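(* Let $\Omega\subset B_{1/2}\subset\mathbb{R}^2$ be a domain. If a sequence $u_k\in H_0^1(\Omega)$ is $D$-weakly convergent to zero, then $u_k\to0$ in $\exp L^2$. In particular, for any $\lambda>0$, $\int_\Omega\left(e^{\lambda u_k^2}-1\right)\,\mathrm{d}x\to0$ as $k\to\infty$.
   Context: $B$ is the open unit disk in $\mathbb{R}^2$ centered at the origin, $B_{1/2}$ the open disk of radius $1/2$ centered at the origin. Points $z\in\mathbb{R}^2$ are identified with complex numbers, and $z^j$ ($j\in\mathbb{N}$) is the complex power. $H_0^1(B)$ and $H_0^1(\Omega)$ carry the norm $\|\nabla u\|_2$; functions in $H_0^1(\Omega)$ are extended by zero. The operator set is $$D=\{g_{j,\zeta}:\ (g_{j,\zeta}u)(z)=j^{-1/2}u(\zeta+z^j),\ z\in B,\ \zeta\in\bar\Omega,\ j\in\mathbb{N}\};$$ each $g_{j,\zeta}$ is a linear isometry from $H_0^1(\Omega)$ to $H_0^1(B)$. A sequence $u_k\in H_0^1(\Omega)$ is $D$-weakly convergent to zero if for every sequence $g_k\in D$ one has $g_ku_k\rightharpoonup0$ weakly in $H_0^1(B)$. $\exp L^2$ is the Orlicz space of the function $e^{t^2}-1$; an equivalent quasinorm is $\sup_{t\in(0,1)}(\log\frac{e}{t})^{-1/2}u^*(t)$, where $u^*$ is the nonincreasing rearrangement of $u$, $u^*(t)=\inf\{s>0:\ |\{|u|>s\}|\le t\}$. *)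

(* Defs.v *)
From HB Require Import structures.
From mathcomp Require Import all_boot all_order all_algebra.
From mathcomp Require Import complex.
From mathcomp Require Import all_classical all_reals all_analysis.

Set Implicit Arguments.
Unset Strict Implicit.
Unset Printing Implicit Defensive.

Import Order.TTheory GRing.Theory Num.Theory.
Import numFieldNormedType.Exports.

Local Open Scope classical_set_scope.
Local Open Scope ring_scope.

(* The plane is R * R. [mplane R] is the same carrier, displayed with the Borel
   sigma-algebra on which the library's product [leb2 R] of two Lebesgue
   measures is defined. Elements of L^2 and H_0^1 are represented by Borel
   functions defined everywhere. *)
Notation mplane R := (measurableTypeR R * measurableTypeR R)%type.
Notation leb2 R := (@lebesgue_measure R \x @lebesgue_measure R)%E.

(* The norm of the normed module R * R is the sup norm, hence a separate
   definition. *)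
Definition euclid (R : realType) (v : R * R) : R :=
  Num.sqrt (v.1 ^+ 2 + v.2 ^+ 2).

Definition disk (R : realType) (r : R) : set (R * R) := [set z | euclid z < r].

Definition cpow (R : realType) (z : R * R) (j : nat) : R * R :=
  let w := Complex z.1 z.2 ^+ j in (complex.Re w, complex.Im w).

Definition domain (R : realType) (Omega : set (R * R)) : Prop :=
  open Omega /\ connected Omega.

Definition L2norm (R : realType) (f : R * R -> R) : \bar R :=
  ('N[leb2 R]_2%:E[(fun z => (f z)%:E)])%E.

Definition e_ (R : realType) (b : bool) : R * R :=
  if b then (0, 1) else (1, 0).

Definition gradient (R : realType) (f : R * R -> R) (z : R * R) : R * R :=
  ('D_(e_ R false) f z, 'D_(e_ R true) f z).

Definition iter_partial (R : realType) (s : seq bool) (f : R * R -> R) :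
    R * R -> R :=
  foldr (fun b h => 'D_(e_ R b) h) f s.

Definition smooth (R : realType) (f : R * R -> R) : Prop :=
  forall s : seq bool, continuous (iter_partial s f) /\
    forall (b : bool) (z : R * R), derivable (iter_partial s f) z (e_ R b).

Definition test_function (R : realType) (Omega : set (R * R))
    (phi : R * R -> R) : Prop :=
  let supp := closure [set z | phi z != 0] in
  [/\ smooth phi, compact supp & supp `<=` Omega].

(* u, extended by zero outside Omega, belongs to H_0^1(Omega), the closure of
   C_c^oo(Omega), and G is (a representative of) its weak gradient. G is unique
   almost everywhere because the gradient is closable in L^2. *)
Definition H01_grad (R : realType) (Omega : set (R * R)) (u : R * R -> R)
    (G : R * R -> R * R) : Prop :=
  [/\ measurable_fun [set: mplane R] u,
      measurable_fun [set: mplane R] (fun z => (G z).1),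
      measurable_fun [set: mplane R] (fun z => (G z).2),
      (forall z, ~ Omega z -> u z = 0) &
      exists phi : nat -> R * R -> R,
        [/\ (forall n, test_function Omega (phi n)),
            L2norm (fun z => phi n z - u z) @[n --> \oo] --> 0%E &
            L2norm (fun z => euclid (gradient (phi n) z - G z)) @[n --> \oo]
              --> 0%E]].

Definition H01 (R : realType) (Omega : set (R * R)) (u : R * R -> R) : Prop :=
  exists G, H01_grad Omega u G.

(* Bounded for the norm ||grad u||_2. A functional is given on representatives;
   boundedness and linearity force it to respect almost everywhere equality. *)
Definition bounded_functional (R : realType) (Omega : set (R * R))
    (ell : (R * R -> R) -> R) : Prop :=
  (forall (a : R) (u v : R * R -> R), H01 Omega u -> H01 Omega v ->
     ell (fun z => a * u z + v z) = a * ell u + ell v) /\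
  (exists C : R, forall u G, H01_grad Omega u G ->
     (`|ell u|%:E <= C%:E * L2norm (fun z => euclid (G z)))%E).

Definition weakly_cvg0 (R : realType) (Omega : set (R * R))
    (w : nat -> R * R -> R) : Prop :=
  forall ell, bounded_functional Omega ell -> ell (w k) @[k --> \oo] --> (0 : R).

Definition gop (R : realType) (j : nat) (zeta : R * R) (u : R * R -> R) :
    R * R -> R :=
  (fun z => j%:R `^ (- 2^-1) * u (zeta + cpow z j)) \_ (disk 1).

Definition opset (R : realType) (Omega : set (R * R)) :
    set ((R * R -> R) -> (R * R -> R)) :=
  [set g | exists (j : nat) (zeta : R * R),
     [/\ (0 < j)%N, closure Omega zeta & g = gop j zeta]].

Definition D_weakly_cvg0 (R : realType) (Omega : set (R * R))
    (u : nat -> R * R -> R) : Prop :=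
  forall g : nat -> (R * R -> R) -> (R * R -> R),
    (forall k, opset Omega (g k)) ->
    weakly_cvg0 (disk 1) (fun k => g k (u k)).

(* The Luxemburg norm of exp L^2(Omega), with value +oo outside this space. *)
Definition expL2_norm (R : realType) (Omega : set (R * R)) (u : R * R -> R) :
    \bar R :=
  ereal_inf [set s%:E | s in [set s : R | 0 < s /\
    (\int[leb2 R]_(z in Omega) (expR ((u z / s) ^+ 2) - 1)%:E <= 1)%E]].

Definition expL2_cvg0 (R : realType) (Omega : set (R * R))
    (u : nat -> R * R -> R) : Prop :=
  (forall k, (expL2_norm Omega (u k) < +oo)%E) /\
  expL2_norm Omega (u k) @[k --> \oo] --> 0%E.

(* Main.v *)
Require Import Defs.
From HB Require Import structures.
From mathcomp Require Import all_boot all_order all_algebra.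
From mathcomp Require Import complex.
From mathcomp Require Import all_classical all_reals all_analysis.
From mathcomp Require Import measurable_realfun ring lra zify.

(* Let A_n(z) be the mean of u over the square of half-side 2^-n centred at z.
   Poincare's inequality on squares and Cauchy-Schwarz give
   |A_b(z) - A_a(z)| <= C |grad u|_2 sqrt(b - a), and averaging the L^1 modulus
   of continuity of u gives int |u - A_N| <= C 2^-N |grad u|_2. Hence, if
   |A_N(z)| <= eps sqrt(N) for all z in Omega, with eps small, then |A_N| <= i/2
   for N of order K i^2 with K as large as we please, the level set {|u| > i} has
   measure O(2^-N), and int (exp(lambda u^2) - 1) is controlled by int |u| and a
   geometric tail.

   Smallness of A_N comes from a single bounded functional. With beta^q = 1/2, let
   S be the sector |y| < x of the annulus beta/2 < |z| < 1/2. For j = q l the power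
   map sends S onto the annulus 2^(-j-l) < |w| < 2^-j, so that the integral over S
   of g_{j,zeta} u is j^(-1/2) |S| A_j(zeta), with |S| of order 1/q, up to an error
   O(q^(-3/2) |grad u|_2). Fixing q large and testing D-weak convergence against
   f |-> int_S f, with zeta and l chosen in the worst possible way for each k,
   yields |A_{ql}(zeta)| <= eps sqrt(ql) for all l and zeta at once.

   The gradient norms are bounded by a gliding hump argument on the functionals
   f |-> int f (Laplacian psi), psi a test function. *)

Set Implicit Arguments.
Unset Strict Implicit.
Unset Printing Implicit Defensive.

Import Order.TTheory GRing.Theory Num.Theory.
Import numFieldNormedType.Exports.

Local Open Scope classical_set_scope.
Local Open Scope ring_scope.

(** * Integration on the plane *)

(** One fixed functional can see all scales because [j^(-1/2)] is the Moser normalisation: a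
    function of gradient norm 1 may have means of order sqrt j at scale 2^-j, and the power map of
    order j spreads the scales just below 2^-j over the fixed set S. The exponent 1/q in beta is the
    source of smallness: the image of S crosses only l = j/q dyadic scales, over which the means
    drift by at most C |grad u| sqrt l, and relative to sqrt j this is a factor q^(-1/2). Since q is
    chosen against this error before the sequence is tested, the gradients must be bounded
    beforehand. Only scales that are multiples of q are reached in this way; any other scale is
    rounded up to such a multiple when the level sets are estimated. A single function has no small
    means, so the finiteness of its exp L^2 norm is obtained from the same estimate by dividing by a
    large s. *)

Section plane_measure.
Variable R : realType.
Implicit Types (f g : R * R -> R) (h : mplane R -> \bar R).
Local Notation leb1 := (@lebesgue_measure R).

(** The topology of [R * R] and the product Borel sigma-algebra of [mplane R] are linked by the
    countable family of boxes with rational corners; boxes that do not lie in [U] are replaced by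
    the empty set. *)
Lemma open_measurable_plane (U : set (R * R)) :
  open U -> measurable (U : set (mplane R)).
Proof.
move=> oU.
pose B (p : (rat * rat) * (rat * rat)) : set (R * R) :=
  `]ratr p.1.1, ratr p.1.2[ `*` `]ratr p.2.1, ratr p.2.2[.
pose C p : set (mplane R) := if pselect (B p `<=` U) then B p else set0.
have -> : U = \bigcup_p C p.
  apply/seteqP; split => [[x y] Uxy|z [p _]]; last first.
    by rewrite /C; case: (pselect _) => // pU /pU.
  have /nbhs_ballP[e /= e0 eU] : nbhs (x, y) U by exact: oU.
  have [p1 /[!in_itv]/= p1P] := @rat_in_itvoo R (x - e) x ltac:(lra).
  have [p2 /[!in_itv]/= p2P] := @rat_in_itvoo R x (x + e) ltac:(lra).
  have [q1 /[!in_itv]/= q1P] := @rat_in_itvoo R (y - e) y ltac:(lra).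
  have [q2 /[!in_itv]/= q2P] := @rat_in_itvoo R y (y + e) ltac:(lra).
  exists ((p1, p2), (q1, q2)) => //; rewrite /C; case: (pselect _) => [?|nU].
    by split; rewrite /= in_itv /=; apply/andP; split; lra.
  exfalso; apply: nU => -[a b] [/=]; rewrite !in_itv /= => /andP[a1 a2] /andP[b1 b2].
  by apply: eU; split; rewrite /= /ball /= ltr_norml; apply/andP; split; lra.
apply: countable_bigcupT_measurable; first exact: countableP.
move=> p; rewrite /C; case: (pselect _) => ? /=; last exact: measurable0.
by apply: measurableX; exact: measurable_itv.
Qed.

Lemma continuous_measurable_plane f :
  continuous f -> measurable_fun [set: mplane R] f.
Proof.
move=> cf; apply: (measurability _ (RGenOInfty.measurableE R)) => //.
move=> _ [_ [x ->] <-]; rewrite setTI; apply: open_measurable_plane.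
by move: cf => /continuousP; apply; exact: interval_open.
Qed.

Lemma measurable_EFin_norm f : measurable_fun [set: mplane R] f ->
  measurable_fun [set: mplane R] (fun z => `|f z|%:E).
Proof. by move=> mf; apply/measurable_EFinP; exact: measurableT_comp. Qed.

Lemma measurable_shift (w : R * R) :
  measurable_fun [set: mplane R] (fun z : mplane R => (z + w)%R : mplane R).
Proof. by apply/measurable_fun_pairP; split; rewrite /comp/=; exact: measurable_funD. Qed.

Lemma tonelli_plane h : measurable_fun [set: mplane R] h ->
  (forall z, (0 <= h z)%E) ->
  (\int[leb2 R]_z h z = \int[leb1]_x \int[leb1]_y h (x, y))%E.
Proof. by move=> mh h0; rewrite fubini_tonelli1. Qed.

Lemma tonelli_plane_swap h : measurable_fun [set: mplane R] h ->
  (forall z, (0 <= h z)%E) ->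
  (\int[leb2 R]_z h z = \int[leb1]_y \int[leb1]_x h (x, y))%E.
Proof. by move=> mh h0; rewrite (tonelli_plane mh h0) (fubini_tonelli h mh h0). Qed.

(** Lebesgue measure is determined by its values on half-open intervals, and [nu], which is [|a|]
    times its image under the affine map, has these values. For [a < 0] the preimages are closed at
    the other end, whence the case distinction. *)
Lemma affine_integral (a b : R) (k : measurableTypeR R -> \bar R) : a != 0 ->
  measurable_fun [set: measurableTypeR R] k -> (forall x, (0 <= k x)%E) ->
  (\int[leb1]_x k x = `|a|%:E * \int[leb1]_x k (a * x + b)%R)%E.
Proof.
move=> a0 mk k0.
have mphi : measurable_fun [set: measurableTypeR R]
    (fun x : R => a * x + b : measurableTypeR R).
  by apply: measurable_funD => //; exact: measurable_funM.
pose phi (x : measurableTypeR R) : measurableTypeR R := a * x + b.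
have [nu [nuS nuI]] : exists nu : {measure set (measurableTypeR R) -> \bar R},
    (forall A, nu A = (`|a|%:E * leb1 (phi @^-1` A))%E) /\
    (\int[nu]_x k x = `|a|%:E * \int[leb1]_x k (phi x))%E.
  unshelve eexists (mscale (NngNum (normr_ge0 a)) (pushforward leb1 phi)) => //.
  by split=> [//|]; rewrite ge0_integral_mscale//= ge0_integral_pushforward.
have nuE A : measurable A -> leb1 A = nu A.
  apply: lebesgue_measure_unique => X [[c d] _ <-].
  rewrite nuS /phi lebesgue_measure_itv/=.
  have [a_gt0|a_lt0|a_eq0] := ltgtP 0 a; last by rewrite -a_eq0 eqxx in a0.
  - rewrite (_ : _ @^-1` _ = `](c - b) / a, (d - b) / a]%classic); last first.
      apply/seteqP; split => x /=; rewrite !in_itv/= ltr_pdivrMr// ler_pdivlMr//;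
      rewrite [x * a]mulrC => /andP[? ?]; apply/andP; split; lra.
    rewrite lebesgue_measure_itv/= !lte_fin ltr_pM2r ?invr_gt0// ltrD2r.
    case: ifP => _; last by rewrite mule0.
    by rewrite -!EFinB -EFinM gtr0_norm//; congr (_%:E); field.
  - rewrite (_ : _ @^-1` _ = `[(d - b) / a, (c - b) / a[%classic); last first.
      apply/seteqP; split => x /=; rewrite !in_itv/= ltr_ndivlMr// ler_ndivrMr//;
      rewrite [x * a]mulrC => /andP[? ?]; apply/andP; split; lra.
    rewrite lebesgue_measure_itv/= !lte_fin ltr_nM2r ?invr_lt0// ltrD2r.
    case: ifP => _; last by rewrite mule0.
    by rewrite -!EFinB -EFinM ltr0_norm//; congr (_%:E); field; rewrite lt_eqF.
rewrite (eq_measure_integral nu); first exact: nuI.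
by move=> A mA _; exact: nuE.
Qed.

Lemma translate_integral (b : R) (k : measurableTypeR R -> \bar R) :
  measurable_fun [set: measurableTypeR R] k -> (forall x, (0 <= k x)%E) ->
  (\int[leb1]_x k (x + b)%R = \int[leb1]_x k x)%E.
Proof.
move=> mk k0; rewrite [RHS](@affine_integral 1 b)// ?oner_eq0// normr1 mul1e.
by under [RHS]eq_integral do rewrite mul1r.
Qed.

Lemma translate_integral_plane (w : R * R) h :
  measurable_fun [set: mplane R] h -> (forall z, (0 <= h z)%E) ->
  (\int[leb2 R]_z h (z + w)%R = \int[leb2 R]_z h z)%E.
Proof.
move=> mh h0.
have mhw : measurable_fun [set: mplane R] (fun z : mplane R => h (z + w)).
  exact: (measurableT_comp mh (measurable_shift w)).
rewrite (tonelli_plane mhw (fun z => h0 _)) (tonelli_plane mh h0).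
transitivity (\int[leb1]_x (fun x => \int[leb1]_y h (x, y)) (x + w.1)%R)%E.
  apply: eq_integral => x _ /=.
  rewrite -(@translate_integral w.2 (fun y => h (x + w.1, y)))//.
  exact: measurable_fun_pair2.
apply: translate_integral => [|x]; last exact: integral_ge0.
exact: measurable_fun_fubini_tonelli_F.
Qed.

(** A quarter turn is an exchange of the coordinates, covered by Tonelli's theorem, and a
    reflection. *)
Lemma rot_integral_plane h :
  measurable_fun [set: mplane R] h -> (forall z, (0 <= h z)%E) ->
  (\int[leb2 R]_z h (- z.2, z.1)%R = \int[leb2 R]_z h z)%E.
Proof.
move=> mh h0.
have mw : measurable_fun [set: mplane R] (fun z : mplane R => (- z.2, z.1)%R : mplane R).
  apply/measurable_fun_pairP; split; rewrite /comp /=.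
    by apply: measurableT_comp => //; exact: measurable_snd.
  exact: measurable_fst.
have mhw : measurable_fun [set: mplane R] (fun z : mplane R => h (- z.2, z.1)).
  exact: (measurableT_comp mh mw).
rewrite (tonelli_plane_swap mhw (fun z => h0 _)) (tonelli_plane mh h0).
rewrite (@affine_integral (-1) 0 (fun x => \int[leb1]_y h (x, y))%E)//; rewrite ?oppr_eq0 ?oner_eq0//.
- rewrite normrN1 mul1e; apply: eq_integral => x _ /=.
  by rewrite mulN1r addr0.
- exact: measurable_fun_fubini_tonelli_F.
- by move=> x; exact: integral_ge0.
Qed.

(** Phrased with real bounds [a] and [b] on the two norms, so that later estimates stay among real
    constants. *)
Lemma cauchy_schwarz (d : measure_display) (T : measurableType d)
    (mu : {measure set T -> \bar R}) (f g : T -> R) (a b : R) :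
  measurable_fun setT f -> measurable_fun setT g -> 0 <= a -> 0 <= b ->
  (\int[mu]_x (f x ^+ 2)%:E <= (a ^+ 2)%:E)%E ->
  (\int[mu]_x (g x ^+ 2)%:E <= (b ^+ 2)%:E)%E ->
  (\int[mu]_x `|f x * g x|%:E <= (a * b)%:E)%E.
Proof.
move=> mf mg a0 b0 fa gb.
have h2 : 2^-1 + 2^-1 = 1 :> R by lra.
have N2 (h : T -> R) (c : R) : 0 <= c ->
    (\int[mu]_x (h x ^+ 2)%:E <= (c ^+ 2)%:E)%E ->
    ('N[mu]_2%:E[EFin \o h] <= c%:E)%E.
  move=> c0 hc; rewrite unlock /=.
  rewrite (_ : c%:E = (c ^+ 2)%:E `^ 2^-1)%E; last first.
    by rewrite poweR_EFin -powR_mulrn// -powRrM mulfV ?pnatr_eq0// powRr1.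
  apply: gt0_ler_poweR; rewrite ?invr_ge0 ?in_itv/= ?andbT ?lee_fin ?leey ?sqr_ge0//.
    by rewrite andbT; apply: integral_ge0 => x _; rewrite lee_fin powR_ge0.
  rewrite (eq_integral (fun x => (h x ^+ 2)%:E))// => x _.
  by rewrite powR_mulrn// real_normK// num_real.
have := @hoelder _ T R mu f g 2 2 mf mg ltac:(lra) ltac:(lra) h2.
rewrite Lnorm1 => /le_trans; apply.
rewrite EFinM; apply: lee_pmul; rewrite ?Lnorm_ge0//; exact: N2.
Qed.

End plane_measure.

(** * Monotone substitution *)

Section substitution.
Variable R : realType.
Local Notation leb1 := (@lebesgue_measure R).

Lemma continuous_measurable_line (f : R -> R) :
  continuous f -> measurable_fun [set: measurableTypeR R] f.
Proof. by move=> cf; apply: continuous_measurable_fun. Qed.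

Lemma derive_continuous (F f : R -> R) :
  (forall x : R, is_derive x 1 F (f x)) -> continuous F.
Proof.
move=> dF x; apply: differentiable_continuous; apply/derivable1_diffP.
by have [] := dF x.
Qed.

Lemma FTC_closed (F f : R -> R) (a b : R) : a <= b ->
  (forall x : R, is_derive x 1 F (f x)) -> continuous f ->
  (\int[leb1]_(x in `[a, b]) (f x)%:E = (F b - F a)%:E)%E.
Proof.
rewrite le_eqVlt => /predU1P[->|ab] dF cf; first by rewrite set_itv1 integral_set1 subrr.
have cF := derive_continuous dF.
rewrite (@continuous_FTC2 _ f F)//.
- exact: continuous_subspaceT.
- split; first by move=> x _; have [] := dF x.
  + by apply: cvg_at_right_filter; exact: cF.
  + by apply: cvg_at_left_filter; exact: cF.
- by move=> x _; rewrite derive1E; have [] := dF x.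
Qed.

Section increasing.
Variables (F f : R -> R) (a b : R).
Hypotheses (ab : a < b) (dF : forall x : R, is_derive x 1 F (f x)).
Hypotheses (cf : continuous f) (f_gt0 : forall x, a < x < b -> 0 < f x).

Let FTC (c d : R) (cd : c <= d) := FTC_closed cd dF cf.

Let incrF : {in `[a, b] &, {homo F : x y / x < y}}.
Proof.
apply: gtr0_derive1_lt_cc => [x _|x|]; first by have [] := dF x.
  rewrite in_itv => /= xab; rewrite derive1E; have [_ ->] := dF x; exact: f_gt0.
by apply: continuous_subspaceT; exact: derive_continuous dF.
Qed.

Let mF : measurable_fun [set: measurableTypeR R] F.
Proof. by apply: continuous_measurable_line; exact: derive_continuous dF. Qed.

Let mf : measurable_fun [set: measurableTypeR R] f.
Proof. exact: continuous_measurable_line. Qed.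

Let Fab : F a < F b.
Proof. by apply: incrF => //; rewrite in_itv/= ?lexx (ltW ab). Qed.

(* [F] crosses the level [c], clamped to [F a, F b], at [c']. *)
Let level (c : R) : exists2 c', a <= c' <= b &
  (forall y, F a < y < F b -> (c < y) = (F c' < y)) /\
  (forall x, a < x < b -> (c < F x) = (c' < x)).
Proof.
have [c' /[!in_itv]/= c'ab Fc'] : exists2 c', c' \in `[a, b] &
    F c' = Num.min (Num.max c (F a)) (F b).
  apply: IVT; [exact: ltW|by apply: continuous_subspaceT; exact: derive_continuous dF|].
  by rewrite (min_idPl (ltW Fab)) (max_idPr (ltW Fab)) ge_min le_min le_max !lexx !orbT (ltW Fab).
have FP y : F a < y < F b -> (c < y) = (F c' < y).
  move=> /andP[ay yb]; rewrite Fc' gt_min gt_max ay andbT.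
  by rewrite [F b < y]ltNge (ltW yb) orbF.
exists c' => //; split => // x xab.
have xI : x \in `[a, b] by rewrite in_itv/=; lra.
have c'I : c' \in `[a, b] by rewrite in_itv.
have aI : a \in `[a, b] by rewrite in_itv/= lexx ltW.
have bI : b \in `[a, b] by rewrite in_itv/= lexx ltW.
rewrite FP; last by rewrite !incrF//; lra.
have [c'x|xc'|<-] := ltgtP c' x; last by rewrite ltxx.
- exact: incrF.
- by apply: le_gtF; apply/ltW/incrF.
Qed.

Let itv_trim (s t p q : R) (h : R -> \bar R) : s <= p -> p <= q -> q <= t ->
  measurable_fun [set: measurableTypeR R] h ->
  (\int[leb1]_(x in `]p, q] `&` `]s, t[) h x = \int[leb1]_(x in `[p, q]) h x)%E.
Proof.
move=> sp pq qt mh.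
have mh' (A : set (measurableTypeR R)) : measurable_fun A h by exact: measurable_funS mh.
have -> : (\int[leb1]_(x in `[p, q]) h x = \int[leb1]_(x in `]p, q[) h x)%E.
  by rewrite (@integral_itv_bndoo _ _ _ h true false)//; exact: mh'.
have [qt'|tq] := ltP q t.
  rewrite (_ : _ `&` _ = `]p, q]%classic); last first.
    by apply/seteqP; split => x; rewrite /= !in_itv/=; [move=> [? ?]|move=> ?; split]; lra.
  by rewrite (@integral_itv_bndoo _ _ _ h false false)//; exact: mh'.
rewrite (_ : _ `&` _ = `]p, q[%classic)//.
apply/seteqP; split => x; rewrite /= !in_itv/=; last by move=> ?; split; lra.
by move=> [? ?]; lra.
Qed.

Let D : set (measurableTypeR R) := `]F a, F b[.

(* The subgraph of [f] is pushed forward by [F] on the abscissa; the rest of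
   the plane goes to a point outside [D]. *)
Let sub : set (mplane R) := [set z | a < z.1 < b /\ 0 < z.2 < f z.1].

Let Psi (z : mplane R) : measurableTypeR R := if z \in sub then F z.1 else F a.

Let msub : measurable sub.
Proof.
have -> : sub = (`]a, b[ `*` `]0, +oo[) `&`
    ((fun z : mplane R => f z.1 - z.2) @^-1` `]0, +oo[).
  apply/seteqP; split => z; rewrite /sub/= !in_itv/= ?andbT.
    by move=> [? /andP[? ?]]; split => //; lra.
  by move=> [[? ?] ?]; split => //; lra.
apply: measurableI; first by apply: measurableX; exact: measurable_itv.
rewrite -[X in measurable X]setTI.
have : measurable_fun [set: mplane R] (fun z : mplane R => f z.1 - z.2).
  apply: measurable_funB; last exact: measurable_snd.
  by apply: (measurableT_comp mf); exact: measurable_fst.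
by apply => //; exact: measurable_itv.
Qed.

Let mPsi : measurable_fun [set: mplane R] Psi.
Proof.
apply: measurable_fun_if => //.
- apply: (measurable_fun_bool true).
  rewrite setTI (_ : _ @^-1` _ = sub)//.
  by apply/seteqP; split => z /=; [exact: set_mem|exact: mem_set].
- by apply: (measurable_funS measurableT) => //; apply: (measurableT_comp mF); exact: measurable_fst.
Qed.

Let PsiD (A : set (measurableTypeR R)) : A `<=` D ->
  Psi @^-1` A = [set z | sub z /\ A (F z.1)].
Proof.
move=> AD; apply/seteqP; split => z /=; rewrite /Psi.
  case: ifPn => [/set_mem//|_ /AD]; rewrite /D/= in_itv/= ltxx//.
by case=> [sz]; rewrite mem_set.
Qed.

Lemma sub_integral (h : mplane R -> \bar R) : measurable_fun [set: mplane R] h ->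
  (forall z, (0 <= h z)%E) ->
  (\int[leb2 R]_(z in sub) h z =
   \int[leb1]_(x in `]a, b[) \int[leb1]_(y in `]0%R, f x[) h (x, y))%E.
Proof.
move=> mh h0; rewrite integral_mkcond tonelli_plane//.
- rewrite [RHS]integral_mkcond; apply: eq_integral => x _.
  rewrite patchE; case: ifPn => [/set_mem/=|/negP nx].
    rewrite in_itv/= => xab; rewrite [RHS]integral_mkcond.
    apply: eq_integral => y _; rewrite !patchE.
    have -> : ((x, y) \in sub) = (y \in `]0, f x[%classic).
      by apply/idP/idP => /set_mem/= H; apply/mem_set; move: H;
        rewrite /sub/= in_itv/= => // -[].
    by [].
  apply: integral0_eq => y _; rewrite patchE ifN//; apply/negP => /set_mem[/= xab _].
  by apply: nx; apply/mem_set; rewrite /= in_itv.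
- apply/(measurable_restrictT _ _).1 => //; exact: measurable_funS mh.
- by move=> z; rewrite patchE; case: ifP.
Qed.

Let Psi_integral (k : measurableTypeR R -> \bar R) :
  measurable_fun [set: measurableTypeR R] k -> (forall x, (0 <= k x)%E) ->
  (\int[leb2 R]_(z in Psi @^-1` D) k (Psi z) =
   \int[leb1]_(x in `]a, b[) (k (F x) * (f x)%:E))%E.
Proof.
move=> mk k0.
have PD : Psi @^-1` D = sub.
  rewrite (PsiD (@subset_refl _ D)); apply/seteqP; split => [z []//|z sz]; split => //.
  have [zab _] : sub z := sz.
  by rewrite /D/= in_itv/= !incrF// ?in_itv/=; lra.
rewrite PD; under eq_integral => z zs do rewrite /Psi zs.
have mkF : measurable_fun [set: measurableTypeR R] (fun x => k (F x)).
  exact: (measurableT_comp mk mF).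
rewrite sub_integral//; last first.
  by apply: (measurableT_comp mkF); exact: measurable_fst.
apply: eq_integral => x /set_mem/=; rewrite in_itv/= => xab.
have L : leb1 `]0%R, f x[ = (f x)%:E.
  by rewrite lebesgue_measure_itv/= lte_fin f_gt0// sube0.
by rewrite -[X in (_ * X)%E]L integral_cst.
Qed.

(** The density [f] is realised by planar Lebesgue measure on the subgraph, so that its image [nu]
    under [F] is a measure by construction. On half-open intervals [nu] agrees with Lebesgue measure
    by the fundamental theorem of calculus, hence on every Borel subset of [D]. *)
Lemma increasing_substitution (k : measurableTypeR R -> \bar R) :
  measurable_fun [set: measurableTypeR R] k -> (forall x, (0 <= k x)%E) ->
  (\int[leb1]_(x in `]F a, F b[) k x =
   \int[leb1]_(x in `]a, b[) (k (F x) * (f x)%:E))%E.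
Proof.
move=> mk k0.
have mD : measurable D by exact: measurable_itv.
have [nu nuS nuI] : exists2 nu : {measure set (measurableTypeR R) -> \bar R},
    (forall A, measurable A -> A `<=` D ->
      nu A = \int[leb1]_(x in `]a, b[) ((\1_A (F x))%:E * (f x)%:E))%E &
    (\int[nu]_(x in D) k x = \int[leb1]_(x in `]a, b[) (k (F x) * (f x)%:E))%E.
  have push_int (h : measurableTypeR R -> \bar R) : measurable_fun [set: measurableTypeR R] h ->
      (forall x, (0 <= h x)%E) ->
      (\int[pushforward (leb2 R) Psi]_(x in D) h x = \int[leb1]_(x in `]a, b[) (h (F x) * (f x)%:E))%E.
    move=> mh h0; rewrite ge0_integral_pushforward//; last exact: measurable_funS mh.
    exact: Psi_integral.
  unshelve eexists (pushforward (leb2 R) Psi) => //; last exact: push_int.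
  move=> A mA AD; rewrite -(push_int (fun x => (\1_A x)%:E))//.
    by rewrite integral_indic// setIidl.
  by apply/measurable_EFinP; exact: measurable_indic.
rewrite -nuI; apply: eq_measure_integral => A mA AD.
(* Restricted to [D], both measures can be compared on all half-open intervals of the line, a family
   stable under intersection that exhausts the line with finite measure. *)
pose m1 : {measure set (measurableTypeR R) -> \bar R} := mrestr leb1 mD.
pose m2 : {measure set (measurableTypeR R) -> \bar R} := mrestr nu mD.
suff : m1 A = m2 A by rewrite /m1 /m2/= /mrestr !setIidl.
have mfin n : (mrestr leb1 mD (`](- n%:R)%R, n%:R%R]%classic) < +oo)%E.
  apply: (@le_lt_trans _ _ (leb1 (`](- n%:R)%R, n%:R%R]%classic : set R))).
    rewrite /mrestr; apply: le_measure; last exact: subIsetl.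
      by rewrite inE; apply: measurableI => //; exact: measurable_itv.
    by rewrite inE; exact: measurable_itv.
  by rewrite lebesgue_measure_itv/=; case: ifP => _; rewrite ltry.
have U := @measure_unique _ R (measurableTypeR R) (@ocitv R) (fun n => `](- n%:R)%R, n%:R%R]%classic).
have := U erefl (@ocitvI R) _ _ m1 m2; apply => //.
- by move=> n; exists (- n%:R, n%:R).
- apply/seteqP; split => // x _; exists (Num.truncn `|x|).+1 => //=; rewrite in_itv/=.
  have := truncnS_gt `|x|; rewrite ltr_norml => /andP[-> /ltW]//.
- move=> X [[c d] _ <-]; rewrite /m1 /m2/= /mrestr.
  have [cd|dc] := ltP c d; last by rewrite /= set_itv_ge ?bnd_simp -?leNgt// set0I !measure0.
  (* The condition [c < F x <= d] on values becomes [c' < x <= d'] on arguments, even if [c] or [d]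
     lies outside []F a, F b[]. *)
  have [c' c'ab [FcP cP]] := level c; have [d' d'ab [FdP dP]] := level d.
  have c'I : c' \in `[a, b] by rewrite in_itv.
  have d'I : d' \in `[a, b] by rewrite in_itv.
  have c'd' : c' <= d'.
    rewrite leNgt; apply/negP => d'c'.
    have [x] : exists x, d' < x < c' by exists ((d' + c') / 2); lra.
    move=> xd'c'; have xab : a < x < b by lra.
    by have := cP _ xab; have := dP _ xab; lra.
  have Fle p q : p \in `[a, b] -> q \in `[a, b] -> p <= q -> F p <= F q.
    by move=> pI qI; rewrite le_eqVlt => /predU1P[->//|pq]; exact/ltW/incrF.
  have aI : a \in `[a, b] by rewrite in_itv/= lexx ltW.
  have bI : b \in `[a, b] by rewrite in_itv/= lexx ltW.
  rewrite nuS; last 2 first.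
    by apply: measurableI => //; exact: measurable_itv.
    exact: subIsetr.
  transitivity (F d' - F c')%:E.
    rewrite (_ : _ `&` D = `]F c', F d'] `&` `]F a, F b[); last first.
      by apply/seteqP; split => y; rewrite /D/= !in_itv/= => -[yI yD]; split => //;
        move: yI; rewrite !(leNgt y) (FcP y yD) (FdP y yD).
    rewrite -[LHS]mul1e -integral_cst/=; last by apply: measurableI; exact: measurable_itv.
    rewrite itv_trim//; last 3 first.
    - by apply: Fle => //; lra.
    - exact: Fle.
    - by apply: Fle => //; lra.
    rewrite integral_cst/=; last exact: measurable_itv.
    rewrite mul1e lebesgue_measure_itv/= lte_fin -EFinD; case: ltP => // h.
    by congr (_%:E); have := Fle _ _ c'I d'I c'd'; lra.
  rewrite -FTC// -(@itv_trim a b)//; last 3 first.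
  - lra.
  - lra.
  - exact/measurable_EFinP.
  rewrite setIC integral_mkcondr; apply: eq_integral => x /set_mem/= /[!in_itv]/= xab.
  have FxD : F a < F x < F b by rewrite !incrF// ?in_itv/=; lra.
  rewrite patchE indicE.
  have -> : (F x \in (`]c, d]%classic `&` D)) = (x \in `]c', d']%classic).
    apply/idP/idP.
      move=> /set_mem[/= + _]; rewrite in_itv/= (leNgt (F x)) cP// dP// => h.
      by apply/mem_set; rewrite /= in_itv/= leNgt.
    move=> /set_mem/=; rewrite in_itv/= (leNgt x) => h.
    by apply/mem_set; split; rewrite /D/= in_itv/= ?(leNgt (F x)) ?cP ?dP.
  by case: ifP => _; rewrite ?mul1e ?mul0e.
Qed.

End increasing.
End substitution.

(** * One-variable calculus along coordinate lines *)

Section slices.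
Variable R : realType.
Implicit Types (f g : R * R -> R).
Local Notation leb1 := (@lebesgue_measure R).

Lemma is_derive_slice1 f (x y : R) : derivable f (x, y) (e_ R false) ->
  is_derive x 1 (fun s => f (s, y)) ('D_(e_ R false) f (x, y)).
Proof.
move=> df; suff E : (fun h : R => h^-1 *: (((fun s => f (s, y)) \o shift x) (h *: (1 : R)) - f (x, y))) =
   (fun h : R => h^-1 *: ((f \o shift (x, y)) (h *: e_ R false) - f (x, y))).
  by split; [rewrite /derivable E|rewrite /derive E].
by apply/funext => h; rewrite /= /e_ /=; congr (_ *: (f (_ , _) - _)); rewrite /= ?scaler0 ?add0r.
Qed.

Lemma is_derive_slice2 f (x y : R) : derivable f (x, y) (e_ R true) ->
  is_derive y 1 (fun s => f (x, s)) ('D_(e_ R true) f (x, y)).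
Proof.
move=> df; suff E : (fun h : R => h^-1 *: (((fun s => f (x, s)) \o shift y) (h *: (1 : R)) - f (x, y))) =
   (fun h : R => h^-1 *: ((f \o shift (x, y)) (h *: e_ R true) - f (x, y))).
  by split; [rewrite /derivable E|rewrite /derive E].
by apply/funext => h; rewrite /= /e_ /=; congr (_ *: (f (_ , _) - _)); rewrite /= ?scaler0 ?add0r.
Qed.

Lemma continuous_slice1 f (y : R) : continuous f -> continuous (fun x => f (x, y)).
Proof.
move=> cf x; apply: (@continuous_comp _ _ _ (fun x => (x, y)) f); last exact: cf.
by apply: (@cvg_pair _ _ _ _ (nbhs _) (nbhs _)); [exact: cvg_id|exact: cvg_cst].
Qed.

Lemma continuous_slice2 f (x : R) : continuous f -> continuous (fun y => f (x, y)).
Proof.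
move=> cf y; apply: (@continuous_comp _ _ _ (fun y => (x, y)) f); last exact: cf.
by apply: (@cvg_pair _ _ _ _ (nbhs _) (nbhs _)); [exact: cvg_cst|exact: cvg_id].
Qed.

(** Enlarging the segment to a fixed set [I] makes the bound independent of the endpoints, so that
    it can be integrated over pairs of points. *)
Lemma FTC_norm_le (F f : R -> R) (I : set (measurableTypeR R)) (x y : R) : measurable I ->
  `[Num.min x y, Num.max x y]%classic `<=` I ->
  (forall x : R, is_derive x 1 F (f x)) -> continuous f ->
  (`|F x - F y|%:E <= \int[leb1]_(s in I) `|f s|%:E)%E.
Proof.
wlog xy : x y / x <= y.
  move=> H; have [xy|yx] : x <= y \/ y <= x by apply/orP; exact: le_total.
    exact: H.
  by rewrite minC maxC distrC; exact: H.
rewrite (min_idPl xy) (max_idPr xy) => mI sI dF cf.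
have mf A : measurable_fun (A : set (measurableTypeR R)) f.
  exact: (measurable_funS measurableT) (continuous_measurable_line cf).
rewrite distrC -abse_EFin -(FTC_closed xy dF cf).
apply: (@le_trans _ _ (\int[leb1]_(s in `[x, y]) `|f s|%:E)%E).
  by apply: le_abse_integral => //; exact/measurable_EFinP.
apply: ge0_subset_integral => //.
by apply/measurable_EFinP; apply: measurableT_comp.
Qed.

Lemma integral_deriv0 (F f : R -> R) (L : R) :
  (forall x : R, is_derive x 1 F (f x)) -> continuous f ->
  (forall x, L <= `|x| -> F x = 0) ->
  (\int[leb1]_(x in `[(- L)%R, L]) (f x)%:E = 0)%E.
Proof.
move=> dF cf F0; have [L0|L0] := leP 0 L; last first.
  by rewrite set_itv_ge ?integral_set0// bnd_simp -ltNge; lra.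
rewrite (FTC_closed _ dF cf); last lra.
by rewrite !F0 ?subrr// ?normrN ger0_norm.
Qed.

End slices.

(** * Sectors and the power map *)

Section polar.
Variable R : realType.
Local Notation leb1 := (@lebesgue_measure R).
Local Notation nsq z := (z.1 ^+ 2 + z.2 ^+ 2 : R).
Implicit Types (v w : mplane R -> \bar R).

Definition sector : set (mplane R) := [set z | `|z.2| < z.1].

Definition radial v (t : R) : \bar R :=
  (\int[leb1]_(r in `]0%R, +oo[) (v ((r * cos t)%R, (r * sin t)%R) * r%:E))%E.

Lemma measurable_invr : measurable_fun [set: measurableTypeR R] (fun x : R => x^-1).
Proof.
have -> : [set: R] = ([set~ 0] `|` [set 0 : R]) by rewrite setUC setUv.
have mC : measurable ([set~ 0] : set R) by apply: measurableC; exact: measurable_set1.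
apply/measurable_funU => //; split; last exact: measurable_fun_set1.
apply: open_continuous_measurable_fun.
  by apply: closed_openC; exact: closed_eq.
by move=> x /set_mem/eqP x0; exact: inv_continuous.
Qed.

Lemma measurable_polar_map v : measurable_fun [set: mplane R] v ->
  measurable_fun [set: mplane R]
    (fun p : mplane R => v (p.2 * cos p.1, p.2 * sin p.1)).
Proof.
move=> mv; apply: (measurableT_comp mv).
have m1 : measurable_fun [set: mplane R] (fun p : mplane R => cos p.1).
  by apply: measurableT_comp; [exact: continuous_measurable_line (@continuous_cos R)|exact: measurable_fst].
have m2 : measurable_fun [set: mplane R] (fun p : mplane R => sin p.1).
  by apply: measurableT_comp; [exact: continuous_measurable_line (@continuous_sin R)|exact: measurable_fst].
by apply/measurable_fun_pairP; split; apply: measurable_funM => //; exact: measurable_snd.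
Qed.

Lemma measurable_radial v : measurable_fun [set: mplane R] v ->
  (forall z, (0 <= v z)%E) -> measurable_fun [set: measurableTypeR R] (radial v).
Proof.
move=> mv v0; rewrite /radial.
under eq_fun do rewrite integral_mkcond.
apply: (measurable_fun_fubini_tonelli_F (m2 := leb1)
  (fun p : mplane R => (((fun r => v (r * cos p.1, r * sin p.1)%R * r%:E) \_ `]0%R, +oo[) p.2)%E)).
  apply: (eq_measurable_fun (((fun p : mplane R => v (p.2 * cos p.1, p.2 * sin p.1)%R * p.2%:E)
     \_ ([set: R] `*` `]0%R, +oo[))%E)).
    move=> p _; rewrite !patchE.
    have -> : (p \in ([set: R] `*` `]0%R, +oo[%classic)) = (p.2 \in `]0%R, +oo[%classic).
      by apply/idP/idP => /set_mem H; apply/mem_set; [case: H|split].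
    by [].
  apply/(measurable_restrictT _ _).1; first by apply: measurableX => //; exact: measurable_itv.
  apply: (measurable_funS measurableT) => //.
  apply: emeasurable_funM; first exact: measurable_polar_map.
  by apply/measurable_EFinP; exact: measurable_snd.
move=> p; rewrite patchE; case: ifPn => // /set_mem/=; rewrite in_itv/= andbT => p0.
by apply: mule_ge0 => //; rewrite lee_fin ltW.
Qed.

Lemma radial_ge0 v t : (forall z, (0 <= v z)%E) -> (0 <= radial v t)%E.
Proof.
move=> v0; apply: integral_ge0 => r /=; rewrite in_itv/= andbT => r0.
by apply: mule_ge0 => //; rewrite lee_fin ltW.
Qed.

Lemma measurable_sector : measurable sector.
Proof.
have -> : sector = (fun z : mplane R => z.1 - `|z.2|) @^-1` `]0, +oo[.
  by apply/seteqP; split => z; rewrite /sector/= in_itv/= andbT subr_gt0.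
rewrite -[X in measurable X]setTI.
have : measurable_fun [set: mplane R] (fun z : mplane R => z.1 - `|z.2|).
  apply: measurable_funB; first exact: measurable_fst.
  by apply: measurableT_comp => //; exact: measurable_snd.
by apply => //; exact: measurable_itv.
Qed.

(** For fixed [x > 0] substitute [y = x t]: the sector becomes the strip of slopes [-1 < t < 1], and
    exchanging the integrals leaves one integral per ray. Polar coordinates on this sector are
    thereby reduced to one-dimensional substitutions. *)
Lemma sector_shear v : measurable_fun [set: mplane R] v ->
  (forall z, (0 <= v z)%E) ->
  (\int[leb2 R]_(z in sector) v z =
   \int[leb1]_(t in `](-1)%R, 1%R[)
     \int[leb1]_(x in `]0%R, +oo[) (v (x, x * t)%R * x%:E))%E.
Proof.
move=> mv v0; rewrite integral_mkcond tonelli_plane; last 2 first.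
- apply/(measurable_restrictT _ _).1; first exact: measurable_sector.
  exact: measurable_funS mv.
- by move=> z; rewrite patchE; case: ifP.
pose g (p : mplane R) : \bar R := (((fun p : mplane R => v (p.1, p.1 * p.2)%R * p.1%:E)
   \_ (`]0%R, +oo[ `*` `](-1)%R, 1%R[)) p)%E.
have mg : measurable_fun [set: mplane R] g.
  apply/(measurable_restrictT _ _).1; first by apply: measurableX => //; exact: measurable_itv.
  apply: (measurable_funS measurableT) => //.
  apply: emeasurable_funM; last by apply/measurable_EFinP; exact: measurable_fst.
  apply: (measurableT_comp mv); apply/measurable_fun_pairP; split; rewrite /comp/=.
    exact: measurable_fst.
  by apply: measurable_funM; [exact: measurable_fst|exact: measurable_snd].
have g0 p : (0 <= g p)%E.
  rewrite /g patchE; case: ifPn => // /set_mem[/=]; rewrite in_itv/= andbT => p0 _.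
  by apply: mule_ge0 => //; rewrite lee_fin ltW.
transitivity (\int[leb1]_x \int[leb1]_y g (x, y))%E.
  apply: eq_integral => x _; have [x0|x0] := ltP 0 x; last first.
    rewrite !integral0_eq// => y _; rewrite /g patchE ifN//; apply/negP => /set_mem.
      by case=> /=; rewrite in_itv/= andbT ltNge x0.
    by rewrite /sector/= => h; have := normr_ge0 y; lra.
  have mS : measurable_fun [set: mplane R] (v \_ sector).
    apply/(measurable_restrictT _ _).1; first exact: measurable_sector.
    exact: measurable_funS mv.
  have S0 z : (0 <= (v \_ sector) z)%E by rewrite patchE; case: ifP.
  rewrite (@affine_integral _ x 0 (fun y => (v \_ sector) (x, y)))//; last 2 first.
  - by rewrite gt_eqF.
  - exact: (measurable_fun_pair2 _ mS).
  rewrite gtr0_norm// -ge0_integralZl//; last 2 first.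
  - apply: (@measurableT_comp _ _ _ _ _ _ (fun y => (v \_ sector) (x, y))).
      exact: (measurable_fun_pair2 _ mS).
    by apply: measurable_funD => //; exact: measurable_funM.
  - by rewrite lee_fin ltW.
  apply: eq_integral => t _; rewrite addr0 /g !patchE/=.
  have -> : ((x, x * t) \in sector) = ((x, t) \in (`]0, +oo[%classic `*` `](-1), 1[%classic)).
    have E : (`|x * t| < x) = (-1 < t < 1).
      by rewrite normrM gtr0_norm// -{2}[x]mulr1 ltr_pM2l// ltr_norml.
    apply/idP/idP => /set_mem H; apply/mem_set; move: H; rewrite /sector/= !in_itv/= andbT E => //.
    by case.
  by case: ifP; rewrite ?mule0// muleC.
rewrite (fubini_tonelli g mg g0) [RHS]integral_mkcond; apply: eq_integral => t _.
rewrite [RHS]patchE; case: ifPn => [/set_mem/=|/negP nt].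
  rewrite in_itv/= => tI; rewrite [RHS]integral_mkcond; apply: eq_integral => x _.
  rewrite /g !patchE/=.
  have -> : ((x, t) \in (`]0, +oo[%classic `*` `](-1), 1[%classic)) = (x \in `]0, +oo[%classic).
    by apply/idP/idP => /set_mem H; apply/mem_set; [case: H|split; rewrite //= in_itv].
  by [].
apply: integral0_eq => x _; rewrite /g patchE ifN//; apply/negP => /set_mem[/= _ tI].
by apply: nt; apply/mem_set.
Qed.

(** The substitution [x = r cos (atan t)] parametrises the ray of slope [t] by arc length. It
    produces the cosine twice, once from [dx] and once from the weight [x], and their product
    [1 / (1 + t^2)] is the derivative of [atan] wanted for the passage from slope to angle. *)
Lemma radial_shear v (t : R) : measurable_fun [set: mplane R] v ->
  (forall z, (0 <= v z)%E) ->
  (\int[leb1]_(x in `]0%R, +oo[) (v (x, x * t)%R * x%:E) =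
   radial v (atan t) * ((1 + t ^+ 2)^-1)%:E)%E.
Proof.
move=> mv v0; set c := cos (atan t).
have c0 : 0 < c by rewrite /c cos_atan invr_gt0 sqrtr_gt0; have := sqr_ge0 t; lra.
have sc : sin (atan t) = c * t.
  by rewrite -[X in _ = _ * X](atanK t) /tan -/c mulrCA mulfV ?mulr1// gt_eqF.
have c2 : c ^+ 2 = (1 + t ^+ 2)^-1.
  by rewrite /c cos_atan exprVn sqr_sqrtr//; have := sqr_ge0 t; lra.
pose h (x : R) : \bar R := (((fun x => v (x, x * t)%R * x%:E) \_ `]0%R, +oo[) x)%E.
have mh : measurable_fun [set: measurableTypeR R] h.
  apply/(measurable_restrictT _ _).1; first exact: measurable_itv.
  apply: (measurable_funS measurableT) => //.
  apply: emeasurable_funM; last exact/measurable_EFinP.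
  apply: (measurableT_comp mv); apply/measurable_fun_pairP; split; rewrite /comp/= //.
  exact: measurable_funM.
have h0 x : (0 <= h x)%E.
  rewrite /h patchE; case: ifPn => // /set_mem; rewrite /= in_itv/= andbT => x0.
  by apply: mule_ge0 => //; rewrite lee_fin ltW.
rewrite integral_mkcond (@affine_integral _ c 0 h)//; last by rewrite gt_eqF.
rewrite gtr0_norm// -ge0_integralZl//; last 2 first.
- apply: (measurableT_comp mh).
  by apply: measurable_funD => //; exact: measurable_funM.
- by rewrite lee_fin ltW.
rewrite muleC /radial -ge0_integralZl//; last 3 first.
- apply: (measurable_funS measurableT) => //.
  apply: emeasurable_funM; last exact/measurable_EFinP.
  apply: (measurableT_comp mv); apply/measurable_fun_pairP; split; rewrite /comp/= //;
  exact: measurable_funM.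
- move=> x /=; rewrite in_itv/= andbT => x0.
  by apply: mule_ge0 => //; rewrite lee_fin ltW.
- by rewrite lee_fin -c2 sqr_ge0.
rewrite [RHS]integral_mkcond; apply: eq_integral => x _.
rewrite addr0 /h !patchE.
have -> : (c * x \in `]0, +oo[%classic) = (x \in `]0, +oo[%classic).
  by apply/idP/idP => /set_mem/=; rewrite in_itv/= andbT => H; apply/mem_set;
     rewrite /= in_itv/= andbT; move: H; rewrite pmulr_rgt0.
case: ifPn => [/set_mem/=|_]; last by rewrite mule0.
rewrite in_itv/= andbT => x0; rewrite sc -c2 -/c (mulrC c x) -mulrA.
by rewrite muleCA [RHS]muleCA -!EFinM; congr (_ * _%:E)%E; ring.
Qed.

Lemma sector_polar v : measurable_fun [set: mplane R] v ->
  (forall z, (0 <= v z)%E) ->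
  (\int[leb2 R]_(z in sector) v z =
   \int[leb1]_(t in `](- (pi / 4))%R, (pi / 4)%R[) radial v t)%E.
Proof.
move=> mv v0; rewrite (sector_shear mv v0).
under eq_integral do rewrite radial_shear//.
have -> : - (pi / 4) = atan (-1) :> R by rewrite atanN atan1.
rewrite -(atan1 R).
rewrite (@increasing_substitution R atan (fun t => (1 + t ^+ 2)^-1) (-1) 1)//.
- by move=> x; apply: cvgV; [have := sqr_ge0 x; lra|apply: cvgD; [exact: cvg_cst|exact: exprn_continuous]].
- by move=> x _; rewrite invr_gt0; have := sqr_ge0 x; lra.
- exact: measurable_radial.
- by move=> t; exact: radial_ge0.
Qed.

Lemma radial_rot v (t : R) : radial v (t + pi / 2) = radial (fun z => v (- z.2, z.1)) t.
Proof.
by rewrite /radial; apply: eq_integral => r _ /=; rewrite cosDpihalf sinDpihalf mulrN.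
Qed.

(** A rotated sector is still part of the plane. The induction rotates [v] instead of the sector, so
    that polar coordinates are used on one sector only. *)
Lemma sector_rot_le (n : nat) v : measurable_fun [set: mplane R] v ->
  (forall z, (0 <= v z)%E) ->
  (\int[leb1]_(t in `](- (pi / 4))%R, (pi / 4)%R[) radial v (t + n%:R * (pi / 2))%R
    <= \int[leb2 R]_z v z)%E.
Proof.
elim: n v => [|n IH] v mv v0.
  under eq_integral do rewrite mul0r addr0.
  rewrite -sector_polar//; apply: ge0_subset_integral => //; exact: measurable_sector.
rewrite -(rot_integral_plane mv v0).
under eq_integral => t _.
  rewrite (_ : t + n.+1%:R * (pi / 2) = t + n%:R * (pi / 2) + pi / 2); last first.
    by rewrite -natr1; ring.
  rewrite radial_rot; over.
apply: IH => //; apply: (measurableT_comp mv); apply/measurable_fun_pairP; split; rewrite /comp/=.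
  by apply: measurableT_comp => //; exact: measurable_snd.
exact: measurable_fst.
Qed.

Lemma radial_periodic (n : nat) v (t : R) : radial v (t + n%:R * (pi *+ 2)) = radial v t.
Proof.
rewrite /radial; apply: eq_integral => r _.
have [-> ->] // : cos (t + n%:R * (pi *+ 2)) = cos t /\ sin (t + n%:R * (pi *+ 2)) = sin t.
elim: n => [|n [IHc IHs]]; first by rewrite mul0r addr0.
rewrite -natr1 (_ : t + (n%:R + 1) * (pi *+ 2) = t + n%:R * (pi *+ 2) + pi *+ 2); last ring.
by rewrite mulr2n addrA !cosDpi !sinDpi !opprK.
Qed.

Lemma integral_itv_chain (h : measurableTypeR R -> \bar R) (a c : R) (B : \bar R) (n : nat) :
  measurable_fun [set: measurableTypeR R] h -> (forall x, (0 <= h x)%E) -> 0 <= c ->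
  (forall i, (i < n)%N ->
     (\int[leb1]_(x in `](a + i%:R * c)%R, (a + i.+1%:R * c)%R]) h x <= B)%E) ->
  (\int[leb1]_(x in `]a, (a + n%:R * c)%R]) h x <= n%:R%:E * B)%E.
Proof.
move=> mh h0 c0; elim: n => [|n IH] H.
  by rewrite mul0r addr0 set_itvoc0 integral_set0 mul0e.
have mhS A : measurable_fun A h by exact: measurable_funS mh.
have nc : 0 <= n%:R * c by apply: mulr_ge0.
have Hn := H n (ltnSn n).
have E : a + n.+1%:R * c = a + n%:R * c + c by rewrite -natr1 mulrDl mul1r addrA.
rewrite E in Hn *; set m := a + n%:R * c in Hn IH *.
have am : a <= m by rewrite /m lerDl.
have -> : `]a, (m + c)%R]%classic = `]a, m]%classic `|` `]m, (m + c)%R]%classic.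
  apply/seteqP; split => x /=; rewrite !in_itv/=.
    by move=> /andP[ax ->]; rewrite ax /= andbT; case: (leP x m) => _; [left|right].
  case=> /andP[h1 h2]; first by rewrite h1 (le_trans h2)// lerDl.
  by rewrite (le_lt_trans am h1).
rewrite ge0_integral_setU//; last first.
  by apply/disj_setPS => x [/=]; rewrite !in_itv/= => /andP[_ xm] /andP[+ _]; rewrite ltNge xm.
rewrite -natr1 EFinD ge0_muleDl ?lee_fin// mul1e.
by apply: leeD => //; apply: IH => i ni; apply: H; exact: ltnW.
Qed.

(** While [t] runs through a quarter turn, [j t] sweeps an angle [j pi / 2]. This range lies in
    [2 j + 1] consecutive quarter turns, each contributing at most the whole integral of [v]; the
    substitution divides by [j], and [(2 j + 1) / j <= 3]. *)
Lemma radial_scale (j : nat) v : (0 < j)%N -> measurable_fun [set: mplane R] v ->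
  (forall z, (0 <= v z)%E) ->
  (\int[leb1]_(t in `](- (pi / 4))%R, (pi / 4)%R[) radial v (j%:R * t)%R
    <= 3%:E * \int[leb2 R]_z v z)%E.
Proof.
move=> j0 mv v0; set B := (\int[leb2 R]_z v z)%E.
have pi0 := @pi_gt0 R.
have mr := measurable_radial mv v0; have r0 t := radial_ge0 t v0.
have jr : 1 <= j%:R :> R by rewrite (ler_nat _ 1).
pose a : R := - (pi / 4) - j%:R * (pi / 2).
have piece i : (\int[leb1]_(x in `](a + i%:R * (pi / 2))%R, (a + i.+1%:R * (pi / 2))%R])
     radial v x <= B)%E.
  (* The piece is the angular interval of the sector shifted by [al], which may be negative. Adding
     [j] full turns, that is [4 j] quarter turns, makes it a shift by [i + 3 j] quarter turns, a
     natural number. *)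
  pose al : R := i%:R * (pi / 2) - j%:R * (pi / 2).
  apply: le_trans (sector_rot_le (i + 3 * j) mv v0).
  rewrite integral_mkcond -(@translate_integral _ al); last 2 first.
  - apply/(measurable_restrictT _ _).1; first exact: measurable_itv.
    exact: measurable_funS mr.
  - by move=> x; rewrite patchE; case: ifP.
  rewrite -(@integral_itv_bndoo _ _ _ _ false false); last first.
    apply: (measurable_funS measurableT) => //; apply: (measurableT_comp mr).
    exact: measurable_funD.
  rewrite [leRHS]integral_mkcond le_eqVlt; apply/orP; left; apply/eqP.
  apply: eq_integral => x _; rewrite !patchE.
  have -> : (x + al \in `](a + i%:R * (pi / 2))%R, (a + i.+1%:R * (pi / 2))%R]%classic) =
            (x \in `](- (pi / 4))%R, (pi / 4)%R]%classic).
    by apply/idP/idP => /set_mem/=; rewrite in_itv/= => H; apply/mem_set; rewrite /= in_itv/=;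
       move: H; rewrite /a /al -[i.+1%:R]natr1 => H; lra.
  case: ifP => // _; rewrite -(radial_periodic j); congr (radial v _).
  by rewrite /al natrD natrM; field.
have := @integral_itv_chain (radial v) a (pi / 2) B (2 * j).+1 mr r0 _ (fun i _ => piece i).
move=> /(_ ltac:(lra)) chain.
apply: (@le_trans _ _ ((j%:R^-1)%:E * ((2 * j).+1%:R%:E * B))%E).
  apply: (@le_trans _ _ ((j%:R^-1)%:E * \int[leb1]_(x in `]a, (a + (2 * j).+1%:R * (pi / 2))%R]) radial v x)%E); last first.
    by apply: lee_wpmul2l => //; rewrite lee_fin invr_ge0.
  rewrite [X in (_ <= _ * X)%E]integral_mkcond (@affine_integral _ j%:R 0); last 3 first.
  - by rewrite gt_eqF//; lra.
  - apply/(measurable_restrictT _ _).1; first exact: measurable_itv.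
    exact: measurable_funS mr.
  - by move=> x; rewrite patchE; case: ifP.
  rewrite ger0_norm// muleA -EFinM mulVf ?mul1e; last by rewrite gt_eqF//; lra.
  rewrite integral_mkcond; apply: ge0_le_integral => //.
  - by move=> x _; rewrite patchE; case: ifP.
  - apply/(measurable_restrictT _ _).1; first exact: measurable_itv.
    apply: (measurable_funS measurableT) => //; apply: (measurableT_comp mr).
    exact: measurable_funM.
  - apply: (@measurableT_comp _ _ _ _ _ _ (_ \_ _)).
      apply/(measurable_restrictT _ _).1; first exact: measurable_itv.
      exact: measurable_funS mr.
    by apply: measurable_funD => //; exact: measurable_funM.
  - move=> x _; rewrite addr0 !patchE; case: ifPn => [/set_mem/=|_]; last by case: ifP.
    rewrite in_itv/= => xI; rewrite ifT//; apply/mem_set; rewrite /= in_itv/= /a.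
    rewrite -[(2 * j).+1%:R]natr1 natrM; apply/andP; split; nra.
rewrite muleA -EFinM; apply: lee_wpmul2r; first exact: integral_ge0.
by rewrite lee_fin ler_pdivrMl; [rewrite -[(2 * j).+1%:R]natr1 natrM; lra|lra].
Qed.

Lemma is_derive_power (j : nat) (x : R) :
  is_derive x 1 (fun x : R => x ^+ j) (j%:R * x ^+ j.-1).
Proof.
have -> : (fun x : R => x ^+ j) = (@id R) ^+ j.
  by apply/funext => y; rewrite exprfctE.
by apply: is_derive_eq; rewrite /GRing.scale/= mulr1.
Qed.

(** With [s = r^j] one has [ds / s = j dr / r], and [r <= 1 / r] for [r <= 1]. On an annulus away
    from 0, replacing [r] by [1 / r] costs only a constant factor. *)
Lemma power_substitution_le (k : measurableTypeR R -> \bar R) (r1 r2 : R) (j : nat) :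
  (0 < j)%N -> 0 < r1 -> r1 < r2 -> r2 <= 1 ->
  measurable_fun [set: measurableTypeR R] k -> (forall x, (0 <= k x)%E) ->
  (\int[leb1]_(r in `]r1, r2[) (k (r ^+ j)%R * r%:E) <=
   (j%:R^-1)%:E * \int[leb1]_(s in `](r1 ^+ j)%R, (r2 ^+ j)%R[) (k s * `|s|^-1%:E))%E.
Proof.
move=> j0 r10 r12 r21 mk k0.
have jr : 1 <= j%:R :> R by rewrite (ler_nat _ 1).
have mki : measurable_fun [set: measurableTypeR R] (fun s => (k s * `|s|^-1%:E)%E).
  apply: emeasurable_funM => //; apply/measurable_EFinP.
  by apply: (measurableT_comp measurable_invr); exact: normr_measurable.
have dF := is_derive_power j.
have cf : continuous (fun x : R => j%:R * x ^+ j.-1).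
  by move=> x; apply: cvgM; [exact: cvg_cst|exact: exprn_continuous].
have f0 x : r1 < x < r2 -> 0 < j%:R * x ^+ j.-1.
  by move=> /andP[xr1 _]; apply: mulr_gt0; [|apply: exprn_gt0]; lra.
rewrite (increasing_substitution r12 dF cf f0 mki); last first.
  by move=> x; apply: mule_ge0 => //; rewrite lee_fin invr_ge0.
have mg : measurable_fun `]r1, r2[%classic
    (fun x : R => k (x ^+ j)%R * (`|x ^+ j|%R^-1)%R%:E * (j%:R * x ^+ j.-1)%R%:E)%E.
  apply: (measurable_funS measurableT) => //; apply: emeasurable_funM.
    by apply: (measurableT_comp mki); exact: measurable_funX.
  by apply/measurable_EFinP; apply: measurable_funM => //; exact: measurable_funX.
have g0 (x : R) : `]r1, r2[%classic x ->
    (0 <= k (x ^+ j)%R * (`|x ^+ j|%R^-1)%R%:E * (j%:R * x ^+ j.-1)%R%:E)%E.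
  rewrite /= in_itv/= => xI; apply: mule_ge0; last by rewrite lee_fin ltW// f0.
  by apply: mule_ge0 => //; rewrite lee_fin invr_ge0.
rewrite -ge0_integralZl ?lee_fin ?invr_ge0//.
apply: ge0_le_integral => //.
- by move=> x /=; rewrite in_itv/= => xI; apply: mule_ge0 => //; rewrite lee_fin; lra.
- apply: (measurable_funS measurableT) => //; apply: emeasurable_funM; last exact/measurable_EFinP.
  by apply: (measurableT_comp mk); exact: measurable_funX.
- by apply: emeasurable_funM.
- move=> x /=; rewrite in_itv/= => xI.
  have x0 : 0 < x by lra.
  have xj : x ^+ j.-1 != 0 by rewrite expf_neq0// gt_eqF.
  have gen (y n : R) : y != 0 -> n != 0 -> n^-1 * ((x * y)^-1 * (n * y)) = x^-1.
    by move=> y0 n0; field; rewrite y0 n0 gt_eqF.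
  rewrite -muleA -EFinM muleCA -EFinM; apply: lee_wpmul2l => //.
  rewrite ger0_norm; last by apply: exprn_ge0; lra.
  rewrite -{2}(prednK j0) exprS gen//; last by rewrite gt_eqF//; lra.
  by rewrite lee_fin -[leRHS]mul1r ler_pdivlMr//; nra.
Qed.

Lemma cpow_polar (r t : R) (j : nat) :
  cpow (r * cos t, r * sin t) j = (r ^+ j * cos (j%:R * t), r ^+ j * sin (j%:R * t)).
Proof.
rewrite /cpow /=; suff -> : (Complex (r * cos t) (r * sin t) : R[i]) ^+ j =
   Complex (r ^+ j * cos (j%:R * t)) (r ^+ j * sin (j%:R * t)) by [].
elim: j => [|j IH]; first by rewrite expr0 mul0r cos0 sin0 expr0 mulr1 mulr0.
rewrite exprS IH -natr1 mulrDl mul1r cosD sinD exprS.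
by apply/eqP; rewrite eq_complex /=; apply/andP; split; apply/eqP; ring.
Qed.

Lemma measurable_cpow (j : nat) :
  measurable_fun [set: mplane R] (fun z : mplane R => cpow z j : mplane R).
Proof.
elim: j => [|j IH].
  by apply/measurable_fun_pairP; split; exact: measurable_cst.
have E (z : R * R) : cpow z j.+1 =
    (z.1 * (cpow z j).1 - z.2 * (cpow z j).2, z.1 * (cpow z j).2 + z.2 * (cpow z j).1).
  by rewrite /cpow exprS; case: (_ ^+ j).
have /measurable_fun_pairP[m1 m2] := IH.
have mf := @measurable_fst _ _ (measurableTypeR R) (measurableTypeR R).
have ms := @measurable_snd _ _ (measurableTypeR R) (measurableTypeR R).
apply/measurable_fun_pairP; split.
  apply: (eq_measurable_fun (fun z : mplane R => z.1 * (cpow z j).1 - z.2 * (cpow z j).2)).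
    by move=> z _; rewrite -[RHS]/((cpow z j.+1).1) E.
  by apply: measurable_funB; exact: measurable_funM.
apply: (eq_measurable_fun (fun z : mplane R => z.1 * (cpow z j).2 + z.2 * (cpow z j).1)).
  by move=> z _; rewrite -[RHS]/((cpow z j.+1).2) E.
by apply: measurable_funD; exact: measurable_funM.
Qed.

Definition annulus (r1 r2 : R) : set (mplane R) :=
  [set z | r1 ^+ 2 < nsq z < r2 ^+ 2].

Lemma measurable_annulus r1 r2 : measurable (annulus r1 r2).
Proof.
have -> : annulus r1 r2 = (fun z : mplane R => nsq z) @^-1` `](r1 ^+ 2), (r2 ^+ 2)[.
  by apply/seteqP; split => z; rewrite /annulus/= in_itv/=.
rewrite -[X in measurable X]setTI.
have : measurable_fun [set: mplane R] (fun z : mplane R => nsq z).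
  by apply: measurable_funD; apply: measurable_funX; [exact: measurable_fst|exact: measurable_snd].
by apply => //; exact: measurable_itv.
Qed.

Lemma nsq_polar (r t : R) : (r * cos t) ^+ 2 + (r * sin t) ^+ 2 = r ^+ 2.
Proof. by rewrite !exprMn -mulrDr cos2Dsin2 mulr1. Qed.

Lemma radial_annulus v (t r1 r2 : R) : 0 < r1 -> r1 < r2 ->
  radial (v \_ (annulus r1 r2)) t =
  (\int[leb1]_(r in `]r1, r2[) (v ((r * cos t)%R, (r * sin t)%R) * r%:E))%E.
Proof.
move=> r10 r12; rewrite /radial integral_mkcond [RHS]integral_mkcond.
apply: eq_integral => r _; rewrite !patchE.
have E : 0 < r -> (((r * cos t, r * sin t) \in annulus r1 r2) = (r \in `]r1, r2[%classic)).
  move=> r0; have -> : ((r * cos t, r * sin t) \in annulus r1 r2) = (r1 < r < r2).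
    by apply/idP/idP => [/set_mem|H]; [|apply/mem_set]; rewrite /annulus/= nsq_polar;
      rewrite !ltr_pXn2r// ?nnegrE; lra.
  by apply/idP/idP => [H|/set_mem/=]; [apply/mem_set; rewrite /= in_itv|rewrite in_itv].
case: ifPn => [/set_mem/=|/negP nr].
  rewrite in_itv/= andbT => r0; rewrite E//; case: ifP => //; by rewrite mul0e.
case: ifPn => // /set_mem/=; rewrite in_itv/= => rI; exfalso; apply: nr; apply/mem_set.
by rewrite /= in_itv/=; lra.
Qed.

(* The power map spreads the sector over about [j / 4] full turns, and its
   Jacobian is of order [j ^+ 2 / |w| ^+ 2] at [w]. *)
Lemma cpow_integral_le (w : mplane R -> \bar R) (r1 r2 : R) (j : nat) : (0 < j)%N ->
  0 < r1 -> r1 < r2 -> r2 <= 1 ->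
  measurable_fun [set: mplane R] w -> (forall z, (0 <= w z)%E) ->
  (\int[leb2 R]_(z in sector `&` annulus r1 r2) w (cpow z j) <=
   (3 / j%:R)%:E *
   \int[leb2 R]_(z in annulus (r1 ^+ j) (r2 ^+ j)) (w z * ((nsq z)^-1)%:E))%E.
Proof.
move=> j0 r10 r12 r21 mw w0.
have r1j : 0 < r1 ^+ j by exact: exprn_gt0.
have r12j : r1 ^+ j < r2 ^+ j by rewrite ltr_pXn2r ?nnegrE//; lra.
have mwc : measurable_fun [set: mplane R] (fun z => w (cpow z j)).
  exact: (measurableT_comp mw (measurable_cpow j)).
have mA := measurable_annulus.
rewrite integral_mkcondr sector_polar; last 2 first.
- by apply/(measurable_restrictT _ _).1 => //; exact: measurable_funS mwc.
- by move=> z; rewrite patchE; case: ifP.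
pose W := ((fun z : mplane R => w z * ((nsq z)^-1)%:E) \_ (annulus (r1 ^+ j) (r2 ^+ j)))%E.
have mW : measurable_fun [set: mplane R] W.
  apply/(measurable_restrictT _ _).1 => //; apply: (measurable_funS measurableT) => //.
  apply: emeasurable_funM => //; apply/measurable_EFinP.
  apply: (measurableT_comp measurable_invr).
  by apply: measurable_funD; apply: measurable_funX; [exact: measurable_fst|exact: measurable_snd].
have W0 z : (0 <= W z)%E.
  rewrite /W patchE; case: ifP => // _; apply: mule_ge0 => //.
  by rewrite lee_fin invr_ge0 addr_ge0 ?sqr_ge0.
rewrite [X in (_ <= _ * X)%E]integral_mkcond -/W.
apply: (@le_trans _ _ (\int[leb1]_(t in `](- (pi / 4))%R, (pi / 4)%R[)
    ((j%:R^-1)%:E * radial W (j%:R * t)%R))%E); last first.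
  have mWj : measurable_fun `](- (pi / 4)), (pi / 4)[%classic (fun t : R => radial W (j%:R * t)).
    apply: (measurable_funS measurableT) => //.
    apply: (measurableT_comp (measurable_radial mW W0)); exact: measurable_funM.
  have W0j t : (0 <= radial W t)%E by exact: radial_ge0.
  rewrite ge0_integralZl ?lee_fin ?invr_ge0//.
  rewrite (mulrC 3) EFinM -muleA; apply: lee_wpmul2l; first by rewrite lee_fin invr_ge0.
  exact: radial_scale.
apply: ge0_le_integral => //.
- by move=> t _; apply: radial_ge0 => z; rewrite patchE; case: ifP.
- apply: (measurable_funS measurableT) => //; apply: measurable_radial.
    by apply/(measurable_restrictT _ _).1 => //; exact: measurable_funS mwc.
  by move=> z; rewrite patchE; case: ifP.
- apply: (measurable_funS measurableT) => //; apply: emeasurable_funM => //.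
  apply: (measurableT_comp (measurable_radial mW W0)); exact: measurable_funM.
move=> t _; rewrite !radial_annulus//.
under eq_integral do rewrite cpow_polar.
have := @power_substitution_le (fun s => w (s * cos (j%:R * t), s * sin (j%:R * t))%R)
  r1 r2 j j0 r10 r12 r21.
move=> /(_ _ (fun s => w0 _)) H; apply: (le_trans (H _)).
  apply: (measurableT_comp mw); apply/measurable_fun_pairP.
  by split; exact: measurable_funM.
rewrite le_eqVlt; apply/orP; left; apply/eqP; congr (_ * _)%E.
(* Along a ray, the weight [1 / s^2] of the plane times the polar factor [s] is the weight [1 / s]
   of the radial substitution. *)
apply: eq_integral => s /set_mem/=; rewrite in_itv/= => sI.
have s0 : 0 < s by lra.
rewrite nsq_polar -muleA -EFinM; congr (_ * _%:E)%E.
by rewrite gtr0_norm//; field; rewrite gt_eqF.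
Qed.

Lemma sector_annulus_area (r1 r2 : R) : 0 < r1 -> r1 < r2 ->
  (\int[leb2 R]_(z in sector `&` annulus r1 r2) 1 =
   (pi / 4 * (r2 ^+ 2 - r1 ^+ 2))%:E)%E.
Proof.
move=> r10 r12; rewrite integral_mkcondr sector_polar; last 2 first.
- by apply/(measurable_restrictT _ _).1; [exact: measurable_annulus|exact: measurable_cst].
- by move=> z; rewrite patchE; case: ifP.
under eq_integral do rewrite radial_annulus//.
have -> : (\int[leb1]_(r in `]r1, r2[) (1 * r%:E) = ((r2 ^+ 2 - r1 ^+ 2) / 2)%:E)%E.
  under eq_integral do rewrite mul1e.
  have mE : measurable_fun `]r1, r2[%classic (fun x : R => x%:E) by exact: (@EFin_measurable R).
  rewrite -(@integral_itv_bndoo _ _ _ (fun x : R => x%:E) true false)//.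
  have dF (x : R) : is_derive x 1 (fun x : R => 2^-1 * x ^+ 2) x.
    have H := is_deriveZ (2^-1 : R) (is_derive_power 2 x).
    by apply: is_derive_eq; rewrite /GRing.scale /= expr1 mulrA mulVf ?mul1r.
  by rewrite (FTC_closed (ltW r12) dF (fun=> cvg_id)); congr (_%:E); field.
rewrite integral_cst; last exact: measurable_itv.
have pi0 := @pi_gt0 R.
rewrite [X in (_ * X)%E]lebesgue_measure_itv/= lte_fin ifT; last lra.
by rewrite -EFinB -EFinM; congr (_%:E); field.
Qed.

End polar.

(** * Test functions *)

Lemma measurable_diff (R : realType) (f : R * R -> R) : measurable_fun [set: mplane R] f ->
  measurable_fun [set: mplane R * mplane R]
    (fun pq : mplane R * mplane R => `|f pq.1 - f pq.2|%:E).
Proof.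
move=> mf; apply/measurable_EFinP; apply: measurableT_comp => //; apply: measurable_funB;
  apply: (measurableT_comp mf); [exact: measurable_fst|exact: measurable_snd].
Qed.

Lemma plane_integralD (R : realType) (S : set (mplane R)) (f g : mplane R -> \bar R) :
  measurable S -> measurable_fun [set: mplane R] f -> measurable_fun [set: mplane R] g ->
  (forall z, (0 <= f z)%E) -> (forall z, (0 <= g z)%E) ->
  (\int[leb2 R]_(z in S) (f z + g z) =
   \int[leb2 R]_(z in S) f z + \int[leb2 R]_(z in S) g z)%E.
Proof.
move=> mS mf mg f0 g0; apply: ge0_integralD => //; exact: measurable_funTS.
Qed.

Lemma measurable_param_integral (d1 d2 : measure_display) (T1 : measurableType d1)
    (T2 : measurableType d2) (R : realType)
    (m2 : {sigma_finite_measure set T2 -> \bar R}) (D : set T2) (f : T1 * T2 -> \bar R) :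
  measurable D -> measurable_fun [set: T1 * T2] f -> (forall z, (0 <= f z)%E) ->
  measurable_fun [set: T1] (fun x => \int[m2]_(y in D) f (x, y))%E.
Proof.
move=> mD mf f0; under eq_fun do rewrite integral_mkcond.
pose g := (f \_ (setT `*` D)).
have mg : measurable_fun [set: T1 * T2] g.
  apply/(measurable_restrictT _ _).1; first exact: measurableX.
  exact: measurable_funS mf.
have g0 z : (0 <= g z)%E by rewrite /g patchE; case: ifP.
apply: (eq_measurable_fun (fubini_F m2 g)); last exact: measurable_fun_fubini_tonelli_F.
move=> x _; rewrite /fubini_F; apply: eq_integral => y _; rewrite /g !patchE.
have -> // : ((x, y) \in setT `*` D) = (y \in D).
by apply/idP/idP => /set_mem h; apply/mem_set; [case: h|split].
Qed.

(* The product measure does not unify with its own sigma-finite instance. *)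
Section plane_measure.
Variable R : realType.

Let leb2_sigma_finite : sigma_finite [set: mplane R] (leb2 R).
Proof.
exists (fun n => `](- n%:R)%R, n%:R[%classic `*` `](- n%:R)%R, n%:R[%classic).
  apply/seteqP; split => // -[x y] _.
  exists (Num.truncn (Num.max `|x| `|y|)).+1 => //=; rewrite !in_itv/= -!ltr_norml.
  have h := truncnS_gt (Num.max `|x| `|y|).
  by split; apply: le_lt_trans h; rewrite le_max lexx ?orbT.
move=> k; have lk : (lebesgue_measure (`](- k%:R)%R, k%:R[%classic : set (measurableTypeR R)) = (k%:R + k%:R)%:E)%E.
  rewrite lebesgue_measure_itv/= lte_fin; case: ltP => [_|?].
    by rewrite -EFinB opprK.
  have k0 := ler0n R k; apply/esym; rewrite (_ : k%:R + k%:R = 0 :> R)//; lra.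
split; first by apply: measurableX; exact: measurable_itv.
rewrite [X in (X < _)%E](_ : _ = ((k%:R + k%:R)%:E * (k%:R + k%:R)%:E)%E) ?ltry//.
by rewrite -lk; exact: product_measure1E.
Qed.

Definition plane_measure : set (mplane R) -> \bar R := leb2 R.

HB.instance Definition _ := Measure.copy plane_measure (leb2 R).

HB.instance Definition _ :=
  Measure_isSigmaFinite.Build _ _ _ plane_measure leb2_sigma_finite.

Lemma measurable_param_plane (d : measure_display) (T : measurableType d)
    (D : set (mplane R)) (f : T * mplane R -> \bar R) :
  measurable D -> measurable_fun [set: T * mplane R] f -> (forall z, (0 <= f z)%E) ->
  measurable_fun [set: T] (fun x => \int[leb2 R]_(y in D) f (x, y))%E.
Proof. exact: (@measurable_param_integral _ _ _ _ _ plane_measure). Qed.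

Lemma fubini_plane (f : mplane R * mplane R -> \bar R) :
  measurable_fun [set: mplane R * mplane R] f -> (forall z, (0 <= f z)%E) ->
  (\int[leb2 R]_p \int[leb2 R]_q f (p, q) = \int[leb2 R]_q \int[leb2 R]_p f (p, q))%E.
Proof. exact: (@fubini_tonelli _ _ _ _ _ plane_measure plane_measure). Qed.

End plane_measure.

(** * Iterated integrals over rectangles *)

Section rectangles.
Variable R : realType.
Local Notation leb1 := (@lebesgue_measure R).
Variables (I J : set (measurableTypeR R)) (f : mplane R -> \bar R).
Hypotheses (mI : measurable I) (mJ : measurable J).
Hypotheses (mf : measurable_fun [set: mplane R] f) (f0 : forall z, (0 <= f z)%E).

Let mfIJ : measurable_fun [set: mplane R] (f \_ (I `*` J)).
Proof.
apply/(measurable_restrictT _ _).1; first exact: measurableX.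
exact: measurable_funS mf.
Qed.

Let fIJ0 z : (0 <= (f \_ (I `*` J)) z)%E.
Proof. by rewrite patchE; case: ifP. Qed.

Lemma rect_integral :
  (\int[leb2 R]_(z in I `*` J) f z = \int[leb1]_(x in I) \int[leb1]_(y in J) f (x, y))%E.
Proof.
rewrite integral_mkcond (tonelli_plane mfIJ fIJ0) [RHS]integral_mkcond.
apply: eq_integral => x _; rewrite patchE; case: ifPn => [/set_mem xI|/negP nx].
  rewrite [RHS]integral_mkcond; apply: eq_integral => y _; rewrite !patchE.
  have -> // : ((x, y) \in I `*` J) = (y \in J).
  by apply/idP/idP => /set_mem h; apply/mem_set; [case: h|split].
apply: integral0_eq => y _; rewrite patchE ifN//; apply/negP => /set_mem[/= xI _].
by apply: nx; apply/mem_set.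
Qed.

Lemma rect_integral_swap :
  (\int[leb2 R]_(z in I `*` J) f z = \int[leb1]_(y in J) \int[leb1]_(x in I) f (x, y))%E.
Proof.
rewrite integral_mkcond (tonelli_plane_swap mfIJ fIJ0) [RHS]integral_mkcond.
apply: eq_integral => y _; rewrite patchE; case: ifPn => [/set_mem yJ|/negP ny].
  rewrite [RHS]integral_mkcond; apply: eq_integral => x _; rewrite !patchE.
  have -> // : ((x, y) \in I `*` J) = (x \in I).
  by apply/idP/idP => /set_mem h; apply/mem_set; [case: h|split].
apply: integral0_eq => x _; rewrite patchE ifN//; apply/negP => /set_mem[/= _ yJ].
by apply: ny; apply/mem_set.
Qed.

End rectangles.

(** Each summand depends on one of the four coordinates of [p] and [q]; the other three integrate to
    [h] each. *)
Lemma rect_integral_sum (R : realType) (I J : set (measurableTypeR R)) (h : R)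
    (A B : measurableTypeR R -> \bar R) : 0 <= h ->
  measurable I -> measurable J ->
  (@lebesgue_measure R) I = h%:E -> (@lebesgue_measure R) J = h%:E ->
  measurable_fun [set: measurableTypeR R] A -> measurable_fun [set: measurableTypeR R] B ->
  (forall x, (0 <= A x)%E) -> (forall x, (0 <= B x)%E) ->
  (\int[leb2 R]_(p in I `*` J) \int[leb2 R]_(q in I `*` J) (A p.2 + B q.1) =
   (h ^+ 3)%:E * (\int[@lebesgue_measure R]_(y in J) A y +
                 \int[@lebesgue_measure R]_(x in I) B x))%E.
Proof.
move=> h0 mI mJ lI lJ mA mB A0 B0.
have h0E : (0 <= h%:E)%E by rewrite lee_fin.
set S := I `*` J.
have mS : measurable S by exact: measurableX.
have mA2 : measurable_fun [set: mplane R] (fun z => A z.2).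
  by apply: (measurableT_comp mA); exact: measurable_snd.
have mB1 : measurable_fun [set: mplane R] (fun z => B z.1).
  by apply: (measurableT_comp mB); exact: measurable_fst.
have lS : (leb2 R) S = (h ^+ 2)%:E by transitivity ((@lebesgue_measure R) I * (@lebesgue_measure R) J)%E; [exact: product_measure1E|rewrite lI lJ -EFinM expr2].
have IA : (\int[leb2 R]_(z in S) A z.2 = h%:E * \int[@lebesgue_measure R]_(y in J) A y)%E.
  rewrite (rect_integral_swap mI mJ mA2 (fun z => A0 z.2)).
  rewrite -ge0_integralZl//; last exact: measurable_funTS mA.
  by apply: eq_integral => y _; rewrite /= muleC -lI; exact: integral_cst.
have IB : (\int[leb2 R]_(z in S) B z.1 = h%:E * \int[@lebesgue_measure R]_(y in I) B y)%E.
  rewrite (rect_integral mI mJ mB1 (fun z => B0 z.1)).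
  rewrite -ge0_integralZl//; last exact: measurable_funTS mB.
  by apply: eq_integral => y _; rewrite /= muleC -lJ; exact: integral_cst.
have KA0 : (0 <= \int[@lebesgue_measure R]_(y in J) A y)%E by exact: integral_ge0.
have KB0 : (0 <= \int[@lebesgue_measure R]_(y in I) B y)%E by exact: integral_ge0.
have inner p : (\int[leb2 R]_(q in S) (A p.2 + B q.1) =
    (h ^+ 2)%:E * A p.2 + h%:E * \int[@lebesgue_measure R]_(y in I) B y)%E.
  rewrite ge0_integralD//; last exact: measurable_funTS mB1.
  by rewrite IB; congr (_ + _)%E; rewrite muleC -lS; exact: integral_cst.
under eq_integral do rewrite inner.
rewrite ge0_integralD//; last 3 first.
- by move=> p _; rewrite mule_ge0// lee_fin exprn_ge0.
- by apply: emeasurable_funM => //; exact: measurable_funTS mA2.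
- by move=> p _; rewrite mule_ge0.
rewrite ge0_integralZl ?lee_fin ?exprn_ge0//; last exact: measurable_funTS mA2.
have fin (KA KB : \bar R) : (0 <= KA)%E -> (0 <= KB)%E ->
    ((h ^+ 2)%:E * (h%:E * KA) + h%:E * KB * (h ^+ 2)%:E = (h ^+ 3)%:E * (KA + KB))%E.
  move=> k1 k2; rewrite ge0_muleDr// muleA -EFinM -exprSr.
  by rewrite [in X in (_ + X)%E]muleAC -EFinM -exprS.
rewrite [X in (_ * X + _)%E]IA -fin//; congr (_ + _)%E.
transitivity (h%:E * (\int[@lebesgue_measure R]_(y in I) B y) * (leb2 R) S)%E.
  exact: integral_cst.
by rewrite lS.
Qed.

Section test_functions.
Variable R : realType.
Implicit Types (phi psi : R * R -> R).
Local Notation leb1 := (@lebesgue_measure R).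
Local Notation D1 phi := ('D_(e_ R false) phi).
Local Notation D2 phi := ('D_(e_ R true) phi).

(* Continuously differentiable functions vanishing outside the open unit disk;
   only the first derivatives of a test function matter in the estimates. *)
Definition C1disk phi := [/\ continuous phi, continuous (D1 phi), continuous (D2 phi),
  (forall b z, derivable phi z (e_ R b)) &
  forall z, ~ disk 1 z -> [/\ phi z = 0, D1 phi z = 0 & D2 phi z = 0]].

Lemma derive_notin_support phi (b : bool) z :
  ~ closure [set z | phi z != 0] z -> 'D_(e_ R b) phi z = 0.
Proof.
move=> nz.
have near0 : \forall x \near z, phi x = 0.
  have : nbhs z (~` closure [set z | phi z != 0]).
    by apply: open_nbhs_nbhs; split => //; apply: closed_openC; exact: closed_closure.
  apply: filterS => x nx; apply/eqP/negP => /negP phx; apply: nx.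
  exact: subset_closure.
have phz : phi z = 0 by exact: nbhs_singleton near0.
rewrite /derive; apply: cvg_lim => //.
apply: cvg_near_cst.
have lim0 : h *: e_ R b + z @[h --> (0:R)^'] --> z.
  rewrite -[X in _ --> X](add0r z) -(scale0r (e_ R b)).
  apply: cvgD; last exact: cvg_cst.
  apply: cvgZr_tmp; exact: nbhs_dnbhs.
near=> h; rewrite phz subr0 /=.
have -> : phi (h *: e_ R b + z) = 0 by near: h; exact: (lim0 _ near0).
by rewrite scaler0.
Unshelve. all: end_near.
Qed.

Lemma test_function_C1disk (Omega : set (R * R)) phi : Omega `<=` disk 1 ->
  test_function Omega phi -> C1disk phi.
Proof.
move=> Od [sm _ supp].
have [c0 d0] := sm [::]; have [c1 _] := sm [:: false]; have [c2 _] := sm [:: true].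
split=> [||||z nz]; [exact: c0|exact: c1|exact: c2|by []|].
have ns : ~ closure [set z | phi z != 0] z by move=> /supp /Od.
split; last 2 first.
- exact: derive_notin_support.
- exact: derive_notin_support.
- by apply/eqP/negP => /negP phz; apply: ns; exact: subset_closure.
Qed.

Lemma disk_itv (z : R * R) : disk 1 z -> (`|z.1| < 1) * (`|z.2| < 1).
Proof.
rewrite /disk/= /euclid => h.
have {}h : z.1 ^+ 2 + z.2 ^+ 2 < 1.
  rewrite ltNge; apply/negP => h1; move: h; apply/negP; rewrite -leNgt.
  by rewrite -sqrtr1 ler_sqrt// ltW// (lt_le_trans _ h1).
have s1 := sqr_ge0 z.1; have s2 := sqr_ge0 z.2.
by split; rewrite -(@ltr_pXn2r _ 2)// ?nnegrE// expr1n real_normK ?num_real//; lra.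
Qed.

Lemma C1disk_slice1 phi (I : set (measurableTypeR R)) (x x' y : R) : C1disk phi ->
  measurable I -> `[Num.min x x', Num.max x x']%classic `<=` I ->
  (`|phi (x, y) - phi (x', y)|%:E <= \int[leb1]_(s in I) `|D1 phi (s, y)|%:E)%E.
Proof.
move=> [cp c1 _ dp _] mI sI.
apply: (@FTC_norm_le _ (fun s => phi (s, y)) (fun s => D1 phi (s, y))) => //.
- by move=> s; apply: is_derive_slice1.
- exact: (continuous_slice1 c1).
Qed.

Lemma C1disk_slice2 phi (I : set (measurableTypeR R)) (x y y' : R) : C1disk phi ->
  measurable I -> `[Num.min y y', Num.max y y']%classic `<=` I ->
  (`|phi (x, y) - phi (x, y')|%:E <= \int[leb1]_(s in I) `|D2 phi (x, s)|%:E)%E.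
Proof.
move=> [cp _ c2 dp _] mI sI.
apply: (@FTC_norm_le _ (fun s => phi (x, s)) (fun s => D2 phi (x, s))) => //.
- by move=> s; apply: is_derive_slice2.
- exact: (continuous_slice2 c2).
Qed.

Lemma itv_minmax (a b x y : R) : a < x < b -> a < y < b ->
  `[Num.min x y, Num.max x y]%classic `<=` `]a, b[%classic.
Proof.
move=> xab yab s /=; rewrite !in_itv/= ge_min le_max => /andP[/orP[]? /orP[]?]; lra.
Qed.

Definition square (a b h : R) : set (mplane R) :=
  `]a, (a + h)[%classic `*` `]b, (b + h)[%classic.

(* Walk horizontally, then vertically. *)
Lemma C1disk_L1_poincare phi (a b h : R) : C1disk phi -> 0 <= h ->
  (\int[leb2 R]_(p in square a b h) \int[leb2 R]_(q in square a b h) `|(phi p - phi q)%R|%:E <=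
   (h ^+ 3)%:E * \int[leb2 R]_(p in square a b h) (`|D1 phi p|%R + `|D2 phi p|%R)%R%:E)%E.
Proof.
move=> C h0; rewrite /square; set I : set (measurableTypeR R) := `]a, (a + h)[%classic.
set J : set (measurableTypeR R) := `]b, (b + h)[%classic; set S := I `*` J => /=.
have [cp c1 c2 dp _] := C.
have mI : measurable I by exact: measurable_itv.
have mJ : measurable J by exact: measurable_itv.
have mS : measurable S by exact: measurableX.
have lI : leb1 I = h%:E.
  by rewrite /I lebesgue_measure_itv/= lte_fin; case: ltP => [_|?]; rewrite -?EFinB; congr (_%:E); lra.
have lJ : leb1 J = h%:E.
  by rewrite /J lebesgue_measure_itv/= lte_fin; case: ltP => [_|?]; rewrite -?EFinB; congr (_%:E); lra.
have m1 : measurable_fun [set: mplane R] (fun z => `|D1 phi z|%:E).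
  exact: measurable_EFin_norm (continuous_measurable_plane c1).
have m2 : measurable_fun [set: mplane R] (fun z => `|D2 phi z|%:E).
  exact: measurable_EFin_norm (continuous_measurable_plane c2).
have n1 z : (0 <= `|D1 phi z|%:E)%E by rewrite lee_fin.
have n2 z : (0 <= `|D2 phi z|%:E)%E by rewrite lee_fin.
pose A (y : R) := (\int[leb1]_(s in I) `|D1 phi (s, y)|%:E)%E.
pose B (x : R) := (\int[leb1]_(s in J) `|D2 phi (x, s)|%:E)%E.
have A0 y : (0 <= A y)%E by apply: integral_ge0 => s _; rewrite lee_fin.
have B0 x : (0 <= B x)%E by apply: integral_ge0 => s _; rewrite lee_fin.
have mA : measurable_fun [set: measurableTypeR R] A.
  apply: (@measurable_param_integral _ _ _ _ _ leb1 I (fun z => `|D1 phi (z.2, z.1)|%:E) mI).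
    by apply: (measurableT_comp m1); exact: measurable_swap.
  by move=> z; exact: n1.
have mB : measurable_fun [set: measurableTypeR R] B.
  exact: (@measurable_param_integral _ _ _ _ _ leb1 J (fun z => `|D2 phi z|%:E) mJ m2 n2).
have mphi : measurable_fun [set: mplane R] phi by exact: continuous_measurable_plane.
have pt p q : S p -> S q -> (`|phi p - phi q|%:E <= A p.2 + B q.1)%E.
  case: p => x y; case: q => x' y' [/= xI yJ] [/= x'I y'J].
  apply: (@le_trans _ _ (`|phi (x, y) - phi (x', y)|%:E + `|phi (x', y) - phi (x', y')|%:E)%E).
    by rewrite -EFinD lee_fin ler_distD.
  apply: leeD.
    by apply: C1disk_slice1 => //; move: xI x'I; rewrite /I/= !in_itv/=; exact: itv_minmax.
  by apply: C1disk_slice2 => //; move: yJ y'J; rewrite /J/= !in_itv/=; exact: itv_minmax.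
have mdiff : measurable_fun [set: mplane R * mplane R] (fun pq : mplane R * mplane R => `|phi pq.1 - phi pq.2|).
  by apply: measurableT_comp => //; apply: measurable_funB;
    apply: (measurableT_comp mphi); [exact: measurable_fst|exact: measurable_snd].
have K1 : (\int[leb2 R]_(z in S) `|D1 phi z|%:E = \int[leb1]_(y in J) A y)%E.
  exact: (rect_integral_swap mI mJ m1 n1).
have K2 : (\int[leb2 R]_(z in S) `|D2 phi z|%:E = \int[leb1]_(x in I) B x)%E.
  exact: (rect_integral mI mJ m2 n2).
have -> : (\int[leb2 R]_(p in S) (`|D1 phi p|%R + `|D2 phi p|%R)%R%:E =
   \int[leb1]_(y in J) A y + \int[leb1]_(x in I) B x)%E.
  rewrite -K1 -K2; exact: (plane_integralD mS m1 m2 n1 n2).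
clearbody A B; rewrite -(rect_integral_sum h0 mI mJ lI lJ mA mB A0 B0).
have mA2 : measurable_fun [set: mplane R] (fun z => A z.2).
  by apply: (measurableT_comp mA); exact: measurable_snd.
have mB1 : measurable_fun [set: mplane R] (fun z => B z.1).
  by apply: (measurableT_comp mB); exact: measurable_fst.
apply: ge0_le_integral => //.
- by move=> p _; apply: integral_ge0 => q _; rewrite lee_fin.
- have md : measurable_fun [set: mplane R * mplane R]
      (fun pq : mplane R * mplane R => `|phi pq.1 - phi pq.2|%:E) by exact/measurable_EFinP.
  have nd (pq : mplane R * mplane R) : (0 <= `|phi pq.1 - phi pq.2|%:E)%E by rewrite lee_fin.
  have H := measurable_param_plane mS md nd.
  by apply: measurable_funTS; exact: H.
- have ms : measurable_fun [set: mplane R * mplane R]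
      (fun pq : mplane R * mplane R => A pq.1.2 + B pq.2.1)%E.
    apply: emeasurable_funD.
      by apply: (measurableT_comp mA2); exact: measurable_fst.
    by apply: (measurableT_comp mB1); exact: measurable_snd.
  have ns (pq : mplane R * mplane R) : (0 <= A pq.1.2 + B pq.2.1)%E by exact: adde_ge0.
  have H := measurable_param_plane mS ms ns.
  by apply: measurable_funTS; exact: H.
- move=> p Sp; apply: ge0_le_integral => //.
  + apply: measurable_funTS; apply/measurable_EFinP; exact: (measurable_fun_pair2 p mdiff).
  + by apply: measurable_funTS; apply: emeasurable_funD => //; exact: measurable_cst.
  + by move=> q Sq; exact: pt.
Qed.

(** The increment is at most the integral of [|f (x + t)|] over [0 <= t <= w]. After exchanging the
    integrals, the inner one is the whole integral of [|f|] for every [t]. A negative [w] is reduced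
    to a positive one by translation. *)
Lemma translate_line_le (F f : R -> R) (w : R) :
  (forall x : R, is_derive x 1 F (f x)) -> continuous f ->
  (\int[leb1]_x `|F (x + w)%R - F x|%:E <= `|w|%:E * \int[leb1]_x `|f x|%:E)%E.
Proof.
wlog w0 : w / 0 <= w.
  move=> H dF cf; have [w0|w0] : 0 <= w \/ 0 <= - w by apply/orP; lra.
    exact: H.
  have cF := derive_continuous dF.
  have mF := continuous_measurable_line cF.
  have := H _ w0 dF cf; rewrite normrN; apply: le_trans.
  rewrite -(@translate_integral _ w (fun x => `|F (x + - w)%R - F x|%:E)).
  - rewrite le_eqVlt; apply/orP; left; apply/eqP; apply: eq_integral => x _.
    by rewrite addrK distrC.
  - apply/measurable_EFinP; apply: measurableT_comp => //; apply: measurable_funB => //.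
    by apply: (measurableT_comp mF); exact: measurable_funD.
  - by move=> x; rewrite lee_fin.
move=> dF cf; have cF := derive_continuous dF.
have mF := continuous_measurable_line cF.
have mf := continuous_measurable_line cf.
have mI : measurable (`[0, w]%classic : set (measurableTypeR R)) by exact: measurable_itv.
have mnf : measurable_fun [set: measurableTypeR R] (fun x => `|f x|%:E).
  by apply/measurable_EFinP; exact: measurableT_comp.
have mg : measurable_fun [set: mplane R] (fun z : mplane R => `|f (z.1 + z.2)|%:E).
  apply: (measurableT_comp mnf); apply: measurable_funD; [exact: measurable_fst|exact: measurable_snd].
have g0 (z : mplane R) : (0 <= `|f (z.1 + z.2)|%:E)%E by rewrite lee_fin.
apply: (@le_trans _ _ (\int[leb1]_(x in setT) \int[leb1]_(t in `[0%R, w]) `|f (x + t)%R|%:E)%E).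
  apply: ge0_le_integral => //.
  - apply/measurable_EFinP; apply: measurableT_comp => //; apply: measurable_funB => //.
    by apply: (measurableT_comp mF); exact: measurable_funD.
  - exact: (@measurable_param_integral _ _ _ _ _ leb1 `[0, w]%classic _ mI mg g0).
  move=> x _.
  apply: (@le_trans _ _ (\int[leb1]_(s in `[x, (x + w)%R]) `|f s|%:E)%E).
    apply: FTC_norm_le => //.
    by move=> s; rewrite (max_idPl _) ?(min_idPr _)//; lra.
  rewrite integral_mkcond -(@translate_integral _ x); last 2 first.
  - apply/(measurable_restrictT _ _).1; [exact: measurable_itv|exact: measurable_funTS].
  - by move=> s; rewrite patchE; case: ifP => // _; rewrite lee_fin.
  rewrite [leRHS]integral_mkcond le_eqVlt; apply/orP; left; apply/eqP.
  apply: eq_integral => t _; rewrite !patchE.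
  have -> : (t + x \in `[x, (x + w)%R]%classic) = (t \in `[0, w]%classic).
    by apply/idP/idP => /set_mem/=; rewrite in_itv/= => h; apply/mem_set; rewrite /= in_itv/=; lra.
  by rewrite addrC.
rewrite -(rect_integral measurableT mI mg g0) (rect_integral_swap measurableT mI mg g0) /=.
rewrite (eq_integral (fun=> \int[leb1]_x `|f x|%:E)%E); last first.
  move=> t _; apply: (@translate_integral _ t (fun x => `|f x|%:E) mnf) => x.
  by rewrite lee_fin.
rewrite le_eqVlt; apply/orP; left; apply/eqP.
have lI : leb1 `[0, w]%classic = w%:E.
  by rewrite lebesgue_measure_itv/= lte_fin sube0; case: ltP => // ?; congr (_%:E); lra.
by rewrite ger0_norm// muleC -lI; exact: integral_cst.
Qed.

Lemma addpE (a b : R * R) : a + b = (a.1 + b.1, a.2 + b.2).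
Proof. by []. Qed.

Lemma C1disk_translate_le phi (w : R * R) : C1disk phi ->
  (\int[leb2 R]_z `|phi (z + w)%R - phi z|%:E <=
   `|w.1|%:E * \int[leb2 R]_z `|D1 phi z|%:E + `|w.2|%:E * \int[leb2 R]_z `|D2 phi z|%:E)%E.
Proof.
move=> [cp c1 c2 dp _].
have mphi := continuous_measurable_plane cp.
have m1 : measurable_fun [set: mplane R] (fun z => `|D1 phi z|%:E).
  exact: measurable_EFin_norm (continuous_measurable_plane c1).
have m2 : measurable_fun [set: mplane R] (fun z => `|D2 phi z|%:E).
  exact: measurable_EFin_norm (continuous_measurable_plane c2).
have n1 z : (0 <= `|D1 phi z|%:E)%E by rewrite lee_fin.
have n2 z : (0 <= `|D2 phi z|%:E)%E by rewrite lee_fin.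
have mt (v : R * R) : measurable_fun [set: mplane R] (fun z : mplane R => phi (z + v)).
  exact: (measurableT_comp mphi (measurable_shift v)).
have md (v v' : R * R) : measurable_fun [set: mplane R] (fun z : mplane R => `|phi (z + v) - phi (z + v')|%:E).
  apply/measurable_EFinP; apply: measurableT_comp => //; exact: measurable_funB.
have nd (v v' z : R * R) : (0 <= `|phi (z + v) - phi (z + v')|%:E)%E by rewrite lee_fin.
(* The displacement is split into a vertical and a horizontal one; the summand [+ 0] gives both
   increments the shape treated by [md] and [nd]. *)
apply: (@le_trans _ _ (\int[leb2 R]_z (`|phi (z + w)%R - phi (z + (0, w.2))%R|%:E +
    `|phi (z + (0, w.2))%R - phi (z + 0)%R|%:E))%E).
  apply: ge0_le_integral => //.
  - apply/measurable_EFinP; apply: measurableT_comp => //; exact: measurable_funB.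
  - exact: emeasurable_funD.
  - by move=> z _; rewrite -EFinD lee_fin addr0 ler_distD.
rewrite ge0_integralD//; apply: leeD.
- have e z : (0 <= `|D1 phi (z + (0, w.2))|%:E)%E by rewrite lee_fin.
  rewrite -(@translate_integral_plane _ (0, w.2) (fun z => `|D1 phi z|%:E) m1 n1).
  have m1' : measurable_fun [set: mplane R] (fun z => `|D1 phi (z + (0, w.2))|%:E).
    exact: (measurableT_comp m1 (measurable_shift _)).
  rewrite (tonelli_plane_swap (md _ _) (nd _ _)) (tonelli_plane_swap m1' e).
  rewrite -ge0_integralZl ?lee_fin//; last 2 first.
  - exact: (measurable_param_integral leb1 measurableT (measurableT_comp m1' (@measurable_swap _ _ _ _)) (fun z => e (z.2, z.1))).
  - by move=> y _; apply: integral_ge0 => x _; exact: e.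
  apply: ge0_le_integral => //.
  - by move=> y _; apply: integral_ge0 => x _; exact: nd.
  - exact: (measurable_param_integral leb1 measurableT (measurableT_comp (md _ _) (@measurable_swap _ _ _ _)) (fun z => nd _ _ (z.2, z.1))).
  - apply: emeasurable_funM => //.
    exact: (measurable_param_integral leb1 measurableT (measurableT_comp m1' (@measurable_swap _ _ _ _)) (fun z => e (z.2, z.1))).
  move=> y _.
  have := @translate_line_le (fun s => phi (s, y + w.2)) (fun s => D1 phi (s, y + w.2)) w.1.
  have dF (x : R) : is_derive x 1 (fun s => phi (s, y + w.2)) (D1 phi (x, y + w.2)).
    exact: is_derive_slice1.
  have E1 : (\int[leb1]_x `|D1 phi ((x, y) + (0, w.2))|%:E =
      \int[leb1]_x `|D1 phi (x, y + w.2)|%:E)%E.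
    by apply: eq_integral => x _; rewrite addpE/= addr0.
  have E2 : (\int[leb1]_x `|phi ((x, y) + w) - phi ((x, y) + (0, w.2))|%:E =
      \int[leb1]_x `|phi (x + w.1, y + w.2)%R - phi (x, y + w.2)%R|%:E)%E.
    by apply: eq_integral => x _; rewrite !addpE/= addr0.
  by move=> /(_ dF (continuous_slice1 c1)); rewrite E1 E2.
- rewrite (tonelli_plane (md _ _) (nd _ _)) (tonelli_plane m2 n2).
  rewrite -ge0_integralZl ?lee_fin//; last 2 first.
  - exact: (measurable_param_integral leb1 measurableT m2 n2).
  - by move=> y _; apply: integral_ge0 => x _; exact: n2.
  apply: ge0_le_integral => //.
  - by move=> y _; apply: integral_ge0 => x _; exact: nd.
  - exact: (measurable_param_integral leb1 measurableT (md _ _) (nd _ _)).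
  - apply: emeasurable_funM => //.
    exact: (measurable_param_integral leb1 measurableT m2 n2).
  move=> x _.
  have := @translate_line_le (fun s => phi (x, s)) (fun s => D2 phi (x, s)) w.2.
  have dF (y : R) : is_derive y 1 (fun s => phi (x, s)) (D2 phi (x, y)).
    exact: is_derive_slice2.
  have E2 : (\int[leb1]_y `|phi ((x, y) + (0, w.2)) - phi ((x, y) + 0)|%:E =
      \int[leb1]_y `|phi (x, y + w.2)%R - phi (x, y)|%:E)%E.
    by apply: eq_integral => y _; rewrite !addpE/= !addr0.
  by move=> /(_ dF (continuous_slice2 c2)); rewrite E2.
Qed.

End test_functions.

(** * Functions in H^1_0 *)

Section L2.
Variable R : realType.
Implicit Types (f g : R * R -> R).

Lemma L2norm_sqr f : ((L2norm f) `^ 2 = \int[leb2 R]_z (f z ^+ 2)%:E)%E.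
Proof.
rewrite /L2norm poweR_Lnorm ?pnatr_eq0//; apply: eq_integral => z _ /=.
by rewrite powR_mulrn// real_normK// num_real.
Qed.

Lemma L2norm_ge0 f : (0 <= L2norm f)%E.
Proof. exact: Lnorm_ge0. Qed.

Lemma L2norm_le_sqr f (a : R) : (L2norm f <= a%:E)%E ->
  (\int[leb2 R]_z (f z ^+ 2)%:E <= (a ^+ 2)%:E)%E.
Proof.
have := L2norm_ge0 f; have := L2norm_sqr f; case: (L2norm f) => [r| |]//.
rewrite poweR_EFin => <-; rewrite !lee_fin => r0 ra.
by rewrite powR_mulrn// lerXn2r// nnegrE// (le_trans r0).
Qed.

Lemma L2norm_eq f (a : R) : 0 <= a ->
  (\int[leb2 R]_z (f z ^+ 2)%:E = (a ^+ 2)%:E)%E -> L2norm f = a%:E.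
Proof.
move=> a0; have := L2norm_ge0 f; have := L2norm_sqr f; case: (L2norm f) => [r| |]//.
  rewrite poweR_EFin => <-; rewrite !lee_fin => r0 [].
  by rewrite powR_mulrn// => /eqP; rewrite eqrXn2// => /eqP ->.
by rewrite /poweR pnatr_eq0/= => <-.
Qed.

Lemma cauchy_schwarz_set f (S : set (mplane R)) (a s : R) :
  measurable S -> measurable_fun [set: mplane R] f -> 0 <= a -> 0 <= s ->
  (\int[leb2 R]_z (f z ^+ 2)%:E <= (a ^+ 2)%:E)%E ->
  ((leb2 R) S <= (s ^+ 2)%:E)%E ->
  (\int[leb2 R]_(z in S) `|f z|%:E <= (a * s)%:E)%E.
Proof.
move=> mS mf a0 s0 fa Ss.
have m1 : measurable_fun [set: mplane R] (\1_S : mplane R -> R) by exact: measurable_indic.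
have := @cauchy_schwarz R _ _ (leb2 R) f (\1_S) a s mf m1 a0 s0 fa.
move=> H; have /H : (\int[leb2 R]_x (\1_S x ^+ 2)%:E <= (s ^+ 2)%:E)%E.
  rewrite (eq_integral (fun x => (\1_S x)%:E)); first by rewrite integral_indic// setIT.
  by move=> z _; rewrite indicE; case: (_ \in _); rewrite ?expr1n ?expr0n.
apply: le_trans; rewrite le_eqVlt; apply/orP; left; apply/eqP.
rewrite [LHS]integral_mkcond; apply: eq_integral => z _; rewrite patchE indicE.
by case: (_ \in _); rewrite ?mulr1 ?mulr0 ?normr0.
Qed.

Lemma square_area (a b h : R) : 0 <= h ->
  (leb2 R) (square a b h) = (h ^+ 2)%:E.
Proof.
move=> h0; rewrite /square; have l (c : R) : lebesgue_measure (`]c, (c + h)[%classic : set (measurableTypeR R)) = h%:E.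
  by rewrite lebesgue_measure_itv/= lte_fin; case: ltP => [_|?]; rewrite -?EFinB; congr (_%:E); lra.
transitivity (lebesgue_measure (`]a, (a + h)%R[%classic : set (measurableTypeR R)) *
  lebesgue_measure (`]b, (b + h)%R[%classic : set (measurableTypeR R)))%E.
  by apply: product_measure1E; exact: measurable_itv.
by rewrite !l -EFinM expr2.
Qed.

Lemma C1disk_bounded (f : R * R -> R) : continuous f -> (forall z, ~ disk 1 z -> f z = 0) ->
  exists2 B, 0 <= B & forall z, `|f z| <= B.
Proof.
move=> cf f0.
have cK : compact (`[(-1)%R, 1%R] `*` `[(-1)%R, 1%R] : set (R * R)).
  by apply: compact_setX; exact: segment_compact.
have /compact_bounded [M [_ HM]] : compact (f @` (`[(-1)%R, 1%R] `*` `[(-1)%R, 1%R])).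
  by apply: continuous_compact => //; exact: continuous_subspaceT.
(* [compact_bounded] grants every bound strictly above [M], hence [M + 1]; the maximum with 0 serves
   the points outside the disk. *)
exists (Num.max 0 (M + 1)); first by rewrite le_max lexx.
move=> z; have [dz|nz] := pselect (disk 1 z); last first.
  by rewrite f0// normr0 le_max lexx.
rewrite le_max; apply/orP; right; apply: HM; first by rewrite ltrDl.
exists z => //; have [z1 z2] := disk_itv dz.
by split; rewrite /= in_itv/= -ler_norml ltW.
Qed.

Lemma measurable_square (a b h : R) : measurable (square a b h).
Proof. by apply: measurableX; exact: measurable_itv. Qed.

(** The square circumscribed about the unit disk. Its area is 4, the origin of the factors 2 and 4
    in the L^1 bounds below. *)
Definition unit_square : set (mplane R) := square (-1) (-1) 2.

Let measurable_unit_square : measurable unit_square := measurable_square _ _ _.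

Lemma disk_unit_square z : disk 1 z -> unit_square z.
Proof.
move=> /disk_itv[z1 z2]; split; rewrite /= in_itv/=; move: z1 z2; rewrite !ltr_norml; lra.
Qed.

Lemma integral_disk f : (forall z, ~ disk 1 z -> f z = 0) ->
  (\int[leb2 R]_z `|f z|%:E = \int[leb2 R]_(z in unit_square) `|f z|%:E)%E.
Proof.
move=> f0; rewrite [RHS]integral_mkcond; apply: eq_integral => z _; rewrite patchE.
case: ifPn => // /negP nz; rewrite f0 ?normr0// => dz; apply: nz; apply/mem_set.
exact: disk_unit_square.
Qed.

Lemma disk_L2_fin (f : R * R -> R) : continuous f -> (forall z, ~ disk 1 z -> f z = 0) ->
  (\int[leb2 R]_z (f z ^+ 2)%:E < +oo)%E.
Proof.
move=> cf f0; have [B B0 fB] := C1disk_bounded cf f0.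
have mf := continuous_measurable_plane cf.
apply: (@le_lt_trans _ _ (\int[leb2 R]_(z in unit_square) (cst (B ^+ 2)%:E z))%E).
  rewrite [leRHS]integral_mkcond; apply: ge0_le_integral => //.
  - by move=> z _; rewrite lee_fin sqr_ge0.
  - by apply/measurable_EFinP; exact: measurable_funX.
  - apply/(measurable_restrictT _ _).1; [exact: measurable_unit_square|exact: measurable_cst].
  - move=> z _; rewrite patchE; case: ifPn => [_|/negP nz].
      by rewrite lee_fin -[f z ^+ 2]real_normK ?num_real// lerXn2r ?nnegrE.
    rewrite f0 ?expr0n// => dz; apply: nz; apply/mem_set; exact: disk_unit_square.
have -> : (\int[leb2 R]_(z in unit_square) (cst (B ^+ 2)%:E z) = (B ^+ 2)%:E * (leb2 R) unit_square)%E.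
  by apply: integral_cst; exact: measurable_unit_square.
by rewrite square_area// -EFinM ltry.
Qed.

Local Notation D1 phi := ('D_(e_ R false) phi).
Local Notation D2 phi := ('D_(e_ R true) phi).

Section H01.
Variables (Omega : set (R * R)) (u : R * R -> R) (G : R * R -> R * R).
Hypotheses (Od : Omega `<=` disk 1) (uG : H01_grad Omega u G).

Let mu : measurable_fun [set: mplane R] u. Proof. by case: uG. Qed.
Let mG1 : measurable_fun [set: mplane R] (fun z => (G z).1). Proof. by case: uG. Qed.
Let mG2 : measurable_fun [set: mplane R] (fun z => (G z).2). Proof. by case: uG. Qed.

Lemma H01_vanish z : ~ disk 1 z -> u z = 0.
Proof. by case: uG => _ _ _ u0 _ nz; apply: u0 => /Od. Qed.

Lemma measurable_sqr f : measurable_fun [set: mplane R] f ->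
  measurable_fun [set: mplane R] (fun z => (f z ^+ 2)%:E).
Proof. by move=> mf; apply/measurable_EFinP; exact: measurable_funX. Qed.

Lemma H01_approx (e : R) : 0 < e -> exists phi : R * R -> R,
  [/\ test_function Omega phi,
      (\int[leb2 R]_z ((phi z - u z) ^+ 2)%:E <= (e ^+ 2)%:E)%E,
      (\int[leb2 R]_z ((D1 phi z - (G z).1) ^+ 2)%:E <= (e ^+ 2)%:E)%E &
      (\int[leb2 R]_z ((D2 phi z - (G z).2) ^+ 2)%:E <= (e ^+ 2)%:E)%E].
Proof.
move=> e0; case: uG => _ _ _ _ [phi [tf c1 c2]].
have e0' : (0 < e%:E)%E by rewrite lte_fin.
have small (a : (\bar R)^nat) : a n @[n --> \oo] --> 0%E -> \forall n \near \oo, (a n <= e%:E)%E.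
  move=> a0; near=> n; apply/ltW; near: n.
  by apply: (a0 [set x | (x < e%:E)%E]); apply: open_nbhs_nbhs; split => //; exact: open_ereal_lt_ereal.
near \oo => n.
exists (phi n).
have u_le : (L2norm (fun z => (phi n z - u z)%R) <= e%:E)%E by near: n; exact: small.
have G_le : (L2norm (fun z => euclid (gradient (phi n) z - G z)%R) <= e%:E)%E.
  by near: n; exact: small.
have C := test_function_C1disk Od (tf n); have [cp k1 k2 _ _] := C.
have md1 : measurable_fun [set: mplane R] (fun z => D1 (phi n) z - (G z).1).
  exact: (measurable_funB (continuous_measurable_plane k1)).
have md2 : measurable_fun [set: mplane R] (fun z => D2 (phi n) z - (G z).2).
  exact: (measurable_funB (continuous_measurable_plane k2)).
have Gs := L2norm_le_sqr G_le.
have E z : euclid (gradient (phi n) z - G z) ^+ 2 =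
    (D1 (phi n) z - (G z).1) ^+ 2 + (D2 (phi n) z - (G z).2) ^+ 2.
  by rewrite /euclid sqr_sqrtr// addr_ge0// sqr_ge0.
have mE : measurable_fun [set: mplane R] (fun z => (euclid (gradient (phi n) z - G z) ^+ 2)%:E).
  apply: (eq_measurable_fun (fun z => ((D1 (phi n) z - (G z).1) ^+ 2)%:E + ((D2 (phi n) z - (G z).2) ^+ 2)%:E)%E).
    by move=> z _; rewrite E EFinD.
  by apply: emeasurable_funD; exact: measurable_sqr.
split => //.
- exact: L2norm_le_sqr.
- apply: le_trans Gs; apply: ge0_le_integral => //.
  + by move=> z _; rewrite lee_fin sqr_ge0.
  + exact: measurable_sqr.
  + by move=> z _; rewrite E lee_fin lerDl sqr_ge0.
- apply: le_trans Gs; apply: ge0_le_integral => //.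
  + by move=> z _; rewrite lee_fin sqr_ge0.
  + exact: measurable_sqr.
  + by move=> z _; rewrite E lee_fin lerDr sqr_ge0.
Unshelve. all: end_near.
Qed.

Lemma sqr_integral_triangle f g : measurable_fun [set: mplane R] f ->
  measurable_fun [set: mplane R] g ->
  (\int[leb2 R]_z (g z ^+ 2)%:E <= 2%:E * \int[leb2 R]_z (f z ^+ 2)%:E +
     2%:E * \int[leb2 R]_z ((f z - g z) ^+ 2)%:E)%E.
Proof.
move=> mf mg.
have mfg : measurable_fun [set: mplane R] (fun z => f z - g z) by exact: measurable_funB.
have nn (k : R * R -> R) z : (0 <= (k z ^+ 2)%:E)%E by rewrite lee_fin sqr_ge0.
have k2 (k : R * R -> R) z : (0 <= 2%:E * (k z ^+ 2)%:E)%E by rewrite mule_ge0.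
have mk2 (k : R * R -> R) : measurable_fun [set: mplane R] k ->
    measurable_fun [set: mplane R] (fun z => 2%:E * (k z ^+ 2)%:E)%E.
  by move=> mk; apply: emeasurable_funM => //; exact: measurable_sqr.
have I1 (k : R * R -> R) : measurable_fun [set: mplane R] k ->
    (2%:E * \int[leb2 R]_z (k z ^+ 2)%:E = \int[leb2 R]_z (2%:E * (k z ^+ 2)%:E))%E.
  by move=> mk; rewrite ge0_integralZl//; exact: measurable_sqr.
rewrite (I1 f mf) (I1 _ mfg).
have A1 := mk2 f mf.
have A2 : measurable_fun [set: mplane R] (fun z => 2%:E * ((f z - g z) ^+ 2)%R%:E)%E := mk2 _ mfg.
have A3 z : (0 <= 2%:E * ((f z - g z) ^+ 2)%R%:E)%E := k2 (fun z => f z - g z) z.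
have D : (\int[leb2 R]_z (2%:E * (f z ^+ 2)%:E) + \int[leb2 R]_z (2%:E * ((f z - g z) ^+ 2)%:E) =
   \int[leb2 R]_z (2%:E * (f z ^+ 2)%:E + 2%:E * ((f z - g z) ^+ 2)%:E))%E.
  by rewrite ge0_integralD.
rewrite D; apply: ge0_le_integral => //.
- exact: measurable_sqr.
- exact: emeasurable_funD.
- move=> z _; rewrite -!EFinM -EFinD lee_fin.
  (* The difference of the two sides is exactly [(2 f - g)^2]. *)
  have := sqr_ge0 (2 * f z - g z); nra.
Qed.

(** [H01_grad] does not assert that [u] and [G] are square integrable. This follows from closeness
    to a single test function, whose values and derivatives are bounded and vanish outside the disk.
    The real number [M] then stands for the gradient norm throughout. *)
Lemma H01_L2 : exists2 M : R, 0 <= M &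
  [/\ (\int[leb2 R]_z (u z ^+ 2)%:E < +oo)%E,
      L2norm (fun z => euclid (G z)) = M%:E,
      (\int[leb2 R]_z ((G z).1 ^+ 2)%:E + \int[leb2 R]_z ((G z).2 ^+ 2)%:E = (M ^+ 2)%:E)%E,
      (\int[leb2 R]_z ((G z).1 ^+ 2)%:E <= (M ^+ 2)%:E)%E &
      (\int[leb2 R]_z ((G z).2 ^+ 2)%:E <= (M ^+ 2)%:E)%E].
Proof.
have [phi [tf u1 g1 g2]] := H01_approx (ltr01 : 0 < 1).
have [cp k1 k2 _ v] := test_function_C1disk Od tf.
have fin f g : continuous f -> measurable_fun [set: mplane R] g -> (forall z, ~ disk 1 z -> f z = 0) ->
    (\int[leb2 R]_z ((f z - g z) ^+ 2)%:E <= (1 ^+ 2)%:E)%E ->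
    (\int[leb2 R]_z (g z ^+ 2)%:E < +oo)%E.
  move=> cf mg f0 fg; have mf := continuous_measurable_plane cf.
  apply: le_lt_trans (sqr_integral_triangle mf mg) _.
  apply: lte_add_pinfty; apply: lte_mul_pinfty => //.
    exact: disk_L2_fin.
  by apply: le_lt_trans fg _; rewrite ltry.
have G1 : (\int[leb2 R]_z ((G z).1 ^+ 2)%:E < +oo)%E.
  by apply: (fin _ _ k1 mG1) => // z /v[].
have G2 : (\int[leb2 R]_z ((G z).2 ^+ 2)%:E < +oo)%E.
  by apply: (fin _ _ k2 mG2) => // z /v[].
have n1 : (0 <= \int[leb2 R]_z ((G z).1 ^+ 2)%:E)%E by apply: integral_ge0 => z _; rewrite lee_fin sqr_ge0.
have n2 : (0 <= \int[leb2 R]_z ((G z).2 ^+ 2)%:E)%E by apply: integral_ge0 => z _; rewrite lee_fin sqr_ge0.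
have [a [a0 Ea]] : exists a : R, 0 <= a /\ (\int[leb2 R]_z ((G z).1 ^+ 2)%:E = a%:E)%E.
  by move: n1 G1; case: (\int[leb2 R]_z _)%E => // r; rewrite lee_fin => r0 _; exists r.
have [b [b0 Eb]] : exists b : R, 0 <= b /\ (\int[leb2 R]_z ((G z).2 ^+ 2)%:E = b%:E)%E.
  by move: n2 G2; case: (\int[leb2 R]_z _)%E => // r; rewrite lee_fin => r0 _; exists r.
have sq : Num.sqrt (a + b) ^+ 2 = a + b by rewrite sqr_sqrtr// addr_ge0.
exists (Num.sqrt (a + b)); first exact: sqrtr_ge0.
split.
- by apply: (fin _ _ cp mu) => // z /v[].
- apply: L2norm_eq; first exact: sqrtr_ge0.
  rewrite sq EFinD -Ea -Eb -ge0_integralD//.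
  + apply: eq_integral => z _; rewrite /euclid sqr_sqrtr ?EFinD//.
    by rewrite addr_ge0// sqr_ge0.
  + by move=> z _; rewrite lee_fin sqr_ge0.
  + exact: measurable_sqr.
  + by move=> z _; rewrite lee_fin sqr_ge0.
  + exact: measurable_sqr.
- by rewrite Ea Eb sq.
- by rewrite Ea sq lee_fin lerDl.
- by rewrite Eb sq lee_fin lerDr.
Qed.

End H01.
End L2.

Section H01_estimates.
Variable R : realType.
Implicit Types (f g : R * R -> R).
Local Notation D1 phi := ('D_(e_ R false) phi).
Local Notation D2 phi := ('D_(e_ R true) phi).
Variables (Omega : set (R * R)) (u : R * R -> R) (G : R * R -> R * R).
Hypotheses (Od : Omega `<=` disk 1) (uG : H01_grad Omega u G).

Let mu : measurable_fun [set: mplane R] u. Proof. by case: uG. Qed.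
Let mG1 : measurable_fun [set: mplane R] (fun z => (G z).1). Proof. by case: uG. Qed.
Let mG2 : measurable_fun [set: mplane R] (fun z => (G z).2). Proof. by case: uG. Qed.
Let H01_approx := H01_approx Od uG.
Let H01_vanish := H01_vanish Od uG.

Lemma H01_L1_small (e : R) phi : 0 <= e -> test_function Omega phi ->
  (\int[leb2 R]_z ((phi z - u z) ^+ 2)%:E <= (e ^+ 2)%:E)%E ->
  (\int[leb2 R]_z `|phi z - u z|%:E <= (e * 2)%:E)%E.
Proof.
move=> e0 tf pu; have [cp _ _ _ v] := test_function_C1disk Od tf.
have m : measurable_fun [set: mplane R] (fun z => phi z - u z).
  by apply: measurable_funB => //; exact: continuous_measurable_plane.
rewrite (integral_disk (f := fun z => phi z - u z)); last first.
  by move=> z nz; rewrite H01_vanish// subr0; have [] := v z nz.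
apply: cauchy_schwarz_set => //; first exact: measurable_square.
by rewrite square_area.
Qed.

Lemma le_integral_norm f g (S : set (mplane R)) : measurable S ->
  measurable_fun [set: mplane R] f -> measurable_fun [set: mplane R] g ->
  (\int[leb2 R]_(z in S) `|f z|%:E <=
   \int[leb2 R]_(z in S) `|g z|%:E + \int[leb2 R]_(z in S) `|f z - g z|%:E)%E.
Proof.
move=> mS mf mg.
have mn (k : R * R -> R) : measurable_fun [set: mplane R] k -> measurable_fun S (fun z => `|k z|%:E).
  by move=> mk; apply: measurable_funTS; apply/measurable_EFinP; exact: measurableT_comp.
have mfg : measurable_fun [set: mplane R] (fun z => f z - g z) by exact: measurable_funB.
have A1 := mn _ mf; have A2 := mn _ mg; have A3 := mn _ mfg.
rewrite -ge0_integralD//; apply: ge0_le_integral => //; first exact: emeasurable_funD.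
by move=> z _; rewrite -EFinD lee_fin -{1}[f z](subrK (g z)) addrC ler_normD.
Qed.

(** Approximation by test functions carries the translation estimate over. The factor [2 M] bounds
    the L^1 norm of a partial derivative, by Cauchy-Schwarz on a square of area 4. *)
Lemma H01_translate_le (M : R) (w : R * R) : 0 <= M ->
  (\int[leb2 R]_z ((G z).1 ^+ 2)%:E <= (M ^+ 2)%:E)%E ->
  (\int[leb2 R]_z ((G z).2 ^+ 2)%:E <= (M ^+ 2)%:E)%E ->
  (\int[leb2 R]_z `|u (z + w)%R - u z|%:E <= ((`|w.1| + `|w.2|) * (2 * M))%:E)%E.
Proof.
move=> M0 G1 G2; apply/lee_addgt0Pr => e0 e0_gt0.
pose c := `|w.1| + `|w.2|.
have c0 : 0 <= c by rewrite addr_ge0.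
(* The total error is [2 c e] from the gradients and [2 e] for each of [u] and its translate. *)
pose e := e0 / (2 * c + 4).
have e_gt0 : 0 < e by rewrite divr_gt0//; lra.
have [phi [tf pu g1 g2]] := H01_approx e_gt0.
have C := test_function_C1disk Od tf; have [cp k1 k2 _ v] := C.
have mp := continuous_measurable_plane cp.
have mw := measurable_shift w.
have grad (f g : R * R -> R) : continuous f -> measurable_fun [set: mplane R] g ->
    (forall z, ~ disk 1 z -> f z = 0) ->
    (\int[leb2 R]_z ((f z - g z) ^+ 2)%:E <= (e ^+ 2)%:E)%E ->
    (\int[leb2 R]_z (g z ^+ 2)%:E <= (M ^+ 2)%:E)%E ->
    (\int[leb2 R]_z `|f z|%:E <= (2 * (M + e))%:E)%E.
  move=> cf mg f0 fg gM; have mf := continuous_measurable_plane cf.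
  rewrite (integral_disk f0).
  apply: le_trans (le_integral_norm (measurable_square _ _ _) mf mg) _.
  have A : ((leb2 R) (square (-1)%R (-1)%R 2%R) <= (2 ^+ 2)%:E)%E by rewrite square_area.
  have e0' : 0 <= e by exact: ltW.
  have mfg : measurable_fun [set: mplane R] (fun z => f z - g z) by exact: measurable_funB.
  have mU : measurable (square (-1) (-1) 2 : set (mplane R)) by exact: measurable_square.
  rewrite mulrDr EFinD ![2 * _]mulrC; apply: leeD; exact: cauchy_schwarz_set.
have b1 : (\int[leb2 R]_z `|D1 phi z|%:E <= (2 * (M + e))%:E)%E.
  by apply: (grad _ _ k1 mG1) => // z /v[].
have b2 : (\int[leb2 R]_z `|D2 phi z|%:E <= (2 * (M + e))%:E)%E.
  by apply: (grad _ _ k2 mG2) => // z /v[].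
have comb (X1 X2 : \bar R) : (X1 <= (2 * (M + e))%:E)%E -> (X2 <= (2 * (M + e))%:E)%E ->
    (`|w.1|%:E * X1 + `|w.2|%:E * X2 <= (c * (2 * (M + e)))%:E)%E.
  move=> x1 x2; rewrite [c * _]mulrDl EFinD; apply: leeD; rewrite EFinM;
    by apply: lee_wpmul2l => //; rewrite lee_fin.
have d1 := H01_L1_small (ltW e_gt0) tf pu.
have md : measurable_fun [set: mplane R] (fun z => phi z - u z) by exact: measurable_funB.
have mdn := measurable_EFin_norm md.
have mdw : measurable_fun [set: mplane R] (fun z : mplane R => `|phi (z + w) - u (z + w)|%:E) := measurableT_comp mdn mw.
have d2 : (\int[leb2 R]_z `|phi (z + w)%R - u (z + w)%R|%:E <= (e * 2)%:E)%E.
  by rewrite (translate_integral_plane w mdn).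
have mpw : measurable_fun [set: mplane R] (fun z : mplane R => phi (z + w)) := measurableT_comp mp mw.
have muw : measurable_fun [set: mplane R] (fun z : mplane R => u (z + w)) := measurableT_comp mu mw.
have m3 : measurable_fun [set: mplane R] (fun z : mplane R => `|phi (z + w) - phi z|%:E).
  by apply: (measurable_EFin_norm (f := fun z : mplane R => phi (z + w) - phi z)); exact: measurable_funB.
apply: (@le_trans _ _ (\int[leb2 R]_z (`|phi (z + w)%R - phi z|%:E + (`|phi z - u z|%:E + `|phi (z + w)%R - u (z + w)%R|%:E)))%E).
  apply: ge0_le_integral => //.
  - by apply: (measurable_EFin_norm (f := fun z : mplane R => u (z + w) - u z)); exact: measurable_funB.
  - by apply: emeasurable_funD => //; exact: emeasurable_funD.
  - move=> z _; rewrite -!EFinD lee_fin.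
    have -> : u (z + w) - u z = (phi (z + w) - phi z) + ((phi z - u z) - (phi (z + w) - u (z + w))) by ring.
    by apply: le_trans (ler_normD _ _) _; rewrite lerD2l; exact: ler_normB.
have n1 z : (0 <= `|phi (z + w) - phi z|%:E)%E by rewrite lee_fin.
have n2 z : (0 <= `|phi z - u z|%:E)%E by rewrite lee_fin.
have n3 z : (0 <= `|phi (z + w) - u (z + w)|%:E)%E by rewrite lee_fin.
have n4 z : (0 <= `|phi z - u z|%:E + `|phi (z + w) - u (z + w)|%:E)%E by exact: adde_ge0.
have m4 : measurable_fun [set: mplane R]
    (fun z => `|phi z - u z|%:E + `|phi (z + w) - u (z + w)|%:E)%E by exact: emeasurable_funD.
rewrite (plane_integralD measurableT m3 m4 n1 n4) (plane_integralD measurableT mdn mdw n2 n3).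
apply: (@le_trans _ _ ((c * (2 * (M + e)))%:E + ((e * 2)%:E + (e * 2)%:E))%E); last first.
  rewrite -!EFinD lee_fin -/c /e; have cp0 : 2 * c + 4 != 0 by rewrite gt_eqF//; lra.
  by rewrite le_eqVlt; apply/orP; left; apply/eqP; field.
apply: leeD; last exact: leeD.
apply: le_trans (C1disk_translate_le w C) _.
exact: comb b1 b2.
Qed.

(** Translation by [(2, 0)] moves the disk off itself, so that at each point of the disk the
    increment of [u] is [- u]. The constant is [2 * (2 * M)]. *)
Lemma H01_L1_le (M : R) : 0 <= M ->
  (\int[leb2 R]_z ((G z).1 ^+ 2)%:E <= (M ^+ 2)%:E)%E ->
  (\int[leb2 R]_z ((G z).2 ^+ 2)%:E <= (M ^+ 2)%:E)%E ->
  (\int[leb2 R]_z `|u z|%:E <= (4 * M)%:E)%E.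
Proof.
move=> M0 G1 G2; have := H01_translate_le (2, 0) M0 G1 G2.
rewrite /= normr0 addr0 ger0_norm// mulrA (_ : 2 * 2 = 4); last by ring.
apply: le_trans.
have mw := measurable_shift (2, 0 : R).
have muw : measurable_fun [set: mplane R] (fun z : mplane R => u (z + (2, 0))) := measurableT_comp mu mw.
apply: ge0_le_integral => //.
- exact: measurable_EFin_norm.
- by apply/measurable_EFinP; apply: measurableT_comp => //; exact: measurable_funB.
- move=> z _; rewrite lee_fin; have [dz|nz] := pselect (disk 1 z); last first.
    by rewrite (H01_vanish nz) normr0.
  rewrite (H01_vanish (z := z + (2, 0))) ?sub0r ?normrN// => dz2.
  have [h1 _] := disk_itv dz; have [h2 _] := disk_itv dz2.
  by move: h1 h2; rewrite addpE/= !ltr_norml; lra.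
Qed.

Lemma H01_L1_poincare (a b h : R) : 0 <= h ->
  (\int[leb2 R]_(p in square a b h) \int[leb2 R]_(q in square a b h) `|(u p - u q)%R|%:E <=
   (h ^+ 3)%:E * \int[leb2 R]_(p in square a b h) (`|(G p).1|%R + `|(G p).2|%R)%R%:E)%E.
Proof.
move=> h0; set S := square a b h.
have mS : measurable S by exact: measurable_square.
have lS : (leb2 R) S = (h ^+ 2)%:E by exact: square_area.
have lS' : ((leb2 R) S <= (h ^+ 2)%:E)%E by rewrite lS.
have h30 : 0 <= h ^+ 3 by exact: exprn_ge0.
have h40 : 0 <= h ^+ 4 by exact: exprn_ge0.
have h2E : (0 <= (h ^+ 2)%:E)%E by rewrite lee_fin exprn_ge0.
have h3E : (0 <= (h ^+ 3)%:E)%E by rewrite lee_fin.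
apply/lee_addgt0Pr => e0 e0_gt0.
(* The gradients contribute the error [2 h^4 e] and the functions [2 h^3 e]; the summand 1 keeps the
   denominator positive when [h = 0]. *)
pose e := e0 / (2 * h ^+ 4 + 2 * h ^+ 3 + 1).
have e_gt0 : 0 < e by rewrite divr_gt0//; lra.
have e_ge0 := ltW e_gt0.
have [phi [tf pu g1 g2]] := H01_approx e_gt0.
have C := test_function_C1disk Od tf; have [cp k1 k2 _ _] := C.
have mp := continuous_measurable_plane cp.
have mk1 := continuous_measurable_plane k1; have mk2 := continuous_measurable_plane k2.
pose d z := phi z - u z.
have md : measurable_fun [set: mplane R] d by exact: measurable_funB.
have dS : (\int[leb2 R]_(z in S) `|d z|%:E <= (e * h)%:E)%E by exact: cauchy_schwarz_set.
have gradS (f g : R * R -> R) : measurable_fun [set: mplane R] f -> measurable_fun [set: mplane R] g ->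
    (\int[leb2 R]_z ((f z - g z) ^+ 2)%:E <= (e ^+ 2)%:E)%E ->
    (\int[leb2 R]_(z in S) `|f z|%:E <= \int[leb2 R]_(z in S) `|g z|%:E + (e * h)%:E)%E.
  move=> mf mg fg; apply: le_trans (le_integral_norm mS mf mg) _; apply: leeD => //.
  by apply: cauchy_schwarz_set => //; exact: measurable_funB.
have sumS (f g : R * R -> R) : measurable_fun [set: mplane R] f -> measurable_fun [set: mplane R] g ->
    (\int[leb2 R]_(z in S) (`|f z|%R + `|g z|%R)%R%:E =
     \int[leb2 R]_(z in S) `|f z|%:E + \int[leb2 R]_(z in S) `|g z|%:E)%E.
  move=> mf mg; have n (k : R * R -> R) (z : mplane R) : (0 <= `|k z|%:E)%E by rewrite lee_fin.
  exact: (plane_integralD mS (measurable_EFin_norm mf) (measurable_EFin_norm mg) (n f) (n g)).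
have ndiff (k : R * R -> R) (pq : mplane R * mplane R) : (0 <= `|k pq.1 - k pq.2|%:E)%E by rewrite lee_fin.
have mPhi := measurable_param_plane mS (measurable_diff mp) (ndiff phi).
have mU := measurable_param_plane mS (measurable_diff mu) (ndiff u).
pose Phi (p : mplane R) := (\int[leb2 R]_(q in S) `|(phi p - phi q)%R|%:E)%E.
pose K := (\int[leb2 R]_(z in S) `|d z|%:E)%E.
have Phi0 p : (0 <= Phi p)%E by apply: integral_ge0 => q _; rewrite lee_fin.
have K0 : (0 <= K)%E by apply: integral_ge0 => q _; rewrite lee_fin.
have inner p : (\int[leb2 R]_(q in S) `|(u p - u q)%R|%:E <=
    Phi p + (`|d p|%:E * (h ^+ 2)%:E + K))%E.
  have E : (\int[leb2 R]_(q in S) (cst `|d p|%:E q) = `|d p|%:E * (h ^+ 2)%:E)%E.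
    by rewrite -lS; exact: integral_cst.
  have m1 : measurable_fun [set: mplane R] (fun q : mplane R => `|phi p - phi q|%:E).
    exact: (measurable_fun_pair2 p (measurable_diff mp)).
  have m2 := measurable_EFin_norm md.
  have mc : measurable_fun [set: mplane R] (cst `|d p|%:E : mplane R -> \bar R) by exact: measurable_cst.
  have n1 (q : mplane R) : (0 <= `|phi p - phi q|%:E)%E by rewrite lee_fin.
  have n2 (q : mplane R) : (0 <= `|d q|%:E)%E by rewrite lee_fin.
  have n3 (q : mplane R) : (0 <= cst `|d p|%:E q :> \bar R)%E by rewrite lee_fin.
  have n4 (q : mplane R) : (0 <= cst `|d p|%:E q + `|d q|%:E :> \bar R)%E by exact: adde_ge0.
  have mS4 : measurable_fun [set: mplane R] (fun q : mplane R => cst `|d p|%:E q + `|d q|%:E)%E by exact: emeasurable_funD.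
  rewrite -E -(plane_integralD mS mc m2 n3 n2) -(plane_integralD mS m1 mS4 n1 n4).
  apply: ge0_le_integral => //.
  - by apply: measurable_funTS; exact: (measurable_fun_pair2 p (measurable_diff mu)).
  - by apply: measurable_funTS; exact: emeasurable_funD.
  - move=> q _; rewrite -!EFinD lee_fin /d.
    have -> : u p - u q = (phi p - phi q) + ((phi q - u q) - (phi p - u p)) by ring.
    by apply: le_trans (ler_normD _ _) _; rewrite lerD2l addrC; exact: ler_normB.
have mdS : measurable_fun S (fun q => `|d q|%:E) := measurable_funTS (measurable_EFin_norm md).
have step : (\int[leb2 R]_(p in S) \int[leb2 R]_(q in S) `|(u p - u q)%R|%:E <=
    \int[leb2 R]_(p in S) Phi p + (K * (h ^+ 2)%:E + K * (h ^+ 2)%:E))%E.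
  have E : (\int[leb2 R]_(q in S) (cst K q) = K * (h ^+ 2)%:E)%E.
    by rewrite -lS; exact: integral_cst.
  have E2 : (\int[leb2 R]_(p in S) (`|d p|%:E * (h ^+ 2)%:E) = K * (h ^+ 2)%:E)%E.
    by rewrite ge0_integralZr.
  have mc : measurable_fun [set: mplane R] (cst K : mplane R -> \bar R) by exact: measurable_cst.
  have md2 : measurable_fun [set: mplane R] (fun p : mplane R => `|d p|%:E * (h ^+ 2)%:E)%E.
    by apply: emeasurable_funM; [exact: measurable_EFin_norm|exact: measurable_cst].
  have n2 (p : mplane R) : (0 <= `|d p|%:E * (h ^+ 2)%:E)%E by rewrite mule_ge0 ?lee_fin.
  have n3 (p : mplane R) : (0 <= cst K p)%E by exact: K0.
  have n4 (p : mplane R) : (0 <= `|d p|%:E * (h ^+ 2)%:E + cst K p)%E by exact: adde_ge0.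
  have mS4 : measurable_fun [set: mplane R] (fun p : mplane R => `|d p|%:E * (h ^+ 2)%:E + cst K p)%E by exact: emeasurable_funD.
  rewrite -[in X in (_ <= _ + (_ + X))%E]E -E2.
  rewrite -(plane_integralD mS md2 mc n2 n3) -(plane_integralD mS mPhi mS4 Phi0 n4).
  apply: ge0_le_integral => //.
  - by move=> p _; apply: integral_ge0 => q _; rewrite lee_fin.
  - exact: measurable_funTS mU.
  - by apply: measurable_funTS; exact: emeasurable_funD.
apply: (le_trans step).
have P1 := C1disk_L1_poincare a b C h0.
rewrite (sumS _ _ mk1 mk2) in P1; rewrite (sumS _ _ mG1 mG2).
have Q1 := gradS _ _ mk1 mG1 g1; have Q2 := gradS _ _ mk2 mG2 g2.
set X1 := (\int[leb2 R]_(z in S) `|(G z).1|%:E)%E in Q1 *.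
set X2 := (\int[leb2 R]_(z in S) `|(G z).2|%:E)%E in Q2 *.
have X10 : (0 <= X1)%E by apply: integral_ge0 => q _; rewrite lee_fin.
have X20 : (0 <= X2)%E by apply: integral_ge0 => q _; rewrite lee_fin.
apply: (@le_trans _ _ ((h ^+ 3)%:E * (X1 + X2 + (e * h * 2)%:E) +
   ((e * h)%:E * (h ^+ 2)%:E + (e * h)%:E * (h ^+ 2)%:E))%E).
  apply: leeD; last by apply: leeD; exact: lee_wpmul2r.
  apply: (le_trans P1); apply: lee_wpmul2l => //.
  apply: le_trans (leeD Q1 Q2) _.
  by rewrite addeACA -EFinD (_ : e * h * 2 = e * h + e * h)//; ring.
have X120 : (0 <= X1 + X2)%E by exact: adde_ge0.
move: (X1 + X2)%E X120 => X X0.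
have eh0 : (0 <= (e * h * 2)%:E)%E by rewrite lee_fin mulr_ge0// mulr_ge0.
have -> : ((h ^+ 3)%:E * (X + (e * h * 2)%:E) = (h ^+ 3)%:E * X + (h ^+ 3)%:E * (e * h * 2)%:E)%E.
  exact: ge0_muleDr.
rewrite -[leLHS]addeA; apply: leeD => //; rewrite -!EFinM -!EFinD lee_fin.
have -> : h ^+ 3 * (e * h * 2) + (e * h * h ^+ 2 + e * h * h ^+ 2) = e * (2 * h ^+ 4 + 2 * h ^+ 3) by ring.
rewrite /e mulrAC ler_pdivrMr; last by lra.
by apply: ler_wpM2l; [exact: ltW|rewrite lerDl ler01].
Qed.

End H01_estimates.

(** * Averages over dyadic squares *)

Lemma dist_Rintegral_le (R : realType) (S : set (mplane R)) (v : R * R -> R) (c s : R) :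
  measurable S -> (leb2 R).-integrable S (EFin \o v) ->
  (leb2 R) S = s%:E ->
  (`|c * s - Rintegral (leb2 R) S v|%:E <= \int[leb2 R]_(q in S) `|(c - v q)%R|%:E)%E.
Proof.
move=> mS iS lS.
have ic : (leb2 R).-integrable S (EFin \o (fun=> c)).
  apply/integrableP; split; first by apply/measurable_EFinP; exact: measurable_cst.
  have -> : (\int[leb2 R]_(x in S) `|(EFin \o (fun=> c)) x| = `|c|%:E * (leb2 R) S)%E.
    exact: (@integral_cst _ _ _ (leb2 R) S mS `|c|%:E).
  by rewrite lS -EFinM ltry.
have icu : (leb2 R).-integrable S (EFin \o (fun q => c - v q)).
  by have := integrableB mS ic iS; apply: eq_integrable.
have -> : c * s - Rintegral (leb2 R) S v = Rintegral (leb2 R) S (fun q => c - v q).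
  rewrite RintegralB// Rintegral_cst//; congr (_ * _ - _).
  by rewrite -[s]/(fine s%:E); congr fine.
rewrite EFin_normr_Rintegral//; apply: le_abse_integral => //.
by case/integrableP: icu.
Qed.

Section averages.
Variable R : realType.
Implicit Types (c a b h : R) (z p q : R * R) (n : nat).

Definition dside n : R := 2 * 2^-1 ^+ n.

Definition dsquare z n : set (mplane R) :=
  square (z.1 - 2^-1 ^+ n) (z.2 - 2^-1 ^+ n) (dside n).

Lemma dside_gt0 n : 0 < dside n.
Proof. by rewrite /dside mulr_gt0// exprn_gt0. Qed.

Lemma dsquareE z n p :
  dsquare z n p <-> `|p.1 - z.1| < 2^-1 ^+ n /\ `|p.2 - z.2| < 2^-1 ^+ n.
Proof.
rewrite /dsquare /square /dside; set e := 2^-1 ^+ n.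
split=> [[/=]|[]]; rewrite /= ?in_itv/= !ltr_norml; first by lra.
by move=> h1 h2; split; lra.
Qed.

Lemma dsquareS z n : dsquare z n.+1 `<=` dsquare z n.
Proof.
move=> p /dsquareE[h1 h2]; apply/dsquareE.
have : (2^-1 : R) ^+ n.+1 <= 2^-1 ^+ n by rewrite exprS ler_piMl ?exprn_ge0//; lra.
by split; apply: lt_le_trans; eassumption.
Qed.

Lemma measurable_dsquare z n : measurable (dsquare z n).
Proof. exact: measurable_square. Qed.

Lemma dsquare_area z n : (leb2 R) (dsquare z n) = (dside n ^+ 2)%:E.
Proof. by apply: square_area; exact/ltW/dside_gt0. Qed.

(** This is A_n(z). As [fine] discards infinite values, it is the mean only for integrable [u]. *)
Definition davg (u : R * R -> R) z n : R :=
  fine (\int[leb2 R]_(p in dsquare z n) (u p)%:E) / dside n ^+ 2.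

Variables (u g : R * R -> R) (Gam : R).
Hypotheses (mu : measurable_fun [set: mplane R] u) (mg : measurable_fun [set: mplane R] g).
Hypotheses (iu : (\int[leb2 R]_z `|u z|%:E < +oo)%E) (g0 : forall z, 0 <= g z).
Hypotheses (Gam0 : 0 <= Gam) (gGam : (\int[leb2 R]_z (g z ^+ 2)%:E <= (Gam ^+ 2)%:E)%E).
Hypothesis poincare : forall a b h, 0 <= h ->
  (\int[leb2 R]_(p in square a b h) \int[leb2 R]_(q in square a b h) `|(u p - u q)%R|%:E <=
   (h ^+ 3)%:E * \int[leb2 R]_(p in square a b h) (g p)%:E)%E.

Lemma integrable_subset (S : set (mplane R)) : measurable S ->
  (leb2 R).-integrable S (EFin \o u).
Proof.
move=> mS; apply: (integrableS measurableT) => //.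
by apply/integrableP; split => //; exact/measurable_EFinP.
Qed.

Lemma davg_dist_le c z n :
  (`|c - davg u z n|%:E * (dside n ^+ 2)%:E <= \int[leb2 R]_(q in dsquare z n) `|(c - u q)%R|%:E)%E.
Proof.
have mS := measurable_dsquare z n.
have := dist_Rintegral_le c mS (integrable_subset mS) (dsquare_area z n).
apply: le_trans; rewrite -EFinM lee_fin -/(Rintegral _ _ _).
have d2 : dside n ^+ 2 != 0 by rewrite expf_neq0// gt_eqF// dside_gt0.
rewrite /davg -{2}[dside n ^+ 2]ger0_norm ?sqr_ge0// -normrM mulrBl divfK//.
Qed.

Lemma measurable_abs_cst c (f : R * R -> R) : measurable_fun [set: mplane R] f ->
  measurable_fun [set: mplane R] (fun p => `|f p - c|%:E).
Proof.
by move=> mf; apply: measurable_EFin_norm; exact: measurable_funB.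
Qed.

Lemma lee_pmul_cancel (s t : R) (X Y : \bar R) : 0 < s -> (0 <= Y)%E ->
  (X * s%:E <= (t * s)%:E * Y)%E -> (X <= t%:E * Y)%E.
Proof.
move=> s0 Y0; rewrite mulrC EFinM -muleA [(X * _)%E]muleC.
by rewrite lee_pmul2l// ?lte_fin.
Qed.

(** By [davg_dist_le], averaging the Poincare inequality over its second point divides by the area
    [dside n ^ 2] and leaves one factor [dside n]. *)
Lemma osc_le z n :
  (\int[leb2 R]_(p in dsquare z n) `|(u p - davg u z n)%R|%:E <=
   (dside n)%:E * \int[leb2 R]_(p in dsquare z n) (g p)%:E)%E.
Proof.
have mS := measurable_dsquare z n; have d0 := dside_gt0 n.
apply: (@lee_pmul_cancel (dside n ^+ 2)); first by rewrite exprn_gt0.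
  by apply: integral_ge0 => p _; rewrite lee_fin.
rewrite -exprS; apply: le_trans (poincare _ _ (ltW d0)).
have ma : measurable_fun (dsquare z n) (fun p => `|u p - davg u z n|%:E).
  exact: measurable_funTS (measurable_abs_cst _ mu).
have -> : (\int[leb2 R]_(p in dsquare z n) `|(u p - davg u z n)%R|%:E * (dside n ^+ 2)%:E =
    \int[leb2 R]_(p in dsquare z n) (`|(u p - davg u z n)%R|%:E * (dside n ^+ 2)%:E))%E.
  by rewrite ge0_integralZr ?lee_fin ?sqr_ge0.
apply: ge0_le_integral => //.
- by move=> p _; rewrite mule_ge0// lee_fin ?sqr_ge0.
- by apply: emeasurable_funM => //; exact: measurable_cst.
- apply: measurable_funTS; apply: (measurable_param_plane mS (measurable_diff mu)).
  by move=> pq; rewrite lee_fin.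
- by move=> p _; exact: davg_dist_le.
Qed.

(** The oscillation on the larger square is averaged over the smaller one, which gives the factor
    [dside n / dside n.+1 ^ 2 = 2 * 2^n]. *)
Lemma davg_step z n :
  (`|davg u z n.+1 - davg u z n|%:E <=
   (2 * 2 ^+ n)%:E * \int[leb2 R]_(p in dsquare z n) (g p)%:E)%E.
Proof.
have mS := measurable_dsquare z n; have d0 := dside_gt0 n.
apply: (@lee_pmul_cancel (dside n.+1 ^+ 2)); first by rewrite exprn_gt0// dside_gt0.
  by apply: integral_ge0 => p _; rewrite lee_fin.
rewrite distrC; apply: le_trans (davg_dist_le _ _ _) _.
have -> : 2 * 2 ^+ n * dside n.+1 ^+ 2 = dside n.
  have e2 : 2 ^+ n * 2^-1 ^+ n = 1 :> R by rewrite -exprMn mulfV// expr1n.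
  rewrite /dside [_ ^+ n.+1]exprS; set e := 2^-1 ^+ n in e2 *.
  have -> : 2 * 2 ^+ n * (2 * (2^-1 * e)) ^+ 2 = 2 * e * (2 ^+ n * e) by field.
  by rewrite e2 mulr1.
apply: le_trans (osc_le _ _).
have ma (T : set (mplane R)) : measurable_fun T (fun p => `|u p - davg u z n|%:E).
  exact: measurable_funTS (measurable_abs_cst _ mu).
have -> : (\int[leb2 R]_(q in dsquare z n.+1) `|(davg u z n - u q)%R|%:E =
    \int[leb2 R]_(q in dsquare z n.+1) `|(u q - davg u z n)%R|%:E)%E.
  by apply: eq_integral => q _; rewrite distrC.
apply: ge0_subset_integral => //; [exact: measurable_dsquare|exact: dsquareS].
Qed.

Lemma dsquare_indic z n c :
  (\int[leb2 R]_p (c * \1_(dsquare z n) p)%:E = (c * dside n ^+ 2)%:E)%E.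
Proof.
have mS := measurable_dsquare z n.
rewrite EFinM -(dsquare_area z).
have -> : (c%:E * leb2 R (dsquare z n) = \int[leb2 R]_(p in dsquare z n) cst c%:E p)%E.
  by rewrite integral_cst.
rewrite [RHS]integral_mkcond; apply: eq_integral => p _; rewrite patchE indicE.
by case: (_ \in _); rewrite ?mulr1 ?mulr0.
Qed.

(** [K] is the sum of [2^n] times the indicator of [dsquare z n] over the scales crossed. Applying
    Cauchy-Schwarz at each scale separately would bound the drift by a multiple of [l]; a single
    application against [K] gives [sqrt l], because every scale adds the same amount to the square
    integral of [K]. The pointwise bound on [K] controls the cross terms. *)
Lemma davg_weight z (a l : nat) : exists K : R * R -> R,
  [/\ measurable_fun [set: mplane R] K, (forall p, 0 <= K p <= 2 ^+ (a + l)),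
      (`|davg u z (a + l) - davg u z a|%:E <= 2%:E * \int[leb2 R]_p `|(K p * g p)%R|%:E)%E &
      (\int[leb2 R]_p (K p ^+ 2)%:E <= (12 * l%:R)%:E)%E].
Proof.
elim: l => [|l [K [mK K0 KA K2]]].
  exists (fun=> 0); split; first exact: measurable_cst.
  - by move=> p; rewrite lexx exprn_ge0.
  - by rewrite addn0 subrr normr0 mule_ge0//; apply: integral_ge0 => p _; rewrite lee_fin.
  - by rewrite mulr0 integral0_eq// => p _; rewrite expr0n.
rewrite addnS; set n := (a + l)%N in K0 KA *.
pose I : R * R -> R := \1_(dsquare z n).
have mS := measurable_dsquare z n.
have mI : measurable_fun [set: mplane R] I by exact: measurable_indic.
have t0 : 0 <= (2 : R) ^+ n by exact: exprn_ge0.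
have I01 p : I p = 0 \/ I p = 1 by rewrite /I indicE; case: (_ \in _); [right|left].
have mcI (c : R) : measurable_fun [set: mplane R] (fun p => c * I p).
  by apply: measurable_funM => //; exact: measurable_cst.
exists (fun p => K p + 2 ^+ n * I p); split.
- by apply: measurable_funD.
- move=> p; have /andP[k0 k1] := K0 p; rewrite exprS.
  by case: (I01 p) => ->; apply/andP; split; lra.
- have X0 (f : R * R -> R) (S : set (mplane R)) : (0 <= \int[leb2 R]_(p in S) `|f p|%:E)%E.
    by apply: integral_ge0 => p _; rewrite lee_fin.
  have mKg : measurable_fun [set: mplane R] (fun p => `|K p * g p|%:E).
    by apply: measurable_EFin_norm; exact: measurable_funM.
  have mIg : measurable_fun [set: mplane R] (fun p => `|2 ^+ n * I p * g p|%:E).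
    by apply: measurable_EFin_norm; exact: measurable_funM.
  have nKg (p : mplane R) : (0 <= `|K p * g p|%:E)%E by rewrite lee_fin.
  have nIg (p : mplane R) : (0 <= `|2 ^+ n * I p * g p|%:E)%E by rewrite lee_fin.
  have E : (\int[leb2 R]_p `|((K p + 2 ^+ n * I p) * g p)%R|%:E =
      \int[leb2 R]_p `|(K p * g p)%R|%:E + \int[leb2 R]_p `|(2 ^+ n * I p * g p)%R|%:E)%E.
    rewrite -(plane_integralD measurableT mKg mIg nKg nIg); apply: eq_integral => p _.
    have gp := g0 p; have /andP[k0 _] := K0 p.
    have i0 : 0 <= 2 ^+ n * I p by case: (I01 p) => ->; rewrite ?mulr0 ?mulr1.
    by rewrite -EFinD !ger0_norm ?mulr_ge0 ?addr_ge0// mulrDl.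
  have E2 : (\int[leb2 R]_p `|(2 ^+ n * I p * g p)%R|%:E =
      (2 ^+ n)%:E * \int[leb2 R]_(p in dsquare z n) (g p)%:E)%E.
    have mgS : measurable_fun (dsquare z n) (fun p => (g p)%:E).
      by apply: measurable_funTS; exact/measurable_EFinP.
    have gS p : dsquare z n p -> (0 <= (g p)%:E)%E by rewrite lee_fin.
    rewrite -ge0_integralZl//.
    rewrite [RHS]integral_mkcond; apply: eq_integral => p _; rewrite patchE /I indicE.
    case: (_ \in _); rewrite ?mulr0 ?mul0r ?normr0// mulr1 -EFinM.
    by rewrite ger0_norm// mulr_ge0.
  rewrite E E2.
  have st := davg_step z n.
  have Y0 : (0 <= \int[leb2 R]_(p in dsquare z n) (g p)%:E)%E.
    by apply: integral_ge0 => p _; rewrite lee_fin.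
  have fin (A B : \bar R) (x y : R) : (0 <= A)%E -> (0 <= B)%E -> (x%:E <= 2%:E * A)%E ->
      (y%:E <= (2 * 2 ^+ n)%:E * B)%E -> ((x + y)%:E <= 2%:E * (A + (2 ^+ n)%:E * B))%E.
    move=> A0 B0 xA yB; rewrite ge0_muleDr ?mule_ge0 ?lee_fin// EFinD muleA -EFinM.
    exact: leeD.
  apply: le_trans (fin _ _ _ _ _ _ KA st) => //.
  by rewrite lee_fin [leRHS]addrC ler_distD.
- have m1 : measurable_fun [set: mplane R] (fun p => (K p ^+ 2)%:E).
    by apply/measurable_EFinP; exact: measurable_funX.
  have m2 : measurable_fun [set: mplane R] (fun p => (3 * 4 ^+ n * I p)%:E).
    exact/measurable_EFinP.
  have n1 (p : mplane R) : (0 <= (K p ^+ 2)%:E)%E by rewrite lee_fin sqr_ge0.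
  have n2 (p : mplane R) : (0 <= (3 * 4 ^+ n * I p)%:E)%E.
    by rewrite lee_fin; case: (I01 p) => ->; rewrite ?mulr0 ?mulr1// mulr_ge0// exprn_ge0.
  (* Since [K <= 2^n], on the new square the cross term is at most [2 * 4^n], and the square of the
     sum exceeds [K^2] by at most [3 * 4^n]. The area of that square is [4 * 4^-n], whence 12. *)
  apply: (@le_trans _ _ (\int[leb2 R]_p ((K p ^+ 2)%:E + (3 * 4 ^+ n * I p)%R%:E))%E).
    apply: ge0_le_integral => //.
    + by move=> p _; rewrite lee_fin sqr_ge0.
    + by apply/measurable_EFinP; apply: measurable_funX; exact: measurable_funD.
    + exact: emeasurable_funD.
    + move=> p _; rewrite -EFinD lee_fin.
      have E4 : 4 ^+ n = (2 ^+ n) ^+ 2 :> R by rewrite -exprM mulnC exprM; congr (_ ^+ _); ring.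
      have /andP[k0 k1] := K0 p; rewrite E4; move: (2 ^+ n) t0 k1 => t t0 k1.
      case: (I01 p) => ->; nra.
  rewrite (plane_integralD measurableT m1 m2 n1 n2) dsquare_indic.
  have -> : 3 * 4 ^+ n * dside n ^+ 2 = 12.
    rewrite /dside exprMn -exprM mulnC exprM -mulrA [4 ^+ n * _]mulrCA -exprMn.
    have -> : (4 : R) * 2^-1 ^+ 2 = 1 by field.
    rewrite expr1n; ring.
  apply: (@le_trans _ _ ((12 * l%:R)%:E + 12%:E)%E); first exact: leeD.
  by rewrite -EFinD lee_fin -natr1; lra.
Qed.

Lemma davg_chain z (a l : nat) :
  `|davg u z (a + l) - davg u z a| <= 8 * Gam * Num.sqrt l%:R.
Proof.
have [K [mK K0 KA K2]] := davg_weight z a l.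
have s0 : 0 <= 4 * Num.sqrt (l%:R : R) by rewrite mulr_ge0// sqrtr_ge0.
(* The constant 12 is rounded up to 16, whose square root is explicit. *)
have K2' : (\int[leb2 R]_p (K p ^+ 2)%:E <= ((4 * Num.sqrt l%:R) ^+ 2)%:E)%E.
  by apply: le_trans K2 _; rewrite lee_fin exprMn sqr_sqrtr ?ler0n//; have := ler0n R l; nra.
have CS := cauchy_schwarz mK mg s0 Gam0 K2' gGam.
rewrite -lee_fin; apply: le_trans KA _.
apply: (@le_trans _ _ (2%:E * (4 * Num.sqrt l%:R * Gam)%:E)%E).
  by apply: lee_wpmul2l.
by rewrite -EFinM lee_fin; lra.
Qed.

Lemma dsquare_gint_le z n :
  (\int[leb2 R]_(p in dsquare z n) (g p)%:E <= (Gam * dside n)%:E)%E.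
Proof.
have d0 := ltW (dside_gt0 n).
have lS : ((leb2 R) (dsquare z n) <= (dside n ^+ 2)%:E)%E by rewrite dsquare_area.
have := cauchy_schwarz_set (measurable_dsquare z n) mg Gam0 d0 gGam lS.
apply: le_trans; rewrite le_eqVlt; apply/orP; left; apply/eqP.
by apply: eq_integral => p _; rewrite ger0_norm.
Qed.

(** Oscillation inside the small square plus drift of the means from scale [a] to scale [a + l]. The
    comparison is with the mean at the fixed scale [a] because the image of the power map meets all
    these scales at once. *)
Lemma davg_osc_le z (a l : nat) :
  (\int[leb2 R]_(p in dsquare z (a + l)) `|(u p - davg u z a)%R|%:E <=
    (dside (a + l) ^+ 2 * (Gam * (1 + 8 * Num.sqrt l%:R)))%:E)%E.
Proof.
set n := (a + l)%N; have mS := measurable_dsquare z n.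
have d0 := dside_gt0 n.
have m1 := measurable_abs_cst (davg u z n) mu.
set B := `|davg u z n - davg u z a|.
have m2 : measurable_fun [set: mplane R] (fun _ : mplane R => B%:E) by exact: measurable_cst.
have n1 (p : mplane R) : (0 <= `|u p - davg u z n|%:E)%E by rewrite lee_fin.
have n2 (p : mplane R) : (0 <= B%:E)%E by rewrite lee_fin /B.
apply: (@le_trans _ _ (\int[leb2 R]_(p in dsquare z n) (`|(u p - davg u z n)%R|%:E + B%:E))%E).
  apply: ge0_le_integral => //.
  - exact: measurable_funTS (measurable_abs_cst _ mu).
  - by apply: measurable_funTS; exact: emeasurable_funD.
  - by move=> p _; rewrite -EFinD lee_fin ler_distD.
rewrite (plane_integralD mS m1 m2 n1 n2).
have -> : (\int[leb2 R]_(p in dsquare z n) B%:E = B%:E * (dside n ^+ 2)%:E)%E.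
  by rewrite -(dsquare_area z); exact: (@integral_cst _ _ _ (leb2 R) _ mS B%:E).
apply: (@le_trans _ _ ((dside n)%:E * (Gam * dside n)%:E + (8 * Gam * Num.sqrt l%:R)%:E * (dside n ^+ 2)%:E)%E).
  apply: leeD.
    apply: le_trans (osc_le z n) _; apply: lee_wpmul2l; first by rewrite lee_fin ltW.
    exact: dsquare_gint_le.
  by rewrite -!EFinM lee_fin ler_wpM2r ?sqr_ge0//; exact: davg_chain.
rewrite -!EFinM -EFinD lee_fin le_eqVlt; apply/orP; left; apply/eqP; ring.
Qed.

End averages.

Lemma dsquare_translate (R : realType) (z : R * R) (n : nat) (k : mplane R -> \bar R) :
  measurable_fun [set: mplane R] k -> (forall q, (0 <= k q)%E) ->
  (\int[leb2 R]_(q in dsquare z n) k q =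
   \int[leb2 R]_(q in dsquare (0%R : R * R) n) k (z + q)%R)%E.
Proof.
move=> mk k0; have mS := measurable_dsquare z n.
pose h : mplane R -> \bar R := k \_ (dsquare z n).
have mh : measurable_fun [set: mplane R] h.
  by apply/(measurable_restrictT _ _).1 => //; exact: measurable_funTS.
have h0 q : (0 <= h q)%E by rewrite /h patchE; case: ifP.
have -> : (\int[leb2 R]_(q in dsquare z n) k q = \int[leb2 R]_q h q)%E.
  by rewrite [LHS]integral_mkcond.
rewrite -(translate_integral_plane z mh h0).
rewrite [RHS]integral_mkcond; apply: eq_integral => q _; rewrite /h !patchE.
have -> : (q + z \in dsquare z n) = (q \in dsquare 0 n).
  by apply/idP/idP => /set_mem/dsquareE[h1 h2]; apply/mem_set/dsquareE;
    move: h1 h2; rewrite addpE/= ?addrK ?subr0 ?addr0//; rewrite addrK.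
by rewrite (addrC (z : R * R) q).
Qed.

(** * Level sets and L^1 norms from the L^1 modulus of continuity *)

Section level_sets.
Variable R : realType.
Variables (u : R * R -> R) (T : R).
Hypotheses (mu : measurable_fun [set: mplane R] u) (iu : (\int[leb2 R]_z `|u z|%:E < +oo)%E).
Hypothesis T0 : 0 <= T.
Hypothesis translate_le : forall w : R * R,
  (\int[leb2 R]_z `|u (z + w)%R - u z|%:E <= ((`|w.1| + `|w.2|) * T)%:E)%E.

(** The modulus of continuity localised at [z] and not divided by the area of the square, which
    keeps Fubini's theorem directly applicable. *)
Definition local_dev (z : mplane R) (n : nat) : \bar R :=
  (\int[leb2 R]_(q in dsquare (0%R : R * R) n) `|(u (z + q) - u z)%R|%:E)%E.

Lemma davg_local_dev z n :
  (`|u z - davg u z n|%:E * (dside R n ^+ 2)%:E <= local_dev z n)%E.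
Proof.
apply: le_trans (davg_dist_le mu iu (u z) z n) _.
have md : measurable_fun [set: mplane R] (fun q => `|u q - u z|%:E) by exact: measurable_abs_cst.
have d0 (q : mplane R) : (0 <= `|u q - u z|%:E)%E by rewrite lee_fin.
rewrite /local_dev -(dsquare_translate z n md d0) le_eqVlt; apply/orP; left; apply/eqP.
by apply: eq_integral => q _; rewrite distrC.
Qed.

Let mdiff : measurable_fun [set: mplane R * mplane R]
  (fun pq : mplane R * mplane R => `|u (pq.1 + pq.2)%R - u pq.1|%:E).
Proof.
apply/measurable_EFinP; apply: measurableT_comp => //; apply: measurable_funB.
  apply: (measurableT_comp mu); apply/measurable_fun_pairP; split; rewrite /comp/=.
    by apply: measurable_funD; apply: measurableT_comp => //.
  by apply: measurable_funD; apply: measurableT_comp => //.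
by apply: (measurableT_comp mu); exact: measurable_fst.
Qed.

Lemma measurable_local_dev n : measurable_fun [set: mplane R] (local_dev ^~ n).
Proof.
apply: (measurable_param_plane (measurable_dsquare (0 : R * R) n) mdiff) => pq.
by rewrite lee_fin.
Qed.

Lemma local_dev_ge0 z n : (0 <= local_dev z n)%E.
Proof. by apply: integral_ge0 => q _; rewrite lee_fin. Qed.

(** After Fubini, the translation hypothesis applies at each fixed shift [q] in the square, where
    [|q.1| + |q.2|] is less than [dside R n]. *)
Lemma integral_local_dev_le n :
  (\int[leb2 R]_z local_dev z n <= (dside R n ^+ 2 * (dside R n * T))%:E)%E.
Proof.
have mS := measurable_dsquare (0 : R * R) n; have d0 := dside_gt0 R n.
pose f : mplane R * mplane R -> \bar R :=
  (fun pq => `|u (pq.1 + pq.2)%R - u pq.1|%:E)%E \_ ([set: mplane R] `*` dsquare (0%R : R * R) n).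
have mf : measurable_fun [set: mplane R * mplane R] f.
  apply/(measurable_restrictT _ _).1; first exact: measurableX.
  exact: measurable_funTS mdiff.
have f0 pq : (0 <= f pq)%E by rewrite /f patchE; case: ifP => // _; rewrite lee_fin.
have fE p q : f (p, q) = if q \in dsquare (0 : R * R) n then `|u (p + q)%R - u p|%:E else 0%E.
  rewrite /f patchE; have -> // : ((p, q) \in [set: mplane R] `*` dsquare (0 : R * R) n) = (q \in dsquare (0 : R * R) n).
  by apply/idP/idP => /set_mem h; apply/mem_set; [case: h|split].
have -> : (\int[leb2 R]_z local_dev z n = \int[leb2 R]_p \int[leb2 R]_q f (p, q))%E.
  apply: eq_integral => p _; rewrite /local_dev [LHS]integral_mkcond.
  by apply: eq_integral => q _; rewrite fE patchE.
rewrite (fubini_plane mf f0).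
apply: (@le_trans _ _ (\int[leb2 R]_q (dside R n * T * \1_(dsquare (0%R : R * R) n) q)%:E)%E); last first.
  by rewrite dsquare_indic lee_fin mulrC.
apply: ge0_le_integral => //.
- by move=> q _; exact: integral_ge0.
- apply: (measurable_param_plane (f := fun qp => f (qp.2, qp.1)) measurableT) => //.
  exact: (measurableT_comp mf (@measurable_swap _ _ _ _)).
- apply/measurable_EFinP; apply: measurable_funM => //; exact: measurable_indic.
- move=> q _; have [qS|qS] := boolP (q \in dsquare (0 : R * R) n); last first.
    rewrite indicE (negbTE qS) mulr0 integral0_eq// => p _.
    by rewrite fE (negbTE qS).
  have -> : (\int[leb2 R]_p f (p, q) = \int[leb2 R]_p `|u (p + q)%R - u p|%:E)%E.
    by apply: eq_integral => p _; rewrite fE qS.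
  apply: le_trans (translate_le q) _; rewrite indicE qS mulr1 lee_fin ler_wpM2r//.
  move: qS => /set_mem/dsquareE[]; rewrite !subr0 /dside.
  by move: (`|q.1|) (`|q.2|) => x y; lra.
Qed.

(** Where [|u| > t] and the mean is at most [t / 2], the distance from [u] to its mean exceeds
    [t / 2], so [local_dev] is at least [t / 2] times the area of the square. Chebyshev's inequality
    concludes. *)
Lemma level_set_le (Omega : set (mplane R)) (t : R) n : measurable Omega -> 0 < t ->
  (forall z, Omega z -> `|davg u z n| <= t / 2) ->
  ((leb2 R) (Omega `&` [set z | (t < `|u z|)%R]) <= (2 * dside R n * T / t)%:E)%E.
Proof.
move=> mO t0 At; have d0 := dside_gt0 R n.
set L := Omega `&` _.
have mL : measurable L.
  apply: measurableI => //.
  have -> : [set z | (t < `|u z|)%R] = (fun z => `|u z|) @^-1` `]t, +oo[.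
    by apply/seteqP; split => z /=; rewrite in_itv/= andbT.
  rewrite -[X in measurable X]setTI.
  have : measurable_fun [set: mplane R] (fun z => `|u z|) by exact: measurableT_comp.
  by apply => //; exact: measurable_itv.
pose c := t / 2 * dside R n ^+ 2.
have c0 : 0 < c by rewrite mulr_gt0 ?exprn_gt0// divr_gt0.
have : (c%:E * leb2 R L <= (dside R n ^+ 2 * (dside R n * T))%:E)%E.
  apply: le_trans (integral_local_dev_le n).
  rewrite -(@integral_cst _ _ _ (leb2 R) _ mL c%:E).
  apply: (@le_trans _ _ (\int[leb2 R]_(z in L) local_dev z n)%E); last first.
    apply: ge0_subset_integral => //; first exact: measurable_local_dev.
    by move=> z _; exact: local_dev_ge0.
  apply: ge0_le_integral => //.
  - by move=> z _; rewrite lee_fin ltW.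
  - exact: measurable_funTS (measurable_local_dev n).
  - move=> z [Oz /= tz]; apply: le_trans (davg_local_dev z n).
    rewrite -EFinM lee_fin ler_wpM2r ?sqr_ge0//.
    by move: (At _ Oz) (lerB_dist (u z) (davg u z n)) tz; move: (`|u z|) (`|davg u z n|) (`|u z - _|) => x y w; lra.
rewrite -lee_pdivlMl// => /le_trans; apply; rewrite -EFinM lee_fin le_eqVlt /c.
by apply/orP; left; apply/eqP; field; rewrite !gt_eqF.
Qed.

Lemma L1_le_davg (Omega : set (mplane R)) (eta : R) n : measurable Omega -> 0 <= eta ->
  Omega `<=` @unit_square R ->
  (forall z, Omega z -> `|davg u z n| <= eta) ->
  (\int[leb2 R]_(z in Omega) `|u z|%:E <= (dside R n * T + 4 * eta)%:E)%E.
Proof.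
move=> mO eta0 OU Ae; have d0 := dside_gt0 R n.
have d2 : 0 < dside R n ^+ 2 by rewrite exprn_gt0.
have mn : measurable_fun [set: mplane R] (fun z => `|u z|%:E).
  exact: measurable_EFin_norm.
have m1 : measurable_fun [set: mplane R] (fun z : mplane R => ((dside R n ^+ 2)^-1)%:E * local_dev z n)%E.
  by apply: emeasurable_funM; [exact: measurable_cst|exact: measurable_local_dev].
have m2 : measurable_fun [set: mplane R] (fun _ : mplane R => eta%:E) by exact: measurable_cst.
have n1 (z : mplane R) : (0 <= ((dside R n ^+ 2)^-1)%:E * local_dev z n)%E.
  by rewrite mule_ge0 ?local_dev_ge0// lee_fin invr_ge0 ltW.
have n2 (z : mplane R) : (0 <= eta%:E)%E by rewrite lee_fin.
apply: (@le_trans _ _ (\int[leb2 R]_(z in Omega) (((dside R n ^+ 2)^-1)%:E * local_dev z n + eta%:E))%E).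
  apply: ge0_le_integral => //.
  - exact: measurable_funTS.
  - by apply: measurable_funTS; exact: emeasurable_funD.
  - move=> z Oz; apply: (@le_trans _ _ (`|u z - davg u z n|%:E + eta%:E)%E).
      by clear n2; rewrite -EFinD lee_fin; have := Ae _ Oz; have := lerB_dist (u z) (davg u z n); lra.
    apply: leeD => //; rewrite lee_pdivlMl// muleC; exact: davg_local_dev.
rewrite (plane_integralD mO m1 m2 n1 n2) EFinD; apply: leeD.
  rewrite ge0_integralZl//; last 3 first.
  - exact: measurable_funTS (measurable_local_dev n).
  - by move=> z _; exact: local_dev_ge0.
  - by rewrite lee_fin invr_ge0 ltW.
  rewrite lee_pdivrMl// -EFinM; apply: le_trans (integral_local_dev_le n).
  apply: ge0_subset_integral => //; first exact: measurable_local_dev.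
  by move=> z _; exact: local_dev_ge0.
rewrite [leLHS](@integral_cst _ _ _ (leb2 R) _ mO eta%:E) mulrC EFinM.
apply: lee_wpmul2l; first by rewrite lee_fin.
apply: le_trans (le_measure _ _ _ OU) _; rewrite ?inE//; first exact: measurable_square.
have E : leb2 R (square (-1) (-1) 2) = (2 ^+ 2)%:E by exact: square_area.
by clear n2; rewrite [leLHS]E lee_fin; lra.
Qed.

End level_sets.

(** * Means over a sector *)

Section shells.
Variable R : realType.
Local Notation nsq z := (z.1 ^+ 2 + z.2 ^+ 2 : R).

(** The radii are [2^-b] and [2^-a], squared to stay clear of square roots. The inner circle is
    included so that consecutive shells fit together without a gap. *)
Definition shell (a b : nat) : set (mplane R) :=
  [set z | 4^-1 ^+ b <= nsq z < 4^-1 ^+ a].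

Lemma measurable_nsq : measurable_fun [set: mplane R] (fun z : mplane R => nsq z).
Proof.
by apply: measurable_funD; apply: measurable_funX; [exact: measurable_fst|exact: measurable_snd].
Qed.

Lemma measurable_shell a b : measurable (shell a b).
Proof.
have -> : shell a b = (fun z : mplane R => nsq z) @^-1` `[(4^-1 ^+ b), (4^-1 ^+ a)[.
  by apply/seteqP; split => z; rewrite /shell/= in_itv/=.
rewrite -[X in measurable X]setTI.
by apply: measurable_nsq => //; exact: measurable_itv.
Qed.

Lemma quarter_pow n : (4^-1 : R) ^+ n = (2^-1 ^+ n) ^+ 2.
Proof. by rewrite -exprM mulnC exprM; congr (_ ^+ _); field. Qed.

Lemma shellSr a l : shell a (a + l.+1) = shell a (a + l) `|` shell (a + l) (a + l).+1.
Proof.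
have q1 : (4^-1 : R) <= 1 by rewrite invf_le1// ler1n.
have q0 : 0 <= (4^-1 : R) by rewrite invr_ge0.
have h1 : (4^-1 : R) ^+ (a + l) <= 4^-1 ^+ a by apply: ler_wiXn2l; rewrite ?leq_addr.
have h2 : (4^-1 : R) ^+ (a + l).+1 <= 4^-1 ^+ (a + l) by apply: ler_wiXn2l.
rewrite addnS; apply/seteqP; split => z; rewrite /shell/=.
  move=> /andP[z1 z2]; have [z3|z3] := leP (4^-1 ^+ (a + l)) (nsq z); [left|right].
    by rewrite z2.
  by rewrite z1.
by move=> [/andP[z1 z2]|/andP[z1 z2]]; apply/andP; split => //; lra.
Qed.

(** On the shell between scales [n + 1] and [n] the weight is at most [4^(n + 1)], while the
    enclosing square has area [4 * 4^-n]. The product 16 is independent of [n], so each of the [l]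
    shells contributes the same amount. *)
Lemma shell_integral_le (w : mplane R -> \bar R) (C : R) (a l : nat) :
  measurable_fun [set: mplane R] w -> (forall z, (0 <= w z)%E) ->
  (forall i, (i < l)%N -> (\int[leb2 R]_(z in dsquare (0%R : R * R) (a + i)) w z <=
     (dside R (a + i) ^+ 2 * C)%:E)%E) ->
  (\int[leb2 R]_(z in shell a (a + l)) (w z * ((nsq z)^-1)%:E) <= (16 * C * l%:R)%:E)%E.
Proof.
move=> mw w0.
have mq : measurable_fun [set: mplane R] (fun z : mplane R => ((nsq z)^-1)%:E).
  apply/measurable_EFinP; exact: (measurableT_comp (@measurable_invr R) measurable_nsq).
have mwq : measurable_fun [set: mplane R] (fun z => w z * ((nsq z)^-1)%:E)%E by exact: emeasurable_funM.
have wq0 z : (0 <= w z * ((nsq z)^-1)%:E)%E.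
  by rewrite mule_ge0// lee_fin invr_ge0 addr_ge0// sqr_ge0.
elim: l => [|l IH] H.
  rewrite mulr0 addn0 [X in integral _ X _](_ : _ = set0) ?integral_set0//.
  by apply/seteqP; split => // z; rewrite /shell/= => /andP[h1 h2]; lra.
have mS := measurable_shell a (a + l); have mS' := measurable_shell (a + l) (a + l).+1.
rewrite shellSr ge0_integral_setU//; last 2 first.
- exact: measurable_funTS.
- by apply/disj_setPS => z [/andP[h1 _] /andP[_ h4]]; have := lt_le_trans h4 h1; rewrite ltxx.
rewrite -[l.+1%:R]natr1 mulrDr EFinD; apply: leeD.
  by apply: IH => i il; apply: H; exact: leqW.
have := H l (ltnSn l); set n := (a + l)%N => Hl.
have n0 : 0 < (2^-1 : R) ^+ n by rewrite exprn_gt0.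
have q0 : 0 < (4^-1 : R) ^+ n by rewrite exprn_gt0// invr_gt0.
apply: (@le_trans _ _ ((4 / 4^-1 ^+ n)%:E * (dside R n ^+ 2 * C)%:E)%E); last first.
  rewrite -EFinM lee_fin /dside exprMn -quarter_pow le_eqVlt; apply/orP; left; apply/eqP.
  by field; rewrite gt_eqF.
have c0 : 0 <= 4 / 4^-1 ^+ n :> R by rewrite divr_ge0// ltW.
apply: (@le_trans _ _ ((4 / 4^-1 ^+ n)%:E * \int[leb2 R]_(z in dsquare (0%R : R * R) n) w z)%E); last first.
  by apply: lee_wpmul2l; rewrite ?lee_fin.
have mT := measurable_dsquare (0 : R * R) n.
have mwT : measurable_fun (dsquare (0 : R * R) n) w by exact: measurable_funTS.
rewrite -ge0_integralZl// integral_mkcond [leRHS]integral_mkcond.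
have mw4 : measurable_fun [set: mplane R] (fun z => (4 / 4^-1 ^+ n)%:E * w z)%E.
  by apply: emeasurable_funM => //; exact: measurable_cst.
apply: ge0_le_integral => //.
- by move=> z _; rewrite patchE; case: ifP.
- by apply/(measurable_restrictT _ _).1 => //; exact: measurable_funTS.
- by apply/(measurable_restrictT _ _).1 => //; exact: measurable_funTS.
- move=> z _; rewrite !patchE; case: ifPn => [/set_mem/=/andP[z1 z2]|_]; last first.
    by case: ifP => // _; rewrite mule_ge0// lee_fin.
  have s1 := sqr_ge0 z.1; have s2 := sqr_ge0 z.2.
  rewrite ifT; last first.
    apply/mem_set/dsquareE; rewrite !subr0.
    by split; rewrite -(@ltr_pXn2r _ 2)// ?nnegrE ?ltW// real_normK ?num_real// -quarter_pow;
      apply: le_lt_trans z2; rewrite ?lerDl ?lerDr.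
  rewrite muleC; apply: lee_wpmul2r => //; rewrite lee_fin.
  have z0 : 0 < 4^-1 ^+ n.+1 :> R by rewrite exprn_gt0// invr_gt0.
  have -> : 4 / 4^-1 ^+ n = (4^-1 ^+ n.+1)^-1 :> R.
    by rewrite exprS invfM invrK.
  by rewrite lef_pV2// posrE// (lt_le_trans z0 z1).
Qed.

End shells.

Section sector_piece.
Variable R : realType.

(** This is beta, the [q]-th root of 1/2. *)
Definition half_root (q : nat) : R := 2^-1 `^ (q%:R^-1).

Definition sector_piece (q : nat) : set (mplane R) :=
  @sector R `&` annulus (half_root q / 2) 2^-1.

Lemma measurable_sector_piece q : measurable (sector_piece q).
Proof. by apply: measurableI; [exact: measurable_sector|exact: measurable_annulus]. Qed.

Lemma sector_piece_disk q : sector_piece q `<=` disk 1.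
Proof.
move=> z [_ /andP[_ h]]; rewrite /disk/= /euclid -(ltr_pXn2r (n := 2))// ?nnegrE//.
by rewrite expr1n sqr_sqrtr ?addr_ge0 ?sqr_ge0//; apply: lt_trans h _; lra.
Qed.

Lemma half_root_gt0 q : 0 < half_root q.
Proof. by rewrite /half_root powR_gt0. Qed.

Lemma half_root_pow q : (0 < q)%N -> half_root q ^+ q = 2^-1.
Proof.
move=> q0; rewrite -powR_mulrn ?ltW ?half_root_gt0// -powRrM mulVf ?powRr1//.
by rewrite pnatr_eq0 -lt0n.
Qed.

Lemma half_root_lt1 q : (0 < q)%N -> half_root q < 1.
Proof.
move=> q0; rewrite ltNge; apply/negP => h; have := half_root_pow q0.
by have := exprn_ege1 q h; lra.
Qed.

Lemma bernoulli (x : R) n : 0 <= x -> x <= 1 -> 1 - n%:R * x <= (1 - x) ^+ n.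
Proof.
move=> x0 x1; elim: n => [|n IH]; first by rewrite mul0r subr0 expr0.
rewrite exprS -natr1; apply: (@le_trans _ _ ((1 - x) * (1 - n%:R * x))).
  by have := ler0n R n; nra.
by rewrite ler_wpM2l// subr_ge0.
Qed.

Definition sector_piece_area (q : nat) : R :=
  pi / 4 * (2^-1 ^+ 2 - (half_root q / 2) ^+ 2).

Lemma sector_pieceE q : (0 < q)%N -> (leb2 R) (sector_piece q) = (sector_piece_area q)%:E.
Proof.
move=> q0; have b0 := half_root_gt0 q; have b1 := half_root_lt1 q0.
rewrite /sector_piece_area -sector_annulus_area; [|lra|lra].
have mS := measurable_sector_piece q.
by rewrite [RHS](@integral_cst _ _ _ (leb2 R) _ mS 1%E) mul1e.
Qed.

(** Bernoulli's inequality for [x = 1 - beta^2] reads [1 - q x <= beta^(2 q) = 1/4], so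
    [x >= 3 / (4 q)]. With [pi >= 2] the area [pi / 4 * x / 4] is at least [3 / (32 q)]. *)
Lemma sector_piece_area_ge q : (0 < q)%N -> 3 / (32 * q%:R) <= sector_piece_area q.
Proof.
move=> q0; have b0 := half_root_gt0 q; have b1 := half_root_lt1 q0.
have q0' : 0 < q%:R :> R by rewrite ltr0n.
have b2 : 0 <= 1 - half_root q ^+ 2 <= 1 by nra.
have /andP[b3 b4] := b2.
have := bernoulli q b3 b4; rewrite subKr -exprM mulnC exprM half_root_pow// => h.
have h3 : 3 / (4 * q%:R) <= 1 - half_root q ^+ 2.
  by rewrite ler_pdivrMr; [nra|lra].
have p2 : 2 <= pi :> R by exact: pi_ge2.
rewrite /sector_piece_area.
have -> : 2^-1 ^+ 2 - (half_root q / 2) ^+ 2 = (1 - half_root q ^+ 2) / 4 by field.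
apply: (@le_trans _ _ (2 / 4 * ((3 / (4 * q%:R)) / 4))); last first.
  have x0 : 0 <= 3 / (4 * q%:R) :> R by rewrite divr_ge0// mulr_ge0// ler0n.
  by apply: ler_pM; lra.
by rewrite le_eqVlt; apply/orP; left; apply/eqP; field; rewrite gt_eqF.
Qed.

(** As [(beta / 2)^(q l) = 2^-(q l + l)], the image under the power map of order [q l] meets only
    [l] shells. *)
Lemma annulus_shell q l : (0 < q)%N ->
  annulus ((half_root q / 2) ^+ (q * l)) (2^-1 ^+ (q * l)) `<=` @shell R (q * l) (q * l + l).
Proof.
move=> q0 z /andP[h1 h2]; rewrite /shell/= !quarter_pow h2 andbT.
by move: h1 => /ltW; rewrite exprMn exprM half_root_pow// -exprD addnC.
Qed.

Definition sector_mean (q : nat) (f : R * R -> R) : R := Rintegral (leb2 R) (sector_piece q) f.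

Variables (u g : R * R -> R) (Gam : R).
Hypotheses (mu : measurable_fun [set: mplane R] u) (mg : measurable_fun [set: mplane R] g).
Hypotheses (iu : (\int[leb2 R]_z `|u z|%:E < +oo)%E) (g0 : forall z, 0 <= g z).
Hypotheses (Gam0 : 0 <= Gam) (gGam : (\int[leb2 R]_z (g z ^+ 2)%:E <= (Gam ^+ 2)%:E)%E).
Hypothesis poincare : forall a b h, 0 <= h ->
  (\int[leb2 R]_(p in square a b h) \int[leb2 R]_(q in square a b h) `|(u p - u q)%R|%:E <=
   (h ^+ 3)%:E * \int[leb2 R]_(p in square a b h) (g p)%:E)%E.

(** Transport by the power map costs [3 / (q l)], and each of the [l] shells costs 16 times the
    oscillation bound [9 Gam sqrt l]. Hence 432, and a net factor [sqrt l / q]. *)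
Lemma sector_dev_le (zeta : R * R) q l : (0 < q)%N -> (0 < l)%N ->
  (\int[leb2 R]_(z in sector_piece q)
      `|(u (zeta + cpow z (q * l)) - davg u zeta (q * l))%R|%:E <=
   (432 * Gam * Num.sqrt l%:R / q%:R)%:E)%E.
Proof.
move=> q0 l0; set j := (q * l)%N; set A := davg u zeta j.
have j0 : (0 < j)%N by rewrite muln_gt0 q0.
have b0 := half_root_gt0 q; have b1 := half_root_lt1 q0.
have q0' : 0 < q%:R :> R by rewrite ltr0n.
have l0' : 0 < l%:R :> R by rewrite ltr0n.
have mA := measurable_abs_cst A mu.
pose w (z : mplane R) := (`|u (zeta + z) - A|%:E)%E.
have mw : measurable_fun [set: mplane R] w.
  apply: (measurableT_comp mA).
  by apply/measurable_fun_pairP; split; rewrite /comp/=; exact: measurable_funD.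
have w0 z : (0 <= w z)%E by rewrite lee_fin.
have r0 : 0 < half_root q / 2 by lra.
have r1 : half_root q / 2 < 2^-1 by lra.
have r2 : 2^-1 <= 1 :> R by lra.
apply: le_trans (cpow_integral_le j0 r0 r1 r2 mw w0) _.
have j0' : 0 < j%:R :> R by rewrite ltr0n.
have s1 : 1 <= Num.sqrt (l%:R : R) by rewrite -[leLHS]sqrtr1 ler_sqrt ?ler0n// ler1n.
(* This absorbs [Gam * (1 + 8 sqrt i)] for every [i < l], because [sqrt l >= 1]. *)
pose C := 9 * Gam * Num.sqrt l%:R.
apply: (@le_trans _ _ ((3 / j%:R)%:E * (16 * C * l%:R)%:E)%E).
  apply: lee_wpmul2l; first by rewrite lee_fin divr_ge0// ltW.
  apply: (@le_trans _ _ (\int[leb2 R]_(z in shell j (j + l)) (w z * ((z.1 ^+ 2 + z.2 ^+ 2)^-1)%:E))%E).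
    apply: ge0_subset_integral.
    - exact: measurable_annulus.
    - exact: measurable_shell.
    - apply: measurable_funTS; apply: emeasurable_funM => //; apply/measurable_EFinP.
      exact: (measurableT_comp (@measurable_invr R) (@measurable_nsq R)).
    - by move=> z _; rewrite mule_ge0// lee_fin invr_ge0 addr_ge0// sqr_ge0.
    - exact: annulus_shell.
  apply: shell_integral_le => // i il.
  have n0 (p : mplane R) : (0 <= `|u p - A|%:E)%E by rewrite lee_fin.
  rewrite -(dsquare_translate zeta _ mA n0).
  apply: le_trans (davg_osc_le mu mg iu g0 Gam0 gGam poincare zeta j i) _.
  rewrite lee_fin ler_wpM2l ?sqr_ge0// /C.
  have s2 : Num.sqrt (i%:R : R) <= Num.sqrt l%:R by rewrite ler_sqrt ?ler0n// ler_nat ltnW.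
  have -> : 9 * Gam * Num.sqrt (l%:R : R) = Gam * (9 * Num.sqrt l%:R) by ring.
  by rewrite ler_wpM2l//; lra.
rewrite -EFinM lee_fin le_eqVlt; apply/orP; left; apply/eqP.
by rewrite /C /j natrM; field; rewrite !gt_eqF.
Qed.

(** Dividing the deviation by the area of the piece, at least [3 / (32 q)], turns 432 into 4608 and
    the error into [Gam sqrt l], up to that constant. Written relative to [sqrt (q l)], this is the
    gain [1 / sqrt q], uniform in [l] and [zeta]. *)
Lemma davg_sector_le (zeta : R * R) q l : (0 < q)%N -> (0 < l)%N ->
  `|davg u zeta (q * l)| <= Num.sqrt (q * l)%:R *
     (32 * q%:R / 3 * `|sector_mean q (gop (q * l) zeta u)| + 4608 * Gam / Num.sqrt q%:R).
Proof.
move=> q0 l0; have dev := sector_dev_le zeta q0 l0.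
have q0' : 0 < q%:R :> R by rewrite ltr0n.
set j := (q * l)%N in dev *; set A := davg u zeta j in dev *.
have mS := measurable_sector_piece q; have lS := sector_pieceE q0.
pose v z := u (zeta + cpow z j).
have j0' : 0 < j%:R :> R by rewrite ltr0n muln_gt0 q0.
have mv : measurable_fun [set: mplane R] v.
  have m1 : measurable_fun [set: mplane R] (fun z : mplane R => zeta + z : mplane R).
    by apply/measurable_fun_pairP; split; rewrite /comp/=; exact: measurable_funD.
  exact: (measurableT_comp mu (measurableT_comp m1 (@measurable_cpow R j))).
have iv : (leb2 R).-integrable (sector_piece q) (EFin \o v).
  apply/integrableP; split; first by apply: measurable_funTS; exact/measurable_EFinP.
  apply: le_lt_trans (le_integral_norm (g := fun=> A) mS mv _) _; first exact: measurable_cst.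
  have -> : (\int[leb2 R]_(z in sector_piece q) `|A|%:E = (`|A| * sector_piece_area q)%:E)%E.
    by rewrite EFinM -lS; exact: (@integral_cst _ _ _ (leb2 R) _ mS `|A|%:E).
  by apply: lte_add_pinfty; rewrite ?ltry//; apply: le_lt_trans dev _; rewrite ltry.
have gopE : sector_mean q (gop j zeta u) = (Num.sqrt j%:R)^-1 * sector_mean q v.
  rewrite /sector_mean -RintegralZl//; apply: eq_Rintegral => z /set_mem Sz.
  rewrite /gop /patch mem_set; last exact: sector_piece_disk Sz.
  by rewrite powRN powR12_sqrt// ltW.
have sj : 0 < Num.sqrt (j%:R : R) by rewrite sqrtr_gt0.
have := dist_Rintegral_le A mS iv lS.
have -> : (\int[leb2 R]_(z in sector_piece q) `|(A - v z)%R|%:E =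
    \int[leb2 R]_(z in sector_piece q) `|(v z - A)%R|%:E)%E.
  by apply: eq_integral => z _; rewrite distrC.
move=> /le_trans/(_ dev); rewrite lee_fin -/(sector_mean q v) => h.
have h2 : `|A| * sector_piece_area q <= `|sector_mean q v| + 432 * Gam * Num.sqrt l%:R / q%:R.
  have a0 : 0 <= sector_piece_area q.
    by apply: le_trans (sector_piece_area_ge q0); rewrite divr_ge0// mulr_ge0// ltW.
  rewrite -{1}(ger0_norm a0) -normrM -lerBlDl; apply: le_trans h; exact: lerB_dist.
have h3 : `|A| * (3 / (32 * q%:R)) <= `|sector_mean q v| + 432 * Gam * Num.sqrt l%:R / q%:R.
  by apply: le_trans h2; rewrite ler_wpM2l// sector_piece_area_ge.
have sq : 0 < Num.sqrt (q%:R : R) by rewrite sqrtr_gt0.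
have sjE : Num.sqrt (j%:R : R) = Num.sqrt q%:R * Num.sqrt l%:R by rewrite /j natrM sqrtrM.
have nE (m : R) : `|(Num.sqrt j%:R)^-1 * m| = (Num.sqrt j%:R)^-1 * `|m|.
  by rewrite normrM ger0_norm// invr_ge0 ltW.
rewrite gopE nE.
have h4 : `|A| <= (`|sector_mean q v| + 432 * Gam * Num.sqrt l%:R / q%:R) * (32 * q%:R / 3).
  rewrite -ler_pdivrMr; last by rewrite divr_gt0// mulr_gt0.
  by rewrite invf_div.
apply: le_trans h4 _; rewrite le_eqVlt; apply/orP; left; apply/eqP.
rewrite mulrDl mulrDr; congr (_ + _).
  by field; rewrite gt_eqF.
rewrite sjE; move: (Num.sqrt q%:R) (Num.sqrt l%:R) sq => s t s0; field; rewrite !gt_eqF//.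
Qed.

End sector_piece.

(** * Exponential integrals *)

Section exponential.
Variable R : realType.
Implicit Types (x : R).

(** A power of 2 is wanted, to be cancelled by dyadic measures. From [exp (-1/2) >= 1/2] one gets
    [exp (1/2) <= 2], and squaring gives 4. *)
Lemma expR1_le4 : expR 1 <= 4 :> R.
Proof.
have h := expR_ge1Dx (- 2^-1 : R).
have e0 := expR_gt0 (2^-1 : R).
have e2 : expR (2^-1 : R) <= 2.
  move: h; rewrite expRN; move: (expR 2^-1) e0 => t t0 h.
  by have := mulfV (lt0r_neq0 t0); nra.
have -> : (1 : R) = 2%:R * 2^-1 by rewrite mulfV.
by rewrite expRM_natl; nra.
Qed.

Lemma expRB1_le x : expR x - 1 <= x * expR x.
Proof.
have e0 := expR_gt0 x; have h := expR_ge1Dx (- x).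
have -> : x * expR x = expR x - (1 - x) * expR x by ring.
rewrite lerD2l lerN2 -[leRHS](@mulVf _ (expR x)) ?gt_eqF// -expRN.
by rewrite ler_wpM2r// ltW.
Qed.

(** On a bounded range the integrand grows at most linearly in [|r|], which leaves this part to the
    L^1 norm. *)
Lemma sqr_exp_le (lam r c : R) : 0 <= lam -> `|r| <= c ->
  expR (lam * r ^+ 2) - 1 <= lam * c * expR (lam * c ^+ 2) * `|r|.
Proof.
move=> l0 rc; have n0 := normr_ge0 r.
rewrite -[r ^+ 2]real_normK ?num_real//; move: (`|r|) rc n0 => t tc t0.
have c0 : 0 <= c := le_trans t0 tc.
apply: le_trans (expRB1_le _) _.
have -> : lam * c * expR (lam * c ^+ 2) * t = lam * (c * t) * expR (lam * c ^+ 2) by ring.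
apply: ler_pM; rewrite ?expR_ge0 ?mulr_ge0 ?sqr_ge0//.
  by rewrite ler_wpM2l// expr2 ler_wpM2r.
by rewrite ler_expR ler_wpM2l// lerXn2r// nnegrE.
Qed.

Definition level (v : R * R -> R) (i : nat) : set (mplane R) := [set z | i%:R < `|v z|].

Lemma measurable_level v i : measurable_fun [set: mplane R] v -> measurable (level v i).
Proof.
move=> mv.
have -> : level v i = (fun z => `|v z|) @^-1` `]i%:R, +oo[.
  by apply/seteqP; split => z /=; rewrite /level/= in_itv/= andbT.
rewrite -[X in measurable X]setTI.
have : measurable_fun [set: mplane R] (fun z => `|v z|) by exact: measurableT_comp.
by apply => //; exact: measurable_itv.
Qed.

Lemma geometric_sum_le (i n : nat) :
  \sum_(0 <= k < n) (2^-1 : R) ^+ (i + k) <= 2 * 2^-1 ^+ i.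
Proof.
suff -> : \sum_(0 <= k < n) (2^-1 : R) ^+ (i + k) = 2 * 2^-1 ^+ i - 2 * 2^-1 ^+ (i + n).
  by rewrite gerBl mulr_ge0// exprn_ge0.
elim: n => [|n IH]; first by rewrite big_geq// addn0 subrr.
by rewrite big_nat_recr//= IH addnS exprS; field.
Qed.

(** Where [|v| <= i0] the integrand is linear in [|v|] up to a constant. Where [i < |v| <= i + 1] it
    is below [exp (lam (i + 1)^2)], one term of the series [F], and the hypothesis makes the
    integrals of these terms geometric. *)
Lemma exp_tail_le (Omega : set (mplane R)) (v : R * R -> R) (lam B : R) (i0 : nat) :
  measurable Omega -> measurable_fun [set: mplane R] v -> 0 <= lam -> 0 <= B ->
  (forall i, (i0 <= i)%N -> ((leb2 R) (Omega `&` level v i) *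
     (expR (lam * i.+1%:R ^+ 2))%:E <= (B * 2^-1 ^+ i)%:E)%E) ->
  (\int[leb2 R]_(z in Omega) (expR (lam * v z ^+ 2) - 1)%:E <=
   (lam * i0%:R * expR (lam * i0%:R ^+ 2))%:E * \int[leb2 R]_(z in Omega) `|v z|%:E +
   (2 * B * 2^-1 ^+ i0)%:E)%E.
Proof.
move=> mO mv l0 B0 H.
set c := lam * i0%:R * expR (lam * i0%:R ^+ 2).
have c0 : 0 <= c by rewrite !mulr_ge0// ?expR_ge0.
pose a (k : nat) := expR (lam * (i0 + k).+1%:R ^+ 2).
have a0 k : 0 <= a k by exact: expR_ge0.
pose f (k : nat) (z : mplane R) : \bar R := (a k * \1_(level v (i0 + k)) z)%:E.
have f0 k z : (0 <= f k z)%E by rewrite lee_fin mulr_ge0// indicE.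
have mf k : measurable_fun [set: mplane R] (f k).
  apply/measurable_EFinP; apply: measurable_funM; first exact: measurable_cst.
  by apply: measurable_indic; exact: measurable_level.
have f0' k z : true -> (0 <= f k z)%E by [].
pose F (z : mplane R) : \bar R := (\sum_(0 <= k <oo) f k z)%E.
have F0 z : (0 <= F z)%E by apply: nneseries_ge0 => k _ _.
have mF : measurable_fun [set: mplane R] F by apply: ge0_emeasurable_sum.
have mE : measurable_fun [set: mplane R] (fun z => (expR (lam * v z ^+ 2) - 1)%:E).
  apply/measurable_EFinP; apply: measurable_funB => //.
  apply: measurableT_comp => //; apply: measurable_funM => //; exact: measurable_funX.
have mc : measurable_fun [set: mplane R] (fun z => (c * `|v z|)%:E).
  by apply/measurable_EFinP; apply: measurable_funM => //; exact: measurableT_comp.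
have E0 z : (0 <= (expR (lam * v z ^+ 2) - 1)%:E)%E.
  rewrite lee_fin subr_ge0; apply: le_trans (expR_ge1Dx _).
  by rewrite lerDl mulr_ge0// sqr_ge0.
have c0' (z : mplane R) : (0 <= (c * `|v z|)%:E)%E by rewrite lee_fin mulr_ge0.
apply: (@le_trans _ _ (\int[leb2 R]_(z in Omega) ((c * `|v z|)%R%:E + F z))%E).
  apply: ge0_le_integral => //.
  - exact: measurable_funTS.
  - by apply: measurable_funTS; exact: emeasurable_funD.
  - move=> z _; have [vi|vi] := leP `|v z| i0%:R.
      apply: (@le_trans _ _ ((c * `|v z|)%:E + 0)%E); last exact: leeD.
      by rewrite adde0 lee_fin; exact: sqr_exp_le.
    have ex : exists n : nat, `|v z| <= n%:R.
      by exists (Num.truncn `|v z|).+1; rewrite ltW// truncnS_gt.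
    (* The least natural number above [|v z|] is [i + 1], so [z] belongs to [level v i]. *)
    case: (ex_minnP ex) => -[|i] vn mn.
      by have := le_lt_trans (ler0n R i0) vi; rewrite ltNge vn.
    have iv : i%:R < `|v z| by rewrite ltNge; apply/negP => /mn; rewrite ltnn.
    have ii : (i0 <= i)%N.
      by have := lt_le_trans vi vn; rewrite ltr_nat ltnS.
    apply: (@le_trans _ _ (0 + F z)%E); last by apply: leeD.
    rewrite add0e; apply: (@le_trans _ _ (f (i - i0)%N z)).
      rewrite lee_fin indicE mem_set; last by rewrite /level/= subnKC.
      rewrite mulr1 /a subnKC// lerBlDr (@le_trans _ _ (expR (lam * i.+1%:R ^+ 2)))//; last by rewrite lerDl.
      rewrite ler_expR ler_wpM2l// -[v z ^+ 2]real_normK ?num_real//.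
      by rewrite lerXn2r// nnegrE.
    apply: le_trans (nneseries_lim_ge (i - i0).+1 (fun k _ _ => f0 k z)).
    by rewrite big_nat_recr//= leeDr// sume_ge0.
rewrite (plane_integralD mO mc mF c0' F0); apply: leeD.
  under eq_integral do rewrite EFinM.
  rewrite ge0_integralZl//.
  by apply: measurable_funTS; apply/measurable_EFinP; exact: measurableT_comp.
rewrite /F integral_nneseries//; last by move=> k; exact: measurable_funTS.
apply: lime_le; first by apply: is_cvg_nneseries => k _ _; exact: integral_ge0.
apply: nearW => n.
apply: (@le_trans _ _ (\sum_(0 <= k < n) (B * 2^-1 ^+ (i0 + k))%:E)%E); last first.
  rewrite sumEFin lee_fin -mulr_sumr [2 * B]mulrC -mulrA.
  by rewrite ler_wpM2l// geometric_sum_le.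
apply: lee_sum => k _; have := H _ (leq_addr k i0); rewrite -/(a k); apply: le_trans.
have mL := measurable_level (i0 + k) mv.
rewrite /f; under eq_integral do rewrite EFinM.
rewrite ge0_integralZl//.
- by rewrite integral_indic// setIC muleC.
- by apply: measurable_funTS; apply/measurable_EFinP; exact: measurable_indic.
- by rewrite lee_fin.
Qed.

End exponential.

(** * From small dyadic means to exponential integrals *)

Section moser.
Variable R : realType.
Variables (u : R * R -> R) (T : R).
Hypotheses (mu : measurable_fun [set: mplane R] u) (iu : (\int[leb2 R]_z `|u z|%:E < +oo)%E).
Hypothesis T0 : 0 <= T.
Hypothesis translate_le : forall w : R * R,
  (\int[leb2 R]_z `|u (z + w)%R - u z|%:E <= ((`|w.1| + `|w.2|) * T)%:E)%E.

(* With |A_N| <= s i/2 for N about (2m+1) i^2, the level set {|u/s| > i} has measure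
   at most (4T/s) 2^-N, which beats exp(lam (i+1)^2) <= 4^(m i^2). *)
Lemma moser_le (Omega : set (mplane R)) (lam s : R) (m q i0 : nat) :
  measurable Omega -> 0 <= lam -> 4 * lam <= m%:R -> 0 < s -> (0 < q)%N -> (0 < i0)%N ->
  (q <= (2 * m).+1 * i0 ^ 2)%N ->
  (forall z l, Omega z -> (0 < l)%N ->
     `|davg u z (q * l)| <= s / (2 * Num.sqrt (2 * (2 * m).+1%:R)) * Num.sqrt (q * l)%:R) ->
  (\int[leb2 R]_(z in Omega) (expR (lam * (u z / s) ^+ 2) - 1)%:E <=
   (lam * i0%:R * expR (lam * i0%:R ^+ 2))%:E * \int[leb2 R]_(z in Omega) `|(u z / s)%R|%:E +
   (8 * T / s * 2^-1 ^+ i0)%:E)%E.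
Proof.
move=> mO l0 lm s0 q0 i00 qi Ab.
set K := (2 * m).+1 in qi Ab *.
have mv : measurable_fun [set: mplane R] (fun z => u z / s).
  by apply: measurable_funM => //; exact: measurable_cst.
have -> : 8 * T / s = 2 * (4 * T / s) by field; rewrite gt_eqF.
have B0 : 0 <= 4 * T / s by rewrite divr_ge0 ?mulr_ge0// ltW.
apply: exp_tail_le => // i ii0.
have i_gt0 : (0 < i)%N := leq_trans i00 ii0.
(* [K i^2 / q] rounded up, so that [q l] is the first multiple of [q] from [K i^2] on. It stays
   below [2 K i^2] because [q <= K i^2]. *)
pose l := ((K * i ^ 2 + q.-1) %/ q)%N.
have qK : (q <= K * i ^ 2)%N.
  by apply: leq_trans qi _; rewrite leq_mul2l leq_exp2r// ii0 orbT.
have lge : (K * i ^ 2 <= q * l)%N.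
  have := divn_eq (K * i ^ 2 + q.-1) q; have := ltn_pmod (K * i ^ 2 + q.-1) q0.
  by rewrite -/l mulnC; lia.
have lle : (q * l <= 2 * (K * i ^ 2))%N.
  have := leq_trunc_div (K * i ^ 2 + q.-1) q; rewrite -/l mulnC; lia.
have l_gt0 : (0 < l)%N.
  by rewrite lt0n; apply/eqP => l00; move: lge; rewrite l00 muln0 leqn0 muln_eq0 expn_eq0; lia.
have i_gt0' : 0 < i%:R :> R by rewrite ltr0n.
have K0 : 0 < Num.sqrt (2 * K%:R) :> R by rewrite sqrtr_gt0 mulr_gt0.
have level_eq : Omega `&` level (fun z => u z / s) i = Omega `&` [set z | (i%:R * s < `|u z|)%R].
  congr (_ `&` _); apply/seteqP; split => z; rewrite /level/= normrM (gtr0_norm (x := s^-1)) ?invr_gt0//;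
    by rewrite ltr_pdivlMr.
have t0 : 0 < i%:R * s by rewrite mulr_gt0.
have At z : Omega z -> `|davg u z (q * l)| <= i%:R * s / 2.
  move=> Oz; apply: le_trans (Ab _ _ Oz l_gt0) _.
  (* The factor in the hypothesis on the means is calibrated so that this bound yields exactly
     [s i / 2], half of the level. *)
  have h : Num.sqrt (q * l)%:R <= Num.sqrt (2 * K%:R) * i%:R :> R.
    rewrite -[i%:R]ger0_norm// -sqrtr_sqr -sqrtrM ?mulr_ge0// ler_sqrt ?mulr_ge0 ?sqr_ge0//.
    by rewrite -natrX -!natrM ler_nat -mulnA.
  apply: (@le_trans _ _ (s / (2 * Num.sqrt (2 * K%:R)) * (Num.sqrt (2 * K%:R) * i%:R))).
    by rewrite ler_wpM2l// divr_ge0// ?ltW// mulr_gt0.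
  by rewrite le_eqVlt; apply/orP; left; apply/eqP; field; rewrite gt_eqF.
have L := level_set_le mu iu T0 translate_le mO t0 At.
rewrite level_eq; apply: le_trans (lee_wpmul2r _ L) _; first by rewrite lee_fin expR_ge0.
rewrite -EFinM lee_fin.
(* Here [i + 1 <= 2 i], so the exponent is at most [4 lam i^2 <= m i^2]. *)
have e1 : expR (lam * i.+1%:R ^+ 2) <= 4 ^+ (m * i ^ 2).
  apply: (@le_trans _ _ (expR ((m * i ^ 2)%:R * 1))).
    rewrite ler_expR mulr1 natrM natrX.
    apply: (@le_trans _ _ (4 * lam * i%:R ^+ 2)); last by rewrite ler_wpM2r// sqr_ge0.
    rewrite [4 * lam]mulrC -mulrA ler_wpM2l//.
    have -> : 4 * i%:R ^+ 2 = (2 * i%:R) ^+ 2 :> R by ring.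
    by rewrite lerXn2r ?nnegrE ?mulr_ge0// -natr1; have := ler_nat R 1 i; rewrite i_gt0; lra.
  rewrite expRM_natl lerXn2r ?nnegrE ?expR_ge0//; exact: expR1_le4.
have e2 : 2^-1 ^+ (q * l) <= 2^-1 ^+ (K * i ^ 2) :> R by apply: ler_wiXn2l; rewrite ?invr_ge0//; lra.
(* Of [K = 2 m + 1], the part [2 m] cancels the exponential and the remaining 1 supplies the
   geometric decay. *)
have e3 : 2^-1 ^+ (K * i ^ 2) * 4 ^+ (m * i ^ 2) = 2^-1 ^+ (i ^ 2) :> R.
  have -> : (K * i ^ 2 = i ^ 2 + 2 * (m * i ^ 2))%N by rewrite /K mulSn mulnA.
  have q4 : 2^-1 ^+ 2 * 4 = 1 :> R by field.
  by rewrite exprD -mulrA exprM -exprMn q4 expr1n mulr1.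
have e4 : 2^-1 ^+ (i ^ 2) <= 2^-1 ^+ i :> R.
  by apply: ler_wiXn2l; rewrite ?invr_ge0//; [lra|rewrite expnS expn1 leq_pmull].
have e5 : 2^-1 ^+ (q * l) * expR (lam * i.+1%:R ^+ 2) <= 2^-1 ^+ i.
  apply: le_trans e4; rewrite -e3; apply: ler_pM => //; rewrite ?expR_ge0 ?exprn_ge0//.
have i1 : 1 <= i%:R :> R by rewrite ler1n.
rewrite /dside.
set x := 2^-1 ^+ (q * l) in e5 *; set y := expR _ in e5 *.
have -> : 2 * (2 * x) * T / (i%:R * s) * y = (4 * T / s) * ((x * y) / i%:R).
  by field; rewrite !gt_eqF.
rewrite ler_wpM2l// ler_pdivrMr//; apply: le_trans e5 _.
by rewrite ler_peMr// exprn_ge0.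
Qed.

End moser.

(** * Integration by parts *)

Section integration_by_parts.
Variable R : realType.
Implicit Types (f g h k phi psi : R * R -> R).
Local Notation leb1 := (@lebesgue_measure R).
Local Notation D1 phi := ('D_(e_ R false) phi).
Local Notation D2 phi := ('D_(e_ R true) phi).

Lemma integrable_plane f : measurable_fun [set: mplane R] f ->
  (\int[leb2 R]_z `|f z|%:E < +oo)%E -> (leb2 R).-integrable setT (EFin \o f).
Proof. by move=> mf fi; apply/integrableP; split => //; exact/measurable_EFinP. Qed.

Lemma disk_integrable f : continuous f -> (forall z, ~ disk 1 z -> f z = 0) ->
  (leb2 R).-integrable setT (EFin \o f).
Proof.
move=> cf f0; have mf := continuous_measurable_plane cf.
apply: integrable_plane => //; rewrite (integral_disk f0).
have [B B0 fB] := C1disk_bounded cf f0.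
have mU : measurable (@unit_square R) by exact: measurable_square.
apply: (@le_lt_trans _ _ (\int[leb2 R]_(z in @unit_square R) cst B%:E z)%E).
  apply: ge0_le_integral => //.
  - by apply: measurable_funTS; apply/measurable_EFinP; exact: measurableT_comp.
  - by move=> z _; rewrite lee_fin.
have -> : (\int[leb2 R]_(z in @unit_square R) cst B%:E z = B%:E * leb2 R (@unit_square R))%E.
  exact: integral_cst.
have -> : leb2 R (@unit_square R) = (2 ^+ 2)%:E by exact: square_area.
by rewrite -EFinM ltry.
Qed.

Lemma slice_derive_integral0 F f (y : R) :
  (forall x : R, is_derive x 1 (fun s => F (s, y)) (f (x, y))) -> continuous f ->
  (forall z, ~ disk 1 z -> F z = 0) -> (forall z, ~ disk 1 z -> f z = 0) ->
  (\int[leb1]_x (f (x, y))%:E = 0)%E.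
Proof.
move=> dF cf F0 f0.
have out x : 1 <= `|x| -> ~ disk 1 (x, y).
  by move=> x1 /disk_itv[/=]; rewrite ltNge x1.
rewrite -(integral_deriv0 (L := 1) dF (continuous_slice1 cf)); last first.
  by move=> x x1; rewrite F0//; exact: out.
rewrite [RHS]integral_mkcond; apply: eq_integral => x _; rewrite patchE.
case: ifPn => // /negP nx; rewrite f0//; apply: out; rewrite leNgt; apply/negP => x1.
by apply: nx; apply/mem_set; rewrite /= in_itv/= -ler_norml ltW.
Qed.

Lemma slice_derive_integral0_swap F f (x : R) :
  (forall y : R, is_derive y 1 (fun s => F (x, s)) (f (x, y))) -> continuous f ->
  (forall z, ~ disk 1 z -> F z = 0) -> (forall z, ~ disk 1 z -> f z = 0) ->
  (\int[leb1]_y (f (x, y))%:E = 0)%E.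
Proof.
move=> dF cf F0 f0.
have out y : 1 <= `|y| -> ~ disk 1 (x, y).
  by move=> y1 /disk_itv[/= _]; rewrite ltNge y1.
rewrite -(integral_deriv0 (L := 1) dF (continuous_slice2 cf)); last first.
  by move=> y y1; rewrite F0//; exact: out.
rewrite [RHS]integral_mkcond; apply: eq_integral => y _; rewrite patchE.
case: ifPn => // /negP nx; rewrite f0//; apply: out; rewrite leNgt; apply/negP => x1.
by apply: nx; apply/mem_set; rewrite /= in_itv/= -ler_norml ltW.
Qed.

(** A partial derivative given as an explicit function and stated on lines, where the one-variable
    product rule and fundamental theorem apply; it suits shifts and products, which need not be test
    functions. *)
Definition slice_derivative (b : bool) h k : Prop :=
  forall x y : R, if b then is_derive y 1 (fun s => h (x, s)) (k (x, y))
                  else is_derive x 1 (fun s => h (s, y)) (k (x, y)).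

Lemma slice_derivativeM b h1 k1 h2 k2 : slice_derivative b h1 k1 -> slice_derivative b h2 k2 ->
  slice_derivative b (fun z => h1 z * h2 z) (fun z => k1 z * h2 z + h1 z * k2 z).
Proof.
move=> d1 d2 x y; move: (d1 x y) (d2 x y); case: b {d1 d2} => d1 d2;
  by have H := is_deriveM d1 d2; apply: is_derive_eq; rewrite /GRing.scale/= addrC [h2 _ * _]mulrC.
Qed.

Lemma C1disk_slice_derivative phi b : C1disk phi ->
  slice_derivative b phi ('D_(e_ R b) phi).
Proof.
by move=> [_ _ _ d _] x y; case: b; [exact: is_derive_slice2|exact: is_derive_slice1].
Qed.

Lemma slice_derivative_shift b psi (a : R * R) : (forall z, derivable psi z (e_ R b)) ->
  slice_derivative b (fun z => psi (z + a)) (fun z => 'D_(e_ R b) psi (z + a)).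
Proof.
move=> d x y; case: b d => d.
- have E : (fun h : R => h^-1 *: (((fun s => psi ((x, s) + a)) \o shift y) (h *: (1 : R)) - psi ((x, y) + a))) =
     (fun h : R => h^-1 *: ((psi \o shift ((x, y) + a)) (h *: e_ R true) - psi ((x, y) + a))).
    apply/funext => h; rewrite /= /e_ addrA; congr (_ *: (psi (_ + _) - _)).
    by rewrite addpE/= scaler0 add0r.
  by split; [rewrite /derivable E; exact: d|rewrite /derive E].
- have E : (fun h : R => h^-1 *: (((fun s => psi ((s, y) + a)) \o shift x) (h *: (1 : R)) - psi ((x, y) + a))) =
     (fun h : R => h^-1 *: ((psi \o shift ((x, y) + a)) (h *: e_ R false) - psi ((x, y) + a))).
    apply/funext => h; rewrite /= /e_ addrA; congr (_ *: (psi (_ + _) - _)).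
    by rewrite addpE/= scaler0 add0r.
  by split; [rewrite /derivable E; exact: d|rewrite /derive E].
Qed.

Lemma continuousM f g : continuous f -> continuous g -> continuous (fun z => f z * g z).
Proof. by move=> cf cg z; apply: cvgM; [exact: cf|exact: cg]. Qed.

Lemma continuousD f g : continuous f -> continuous g -> continuous (fun z => f z + g z).
Proof. by move=> cf cg z; apply: cvgD; [exact: cf|exact: cg]. Qed.

(** The product [phi * h] vanishes outside the disk, so the integral of its derivative is zero on
    every line; no decay of [h] is required. *)
Lemma C1disk_ibp b phi h k : C1disk phi -> slice_derivative b h k ->
  continuous h -> continuous k ->
  Rintegral (leb2 R) setT (fun z => phi z * k z) =
  - Rintegral (leb2 R) setT (fun z => 'D_(e_ R b) phi z * h z).
Proof.
move=> C dh ch ck; have [cp c1 c2 dp v] := C.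
have cD : continuous ('D_(e_ R b) phi) by case: (b).
have D0 z : ~ disk 1 z -> 'D_(e_ R b) phi z = 0 by move=> /v[_ ? ?]; case: (b).
have p0 z : ~ disk 1 z -> phi z = 0 by move=> /v[].
have i1 : (leb2 R).-integrable setT (EFin \o (fun z => 'D_(e_ R b) phi z * h z)).
  by apply: disk_integrable; [exact: continuousM|move=> z /D0 ->; rewrite mul0r].
have i2 : (leb2 R).-integrable setT (EFin \o (fun z => phi z * k z)).
  by apply: disk_integrable; [exact: continuousM|move=> z /p0 ->; rewrite mul0r].
apply/eqP; rewrite -subr_eq0 opprK addrC -RintegralD//; apply/eqP.
pose f z := 'D_(e_ R b) phi z * h z + phi z * k z.
have cf : continuous f by apply: continuousD; exact: continuousM.
have f0 z : ~ disk 1 z -> f z = 0 by move=> nz; rewrite /f D0// p0// !mul0r addr0.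
have if_ : (leb2 R).-integrable setT (EFin \o f) by exact: disk_integrable.
have dF : slice_derivative b (fun z => phi z * h z) f.
  exact: slice_derivativeM (C1disk_slice_derivative b C) dh.
have F0 z : ~ disk 1 z -> phi z * h z = 0 by move=> /p0 ->; rewrite mul0r.
rewrite /Rintegral -/f; have -> : (\int[leb2 R]_z (f z)%:E = 0)%E; last by [].
case: (b) dF => dF.
- have S x : (\int[leb1]_y (f (x, y))%:E = 0)%E.
    apply: (@slice_derive_integral0_swap (fun z => phi z * h z) f x _ cf F0 f0) => y; exact: (dF x y).
  by rewrite -(integral12_prod_meas1 if_) integral0_eq// => x _; exact: S.
- have S y : (\int[leb1]_x (f (x, y))%:E = 0)%E.
    apply: (@slice_derive_integral0 (fun z => phi z * h z) f y _ cf F0 f0) => x; exact: (dF x y).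
  by rewrite -(integral21_prod_meas1 if_) integral0_eq// => y _; exact: S.
Qed.

Lemma integrable_bounded_mul f k (B : R) : measurable_fun [set: mplane R] f ->
  (\int[leb2 R]_z `|f z|%:E < +oo)%E -> continuous k -> (forall z, `|k z| <= B) ->
  (leb2 R).-integrable setT (EFin \o (fun z => f z * k z)).
Proof.
move=> mf fi ck kB; have mk := continuous_measurable_plane ck.
have B0 : 0 <= B := le_trans (normr_ge0 _) (kB 0).
have mfE : measurable_fun [set: mplane R] (fun z => `|f z|%:E).
  exact: measurable_EFin_norm.
apply: integrable_plane; first exact: measurable_funM.
apply: (@le_lt_trans _ _ (\int[leb2 R]_z (B%:E * `|f z|%:E))%E).
  apply: ge0_le_integral => //.
  - by apply: measurable_EFin_norm; exact: measurable_funM.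
  - by apply: emeasurable_funM => //; exact: measurable_cst.
  - by move=> z _; rewrite -EFinM lee_fin normrM mulrC ler_wpM2r.
by rewrite ge0_integralZl ?lee_fin//; exact: lte_mul_pinfty.
Qed.

Lemma integrable_mul_L2 f g (a b : R) : measurable_fun [set: mplane R] f ->
  measurable_fun [set: mplane R] g -> 0 <= a -> 0 <= b ->
  (\int[leb2 R]_z (f z ^+ 2)%:E <= (a ^+ 2)%:E)%E ->
  (\int[leb2 R]_z (g z ^+ 2)%:E <= (b ^+ 2)%:E)%E ->
  (leb2 R).-integrable setT (EFin \o (fun z => f z * g z)).
Proof.
move=> mf mg a0 b0 fa gb; apply: integrable_plane; first exact: measurable_funM.
by apply: le_lt_trans (cauchy_schwarz mf mg a0 b0 fa gb) _; rewrite ltry.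
Qed.

Lemma Rintegral_le f (c : R) : (leb2 R).-integrable setT (EFin \o f) ->
  (\int[leb2 R]_z `|f z|%:E <= c%:E)%E -> `|Rintegral (leb2 R) setT f| <= c.
Proof.
move=> fi fc; rewrite -lee_fin; apply: le_trans fc.
by rewrite EFin_normr_Rintegral//; apply: le_abse_integral => //; case/integrableP: fi.
Qed.

Section weak.
Variables (Omega : set (R * R)) (u : R * R -> R) (G : R * R -> R * R) (M : R).
Hypotheses (Od : Omega `<=` disk 1) (uG : H01_grad Omega u G) (M0 : 0 <= M).
Hypotheses (GM1 : (\int[leb2 R]_z ((G z).1 ^+ 2)%:E <= (M ^+ 2)%:E)%E)
           (GM2 : (\int[leb2 R]_z ((G z).2 ^+ 2)%:E <= (M ^+ 2)%:E)%E).

Definition grad_component (b : bool) (z : R * R) : R := if b then (G z).2 else (G z).1.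

Let mu : measurable_fun [set: mplane R] u. Proof. by case: uG. Qed.
Let mG b : measurable_fun [set: mplane R] (grad_component b).
Proof. by case: uG => _ m1 m2 _ _; case: b. Qed.
Let GM b : (\int[leb2 R]_z (grad_component b z ^+ 2)%:E <= (M ^+ 2)%:E)%E.
Proof. by case: b. Qed.

Lemma H01_L1_fin : (\int[leb2 R]_z `|u z|%:E < +oo)%E.
Proof. by apply: le_lt_trans (H01_L1_le Od uG M0 GM1 GM2) _; rewrite ltry. Qed.

(** In the limit, L^1 convergence of the test functions is paired with the bounded [k] and L^2
    convergence of their gradients with the square integrable [h]. *)
Lemma H01_ibp b h k (B H : R) : slice_derivative b h k -> continuous h -> continuous k ->
  (forall z, `|k z| <= B) -> 0 <= H -> (\int[leb2 R]_z (h z ^+ 2)%:E <= (H ^+ 2)%:E)%E ->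
  Rintegral (leb2 R) setT (fun z => u z * k z) =
  - Rintegral (leb2 R) setT (fun z => grad_component b z * h z).
Proof.
move=> dh ch ck kB H0 hH; have mh := continuous_measurable_plane ch.
have B0 : 0 <= B := le_trans (normr_ge0 _) (kB 0).
have iu := integrable_bounded_mul mu H01_L1_fin ck kB.
have iG := integrable_mul_L2 (mG b) mh M0 H0 (GM b) hH.
apply/eqP; rewrite -addr_eq0 -normr_le0; apply/ler_addgt0Pr => e0 e0_gt0; rewrite add0r.
(* The two pairings err by [2 B e] and [H e]; the summand 1 keeps the denominator positive. *)
pose e := e0 / (2 * B + H + 1).
have den : 0 < 2 * B + H + 1 by lra.
have e_gt0 : 0 < e by rewrite divr_gt0.
have [phi [tf pu g1 g2]] := H01_approx Od uG e_gt0.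
have C := test_function_C1disk Od tf; have [cp c1 c2 _ v] := C.
have cD : continuous ('D_(e_ R b) phi) by case: (b).
have D0 z : ~ disk 1 z -> 'D_(e_ R b) phi z = 0 by move=> /v[_ ? ?]; case: (b).
have p0 z : ~ disk 1 z -> phi z = 0 by move=> /v[].
have mp := continuous_measurable_plane cp; have mD := continuous_measurable_plane cD.
have ip : (leb2 R).-integrable setT (EFin \o (fun z => phi z * k z)).
  by apply: disk_integrable; [exact: continuousM|move=> z /p0 ->; rewrite mul0r].
have iD : (leb2 R).-integrable setT (EFin \o (fun z => 'D_(e_ R b) phi z * h z)).
  by apply: disk_integrable; [exact: continuousM|move=> z /D0 ->; rewrite mul0r].
have L1 := H01_L1_small Od uG (ltW e_gt0) tf pu.
have gb : (\int[leb2 R]_z (('D_(e_ R b) phi z - grad_component b z) ^+ 2)%:E <= (e ^+ 2)%:E)%E.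
  by rewrite /grad_component; case: (b).
have E1 : `|Rintegral (leb2 R) setT (fun z => phi z * k z) -
    Rintegral (leb2 R) setT (fun z => u z * k z)| <= B * (e * 2).
  rewrite -RintegralB//.
  have md : measurable_fun [set: mplane R] (fun z => phi z - u z) by exact: measurable_funB.
  have mdE : measurable_fun [set: mplane R] (fun z => `|phi z - u z|%:E).
    exact: measurable_EFin_norm.
  apply: Rintegral_le; first by have := integrableB measurableT ip iu; apply: eq_integrable.
  apply: (@le_trans _ _ (\int[leb2 R]_z (B%:E * `|phi z - u z|%:E))%E).
    apply: ge0_le_integral => //.
    - apply/measurable_EFinP; apply: measurableT_comp => //.
      by apply: measurable_funB; apply: measurable_funM => //; exact: continuous_measurable_plane.
    - by apply: emeasurable_funM => //; exact: measurable_cst.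
    - by move=> z _; rewrite -EFinM lee_fin -mulrBl normrM mulrC ler_wpM2r.
  rewrite ge0_integralZl ?lee_fin// EFinM; apply: lee_wpmul2l => //; by rewrite lee_fin.
have E2 : `|Rintegral (leb2 R) setT (fun z => 'D_(e_ R b) phi z * h z) -
    Rintegral (leb2 R) setT (fun z => grad_component b z * h z)| <= e * H.
  rewrite -RintegralB//.
  have md : measurable_fun [set: mplane R] (fun z => 'D_(e_ R b) phi z - grad_component b z).
    exact: measurable_funB.
  apply: Rintegral_le; first by have := integrableB measurableT iD iG; apply: eq_integrable.
  have := cauchy_schwarz md mh (ltW e_gt0) H0 gb hH; apply: le_trans.
  by rewrite le_eqVlt; apply/orP; left; apply/eqP; apply: eq_integral => z _; rewrite -mulrBl.
have E3 := C1disk_ibp C dh ch ck.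
move: E1 E2; rewrite E3.
set x1 := Rintegral _ _ _; set x2 := Rintegral _ _ _; set x3 := Rintegral _ _ _ => E1 E2.
have -> : x2 + x3 = - (- x1 - x2) - (x1 - x3) by ring.
apply: le_trans (ler_normB _ _) _; rewrite normrN.
apply: le_trans (lerD E1 E2) _.
have -> : B * (e * 2) + e * H = e * (2 * B + H) by ring.
by rewrite /e mulrAC ler_pdivrMr//; nra.
Qed.

End weak.
End integration_by_parts.

(** * The Laplacian of a test function as a functional *)

Section laplacian.
Variable R : realType.
Implicit Types (f g h k phi psi : R * R -> R).

Lemma Rintegral_translate f (w : R * R) : measurable_fun [set: mplane R] f ->
  Rintegral (leb2 R) setT (fun z : mplane R => f (z + w)) = Rintegral (leb2 R) setT f.
Proof.
move=> mf; rewrite /Rintegral; congr fine.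
rewrite integralE [RHS]integralE.
have mfE : measurable_fun [set: mplane R] (EFin \o f) by exact/measurable_EFinP.
have mp := measurable_funepos mfE; have mn := measurable_funeneg mfE.
congr (_ - _)%E.
- have np z : (0 <= (EFin \o f)^\+ z)%E by exact: funepos_ge0.
  by rewrite -(translate_integral_plane w mp np); apply: eq_integral => z _; rewrite !funeposE.
- have nn z : (0 <= (EFin \o f)^\- z)%E by exact: funeneg_ge0.
  by rewrite -(translate_integral_plane w mn nn); apply: eq_integral => z _; rewrite !funenegE.
Qed.

Definition laplacian psi (z : R * R) : R :=
  iter_partial [:: false; false] psi z + iter_partial [:: true; true] psi z.

(** Up to sign, the inner product of the gradients of [f] and of the shifted [psi]. It is written
    without the gradient of [f], which is only known to exist, so that it is defined on functions
    and its linearity is that of the integral. The shift [a] undoes the translation in [gop 1 a]. *)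
Definition lap_functional psi (a : R * R) f : R :=
  Rintegral (leb2 R) setT (fun z => f z * laplacian psi (z + a)).

Section test.
Variables (Omega' : set (R * R)) (psi : R * R -> R) (H : R).
Hypotheses (Od' : Omega' `<=` disk 1) (tpsi : test_function Omega' psi) (H0 : 0 <= H).
Hypothesis psiH : forall b, (\int[leb2 R]_z ('D_(e_ R b) psi z ^+ 2)%:E <= (H ^+ 2)%:E)%E.

Let cD b : continuous ('D_(e_ R b) psi).
Proof. by case: tpsi => sm _ _; case: (sm [:: b]). Qed.

Let cDD b : continuous ('D_(e_ R b) ('D_(e_ R b) psi)).
Proof. by case: tpsi => sm _ _; case: (sm [:: b; b]). Qed.

Let dD b z : derivable ('D_(e_ R b) psi) z (e_ R b).
Proof. by case: tpsi => sm _ _; case: (sm [:: b]) => _; apply. Qed.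

Lemma second_derivative_vanish b z : ~ disk 1 z -> 'D_(e_ R b) ('D_(e_ R b) psi) z = 0.
Proof.
move=> nz; have [_ _ supp] := tpsi; apply: derive_notin_support => zc.
apply: nz; apply: Od'; apply: supp; move: zc.
rewrite [X in _ -> X _](closure_id _).1; last exact: closed_closure.
apply: closure_subset => x /= hx; apply: contrapT => nx; move: hx.
by rewrite derive_notin_support ?eqxx.
Qed.

Lemma second_derivative_bounded b : exists B, forall z, `|'D_(e_ R b) ('D_(e_ R b) psi) z| <= B.
Proof.
by have [B _ hB] := C1disk_bounded (@cDD b) (@second_derivative_vanish b); exists B.
Qed.

Lemma continuous_shift h (a : R * R) : continuous h -> continuous (fun z : R * R => h (z + a)).
Proof.
move=> ch z; apply: (@cvg_comp _ _ _ (fun z => z + a) h _ (nbhs (z + a))); last exact: ch.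
by apply: cvgD; [exact: cvg_id|exact: cvg_cst].
Qed.

Let psiHa b (a : R * R) :
  (\int[leb2 R]_z ('D_(e_ R b) psi (z + a)%R ^+ 2)%:E <= (H ^+ 2)%:E)%E.
Proof.
have m : measurable_fun [set: mplane R] (fun z => ('D_(e_ R b) psi z ^+ 2)%:E).
  by apply: measurable_sqr; exact: continuous_measurable_plane.
have n z : (0 <= ('D_(e_ R b) psi z ^+ 2)%:E)%E by rewrite lee_fin sqr_ge0.
by rewrite (translate_integral_plane a m n).
Qed.

Variable (a : R * R).

Section H01.
Variables (Omega : set (R * R)) (u : R * R -> R) (G : R * R -> R * R) (M : R).
Hypotheses (Od : Omega `<=` disk 1) (uG : H01_grad Omega u G) (M0 : 0 <= M).
Hypotheses (GM1 : (\int[leb2 R]_z ((G z).1 ^+ 2)%:E <= (M ^+ 2)%:E)%E)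
           (GM2 : (\int[leb2 R]_z ((G z).2 ^+ 2)%:E <= (M ^+ 2)%:E)%E).

Let mu : measurable_fun [set: mplane R] u. Proof. by case: uG. Qed.

Let int b : (leb2 R).-integrable setT
  (EFin \o (fun z => u z * 'D_(e_ R b) ('D_(e_ R b) psi) (z + a))).
Proof.
have [B hB] := second_derivative_bounded b.
have c := @continuous_shift _ a (@cDD b).
have hBa z : `|'D_(e_ R b) ('D_(e_ R b) psi) (z + a)| <= B by exact: hB.
exact: (integrable_bounded_mul mu (H01_L1_fin Od uG M0 GM1 GM2) c hBa).
Qed.

Lemma lap_functional_integrable : (leb2 R).-integrable setT
  (EFin \o (fun z => u z * laplacian psi (z + a))).
Proof.
have := integrableD measurableT (int false) (int true); apply: eq_integrable => // z _.
by rewrite /laplacian /= mulrDr EFinD.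
Qed.

Lemma lap_functional_ibp : lap_functional psi a u =
  - (Rintegral (leb2 R) setT (fun z => grad_component G false z * 'D_(e_ R false) psi (z + a)) +
     Rintegral (leb2 R) setT (fun z => grad_component G true z * 'D_(e_ R true) psi (z + a))).
Proof.
have key b : Rintegral (leb2 R) setT (fun z => u z * 'D_(e_ R b) ('D_(e_ R b) psi) (z + a)) =
    - Rintegral (leb2 R) setT (fun z => grad_component G b z * 'D_(e_ R b) psi (z + a)).
  have [B hB] := second_derivative_bounded b.
  have c1 := @continuous_shift _ a (@cD b); have c2 := @continuous_shift _ a (@cDD b).
  have hBa z : `|'D_(e_ R b) ('D_(e_ R b) psi) (z + a)| <= B by exact: hB.
  have sd := slice_derivative_shift a (@dD b).
  exact: (H01_ibp Od uG M0 GM1 GM2 sd c1 c2 hBa H0 (psiHa b a)).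
have E : lap_functional psi a u =
    Rintegral (leb2 R) setT (fun z => u z * 'D_(e_ R false) ('D_(e_ R false) psi) (z + a)) +
    Rintegral (leb2 R) setT (fun z => u z * 'D_(e_ R true) ('D_(e_ R true) psi) (z + a)).
  rewrite -(RintegralD measurableT (int false) (int true)).
  by apply: eq_Rintegral => z _; rewrite /laplacian /= mulrDr.
have fin (l x y x' y' : R) : l = x + y -> x = - x' -> y = - y' -> l = - (x' + y').
  by move=> -> -> ->; rewrite opprD.
exact: (fin _ _ _ _ _ E (key false) (key true)).
Qed.

Lemma grad_component_integral_le b (h : R * R -> R) (N : R) : 0 <= N ->
  measurable_fun [set: mplane R] h ->
  (\int[leb2 R]_z (h z ^+ 2)%:E <= (N ^+ 2)%:E)%E ->
  `|Rintegral (leb2 R) setT (fun z => grad_component G b z * h z)| <= M * N.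
Proof.
move=> N0 mh hN.
have mG : measurable_fun [set: mplane R] (grad_component G b).
  by case: uG => _ m1 m2 _ _; case: b.
have GM : (\int[leb2 R]_z (grad_component G b z ^+ 2)%:E <= (M ^+ 2)%:E)%E by case: b {mG}.
apply: Rintegral_le; first exact: (integrable_mul_L2 mG mh M0 N0).
exact: cauchy_schwarz.
Qed.

Lemma lap_functional_le : `|lap_functional psi a u| <= 2 * H * M.
Proof.
rewrite lap_functional_ibp normrN; apply: le_trans (ler_normD _ _) _.
have -> : 2 * H * M = M * H + M * H by ring.
have m b : measurable_fun [set: mplane R] (fun z => 'D_(e_ R b) psi (z + a)).
  by apply: continuous_measurable_plane; exact: (@continuous_shift _ a (@cD b)).
by apply: lerD; apply: grad_component_integral_le => //; exact: m.
Qed.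

End H01.
End test.
End laplacian.

(** * Boundedness of the gradients *)

Section gliding_hump.
Variable R : realType.

Lemma geometric_tail_le (a : nat -> R) (C : R) : (forall i, `|a i| <= C * 16^-1 ^+ i) ->
  forall n l, `|series a (n + l)%N - series a n| <= C * (16 / 15) * 16^-1 ^+ n.
Proof.
move=> ha n l; have C0 : 0 <= C by have := ha 0%N; rewrite expr0 mulr1; apply: le_trans.
(* The exact geometric sum is what the induction on [l] preserves; [16 / 15] is [1 / (1 - 1/16)]. *)
suff : `|series a (n + l)%N - series a n| <= C * (16 / 15) * (16^-1 ^+ n - 16^-1 ^+ (n + l)).
  move=> /le_trans; apply; rewrite ler_wpM2l ?mulr_ge0//.
  by rewrite gerBl exprn_ge0.
elim: l => [|l IH]; first by rewrite addn0 !subrr normr0 mulr0.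
rewrite addnS seriesSr.
have -> : series a (n + l)%N + a (n + l)%N - series a n = (series a (n + l)%N - series a n) + a (n + l)%N by ring.
apply: le_trans (ler_normD _ _) _; apply: le_trans (lerD IH (ha _)) _.
by rewrite le_eqVlt; apply/orP; left; apply/eqP; rewrite exprS; field.
Qed.

Lemma geometric_series_cvg (a : nat -> R) (C : R) : (forall i, `|a i| <= C * 16^-1 ^+ i) ->
  cvgn (series a) /\ forall n, `|limn (series a) - series a n| <= C * (16 / 15) * 16^-1 ^+ n.
Proof.
move=> ha.
have ca : cvgn (series a).
  apply: normed_cvg; apply: (@series_le_cvg _ _ (fun i => C * 16^-1 ^+ i)) => //.
  - by move=> n; apply: normr_ge0.
  - by move=> n; apply: le_trans (ha n).
  - apply: (@is_cvg_geometric_series _ C 16^-1).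
    by rewrite ger0_norm// invf_lt1// ltr1n.
split=> // n.
have cn : (fun m => `|series a m - series a n|) @ \oo --> `|limn (series a) - series a n|.
  by apply: cvg_norm; apply: cvgB; [exact: ca|exact: cvg_cst].
rewrite -(cvg_lim _ cn)//; apply: limr_le; first by apply/cvg_ex; eexists; exact: cn.
near=> m; have nm : (n <= m)%N by near: m; exact: nbhs_infty_ge.
by rewrite -(subnKC nm); exact: geometric_tail_le.
Unshelve. all: end_near.
Qed.

(** [e i k] is the value of the [i]-th functional, of norm at most 1, on the [k]-th vector, of norm
    [M k]. If [M] were unbounded, a series of functionals with coefficients of size [16^-i], taken
    at indices where [M] exceeds [256^i], would be unbounded on the sequence. *)
Lemma gliding_hump (e : nat -> nat -> R) (M : nat -> R) :
  (forall i k, `|e i k| <= M k) -> (forall k, M k <= 6 * `|e k k|) ->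
  (forall (c : nat -> R) (s : nat -> nat), (forall i, `|c i| = 16^-1 ^+ i) ->
     exists B, forall k, `|limn (series (fun i => c i * e (s i) k))| <= B) ->
  exists B, forall k, M k <= B.
Proof.
move=> eM Me bnd; apply: contrapT => unb.
have big i : exists k, 256 ^+ i <= M k.
  apply: contrapT => h; apply: unb; exists (256 ^+ i) => k.
  by rewrite leNgt; apply/negP => /ltW hk; apply: h; exists k.
pose s i := projT1 (cid (big i)).
have sM i : 256 ^+ i <= M (s i) by rewrite /s; case: cid.
(* The sign is chosen so that the new term does not cancel the earlier ones at [s i]. One of the two
   signs works, since the two possible sums differ by twice the term. *)
pose sg (i : nat) (S : nat -> R) : R :=
  if 16^-1 ^+ i * `|e (s i) (s i)| <= `|S (s i) + 16^-1 ^+ i * e (s i) (s i)|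
  then 16^-1 ^+ i else - 16^-1 ^+ i.
pose S := fix S (i : nat) : nat -> R :=
  if i is i'.+1 then fun k => S i' k + sg i' (S i') * e (s i') k else fun=> 0.
pose c i := sg i (S i).
have pow0 i : 0 <= (16^-1 : R) ^+ i by rewrite exprn_ge0.
have cE i : `|c i| = 16^-1 ^+ i.
  by rewrite /c /sg; case: ifP => _; rewrite ?normrN ger0_norm.
have SE n k : series (fun i => c i * e (s i) k) n = S n k.
  by elim: n => [|n IH]; [rewrite /series/= big_geq|rewrite seriesSr IH].
have [B hB] := bnd c s cE.
have grow i : 16^-1 ^+ i * `|e (s i) (s i)| <= `|S i.+1 (s i)|.
  rewrite /= /sg; case: ifPn => //; rewrite -ltNge => h.
  have h2 := ler_normB (S i (s i) + 16^-1 ^+ i * e (s i) (s i)) (S i (s i) - 16^-1 ^+ i * e (s i) (s i)).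
  have E : S i (s i) + 16^-1 ^+ i * e (s i) (s i) - (S i (s i) - 16^-1 ^+ i * e (s i) (s i)) =
    2 * (16^-1 ^+ i * e (s i) (s i)) by ring.
  move: h2; rewrite E normrM normrM (ger0_norm (pow0 i)) (ger0_norm (x := 2))// mulNr.
  move: (`|e _ _|) h => x h; lra.
(* At [k = s i] the partial sum is at least [M k / 6] times [16^-i] and the tail at most [M k / 15]
   times [16^-i]. The difference [1/6 - 1/15] is [1/10], and [M k >= 256^i]. *)
have lower i : 16 ^+ i / 10 <= B.
  have k0 := sM i; set k := s i in k0 *.
  have hk j : `|c j * e (s j) k| <= M k * 16^-1 ^+ j.
    by rewrite normrM cE mulrC ler_wpM2r.
  have [_ tail] := geometric_series_cvg hk; have {tail}:= tail i.+1.
  have := grow i; have := Me k; have := hB k.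
  rewrite SE -/k; set L := limn _; set x := `|e k k|; set y := S i.+1 k => LB Mx xy yL.
  have yB : `|y| <= B + M k * (16 / 15) * 16^-1 ^+ i.+1.
    have -> : y = L - (L - y) by ring.
    by apply: le_trans (ler_normB _ _) _; exact: lerD.
  have p1 : 256 ^+ i * 16^-1 ^+ i = 16 ^+ i :> R by rewrite -exprMn; congr (_ ^+ _); field.
  have h1 : 16 ^+ i <= M k * 16^-1 ^+ i by rewrite -p1 ler_wpM2r.
  have h2 : M k * 16^-1 ^+ i <= 6 * x * 16^-1 ^+ i by rewrite ler_wpM2r.
  move: yB; rewrite exprS; move: (16^-1 ^+ i) xy h1 h2 => p xy h1 h2 yB.
  lra.
pose i := (Num.truncn (10 * B)).+1.
have := lower i; apply/negP; rewrite -ltNge ltr_pdivlMr// mulrC.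
apply: (@lt_trans _ _ i%:R); first exact: truncnS_gt.
by rewrite -natrX ltr_nat ltn_expl.
Qed.

End gliding_hump.

(** * Norming functionals on translates *)

Section uniform_bound.
Variable R : realType.
Implicit Types (f g h k phi psi : R * R -> R).

Lemma sqr_integral_fin (f : R * R -> R) (M : R) : measurable_fun [set: mplane R] f ->
  (\int[leb2 R]_z (f z ^+ 2)%:E <= (M ^+ 2)%:E)%E ->
  (leb2 R).-integrable setT (EFin \o (fun z => f z ^+ 2)).
Proof.
move=> mf fM; apply: integrable_plane; first exact: measurable_funX.
under eq_integral do rewrite ger0_norm ?sqr_ge0//.
by apply: le_lt_trans fM _; rewrite ltry.
Qed.

Lemma norm_near_sqr (M l x1 x2 y1 y2 : R) : l = - (x1 + x2) -> `|x1 - y1| <= M * (M / 8) ->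
  `|x2 - y2| <= M * (M / 8) -> y1 + y2 = M ^+ 2 -> 3 / 4 * M ^+ 2 <= `|l|.
Proof.
move=> -> h1 h2 h3; rewrite normrN; apply: le_trans (ler_norm _).
by move: h1 h2; rewrite !ler_norml => /andP[h1 _] /andP[h2 _]; rewrite expr2 in h3 *; lra.
Qed.

(** The gradient of [u] itself would pair with [u] to [M^2]. A test function whose gradient is
    within [M / 8] in each component loses at most [M^2 / 8] twice, leaving [3/4 M^2]. *)
Lemma norming_test_function (Omega : set (R * R)) u G (M : R) : Omega `<=` disk 1 ->
  H01_grad Omega u G -> 0 < M ->
  (\int[leb2 R]_z ((G z).1 ^+ 2)%:E + \int[leb2 R]_z ((G z).2 ^+ 2)%:E = (M ^+ 2)%:E)%E ->
  (\int[leb2 R]_z ((G z).1 ^+ 2)%:E <= (M ^+ 2)%:E)%E ->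
  (\int[leb2 R]_z ((G z).2 ^+ 2)%:E <= (M ^+ 2)%:E)%E ->
  exists psi, [/\ test_function Omega psi,
    (forall b, (\int[leb2 R]_z ('D_(e_ R b) psi z ^+ 2)%:E <= ((2 * M) ^+ 2)%:E)%E) &
    3 / 4 * M ^+ 2 <= `|lap_functional psi 0 u|].
Proof.
move=> Od uG M0 GM GM1 GM2; have [mu m1 m2 _ _] := uG.
have e0 : 0 < M / 8 by rewrite divr_gt0.
have [psi [tf _ g1 g2]] := H01_approx Od uG e0.
have C := test_function_C1disk Od tf; have [_ c1 c2 _ _] := C.
pose g b := grad_component G b.
have mg b : measurable_fun [set: mplane R] (g b) by case: b.
have gM b : (\int[leb2 R]_z (g b z ^+ 2)%:E <= (M ^+ 2)%:E)%E by case: b.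
have gd b : (\int[leb2 R]_z (('D_(e_ R b) psi z - g b z) ^+ 2)%:E <= ((M / 8) ^+ 2)%:E)%E by case: b.
have mD b : measurable_fun [set: mplane R] ('D_(e_ R b) psi).
  by case: b; [exact: continuous_measurable_plane c2|exact: continuous_measurable_plane c1].
have psiH b : (\int[leb2 R]_z ('D_(e_ R b) psi z ^+ 2)%:E <= ((2 * M) ^+ 2)%:E)%E.
  apply: le_trans (sqr_integral_triangle (mg b) (mD b)) _.
  apply: (@le_trans _ _ (2%:E * (M ^+ 2)%:E + 2%:E * ((M / 8) ^+ 2)%:E)%E); last first.
    by rewrite -!EFinM -EFinD lee_fin; nra.
  apply: leeD; apply: lee_wpmul2l => //; last first.
    apply: le_trans (gd b); rewrite le_eqVlt; apply/orP; left; apply/eqP.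
    by apply: eq_integral => z _; rewrite -sqrrN opprB.
exists psi; split => //.
have M0' := ltW M0; have H0 : 0 <= 2 * M by lra.
have ibp := lap_functional_ibp Od tf H0 psiH 0 Od uG M0' GM1 GM2.
have near b : `|Rintegral (leb2 R) setT (fun z => g b z * 'D_(e_ R b) psi (z + 0)) -
    Rintegral (leb2 R) setT (fun z => g b z ^+ 2)| <= M * (M / 8).
  have i1 : (leb2 R).-integrable setT (EFin \o (fun z => g b z * 'D_(e_ R b) psi (z + 0))).
    have := integrable_mul_L2 (mg b) (mD b) M0' H0 (gM b) (psiH b).
    by apply: eq_integrable => // z _; rewrite /= addr0.
  have i2 := sqr_integral_fin (mg b) (gM b).
  rewrite -(RintegralB measurableT i1 i2).
  have mdf : measurable_fun [set: mplane R] (fun z => 'D_(e_ R b) psi z - g b z) by exact: measurable_funB.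
  apply: Rintegral_le; first by have := integrableB measurableT i1 i2; apply: eq_integrable.
  have := cauchy_schwarz (mg b) mdf M0' (ltW e0) (gM b) (gd b); apply: le_trans.
  rewrite le_eqVlt; apply/orP; left; apply/eqP; apply: eq_integral => z _.
  by rewrite addr0 mulrBr expr2.
have sum : Rintegral (leb2 R) setT (fun z => g false z ^+ 2) +
    Rintegral (leb2 R) setT (fun z => g true z ^+ 2) = M ^+ 2.
  have fin b : ((\int[leb2 R]_z (g b z ^+ 2)%:E) \is a fin_num)%E.
    rewrite ge0_fin_numE; first by apply: le_lt_trans (gM b) _; rewrite ltry.
    by apply: integral_ge0 => z _; rewrite lee_fin sqr_ge0.
  apply: EFin_inj; rewrite EFinD /Rintegral !fineK; [exact: GM|exact: (fin true)|exact: (fin false)].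
exact: (norm_near_sqr ibp (near false) (near true) sum).
Qed.

(** The radius 1/2 enters here: for [|zeta| < 1/2], a point outside the unit disk is moved outside
    the disk of radius 1/2, so the truncation in [gop] removes nothing. *)
Lemma gop1E (Omega : set (R * R)) u (zeta : R * R) : Omega `<=` disk 2^-1 ->
  disk 2^-1 zeta -> (forall z, ~ Omega z -> u z = 0) ->
  gop 1 zeta u = (fun z => u (zeta + z)).
Proof.
move=> Od dz u0; apply/funext => z; rewrite /gop /patch.
have -> : cpow z 1 = z by case: z => x y; rewrite /cpow expr1.
rewrite powR1 mul1r; case: ifPn => // /negP nz; rewrite u0// => /Od.
have small (w : R * R) : disk 2^-1 w -> w.1 ^+ 2 + w.2 ^+ 2 < 4^-1.
  rewrite /disk/= /euclid => h.
  have : Num.sqrt (w.1 ^+ 2 + w.2 ^+ 2) ^+ 2 < 2^-1 ^+ 2 by rewrite ltr_pXn2r ?nnegrE ?sqrtr_ge0//; lra.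
  by rewrite sqr_sqrtr ?addr_ge0 ?sqr_ge0//; lra.
move=> /small/= h1; have h2 := small _ dz; apply: nz; apply/mem_set.
rewrite /disk/= /euclid -(ltr_pXn2r (n := 2))// ?nnegrE// expr1n sqr_sqrtr ?addr_ge0 ?sqr_ge0//.
(* Parallelogram form of the triangle inequality: [2 |zeta + z|^2 + 2 |zeta|^2 - |z|^2 = |2 zeta +
   z|^2]. *)
have := sqr_ge0 (2 * zeta.1 + z.1); have := sqr_ge0 (2 * zeta.2 + z.2); nra.
Qed.

Lemma lap_functional_gop (Omega Omega' : set (R * R)) (u psi : R * R -> R) (zeta : R * R) : Omega `<=` disk 2^-1 ->
  disk 2^-1 zeta -> (forall z, ~ Omega z -> u z = 0) -> measurable_fun [set: mplane R] u ->
  test_function Omega' psi ->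
  lap_functional psi zeta (gop 1 zeta u) = lap_functional psi 0 u.
Proof.
move=> Od dz u0 mu [sm _ _]; rewrite (gop1E Od dz u0).
have ml : measurable_fun [set: mplane R] (laplacian psi).
  apply: measurable_funD; apply: continuous_measurable_plane;
    [by case: (sm [:: false; false])|by case: (sm [:: true; true])].
have mf : measurable_fun [set: mplane R] (fun z => u z * laplacian psi z) by exact: measurable_funM.
transitivity (Rintegral (leb2 R) setT (fun z => u z * laplacian psi z)).
  rewrite -(Rintegral_translate zeta mf); apply: eq_Rintegral => z _.
  by rewrite (addrC zeta).
by apply: eq_Rintegral => z _; rewrite addr0.
Qed.

Lemma norming_ratio (M x : R) : 0 < M -> 3 / 4 * M ^+ 2 <= `|x| ->
  M <= 6 * `|(4 * M)^-1 * x|.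
Proof.
move=> M0 Mx; have M4 : 0 < 4 * M by lra.
rewrite normrM gtr0_norm ?invr_gt0// mulrCA ler_pdivlMl//; nra.
Qed.

(** Division by [4 M] normalises [lap_functional], as the test function has gradient components of
    norm at most [2 M]. The third clause bounds [e] on translates through the gradient before
    translation, which spares the construction of a weak gradient for the translate. When [M = 0]
    the zero functional does. *)
Lemma norming_functional (Omega : set (R * R)) u G (M : R) (zeta : R * R) :
  Omega `<=` disk 2^-1 -> disk 2^-1 zeta -> H01_grad Omega u G -> 0 <= M ->
  (\int[leb2 R]_z ((G z).1 ^+ 2)%:E + \int[leb2 R]_z ((G z).2 ^+ 2)%:E = (M ^+ 2)%:E)%E ->
  (\int[leb2 R]_z ((G z).1 ^+ 2)%:E <= (M ^+ 2)%:E)%E ->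
  (\int[leb2 R]_z ((G z).2 ^+ 2)%:E <= (M ^+ 2)%:E)%E ->
  exists e : (R * R -> R) -> R,
  [/\ (forall (c : R) f g, H01 (disk 1) f -> H01 (disk 1) g ->
         e (fun z => c * f z + g z) = c * e f + e g),
      (forall f F (N : R), H01_grad (disk 1) f F -> 0 <= N ->
         (\int[leb2 R]_z ((F z).1 ^+ 2)%:E <= (N ^+ 2)%:E)%E ->
         (\int[leb2 R]_z ((F z).2 ^+ 2)%:E <= (N ^+ 2)%:E)%E -> `|e f| <= N),
      (forall v V (N : R), H01_grad Omega v V -> 0 <= N ->
         (\int[leb2 R]_z ((V z).1 ^+ 2)%:E <= (N ^+ 2)%:E)%E ->
         (\int[leb2 R]_z ((V z).2 ^+ 2)%:E <= (N ^+ 2)%:E)%E -> `|e (gop 1 zeta v)| <= N) &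
      M <= 6 * `|e (gop 1 zeta u)|].
Proof.
move=> Oh dz uG M0 GM GM1 GM2.
have Od : Omega `<=` disk 1 by move=> z /Oh; rewrite /disk/= => /lt_trans; apply; lra.
have [M00|Mn0] := eqVneq M 0.
  exists (fun=> 0); split => //.
  - by move=> c f g _ _; rewrite mulr0 addr0.
  - by move=> f F N _ N0 _ _; rewrite normr0.
  - by move=> f F N _ N0 _ _; rewrite normr0.
  - by rewrite M00 normr0 mulr0.
have M_gt0 : 0 < M by rewrite lt_def Mn0.
have [psi [tf psiH low]] := norming_test_function Od uG M_gt0 GM GM1 GM2.
have H0 : 0 <= 2 * M by lra.
have M4 : 0 < (4 * M)^-1 by rewrite invr_gt0; lra.
exists (fun f => (4 * M)^-1 * lap_functional psi zeta f); split.
- move=> c f g [F fF] [K gK].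
  have [N1 N10 [_ _ _ a1 a2]] := H01_L2 (@subset_refl _ _) fF.
  have [N2 N20 [_ _ _ b1 b2]] := H01_L2 (@subset_refl _ _) gK.
  have i1 := lap_functional_integrable Od tf zeta (@subset_refl _ _) fF N10 a1 a2.
  have i2 := lap_functional_integrable Od tf zeta (@subset_refl _ _) gK N20 b1 b2.
  rewrite mulrCA -mulrDr; congr (_ * _).
  rewrite /lap_functional -(RintegralZl _ measurableT i1).
  have i3 : (leb2 R).-integrable setT (EFin \o (fun z => c * (f z * laplacian psi (z + zeta)))).
    by have := integrableZl measurableT c i1; apply: eq_integrable.
  rewrite -(RintegralD measurableT i3 i2); apply: eq_Rintegral => z _.
  by rewrite mulrDl mulrA.
- move=> f F N fF N0 a1 a2; rewrite normrM gtr0_norm// ler_pdivrMl; last by lra.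
  have -> : 4 * M * N = 2 * (2 * M) * N by ring.
  exact: (lap_functional_le Od tf H0 psiH zeta (@subset_refl _ _) fF N0 a1 a2).
- move=> v V N vV N0 a1 a2; rewrite normrM gtr0_norm// ler_pdivrMl; last by lra.
  have [mv _ _ v0 _] := vV.
  rewrite (lap_functional_gop Oh dz v0 mv tf).
  have -> : 4 * M * N = 2 * (2 * M) * N by ring.
  exact: (lap_functional_le Od tf H0 psiH 0 Od vV N0 a1 a2).
- have [mv _ _ v0 _] := uG; rewrite (lap_functional_gop Oh dz v0 mv tf).
  exact: norming_ratio.
Qed.

End uniform_bound.

Section boundedness.
Variable R : realType.

Lemma cvg0_bounded (x : nat -> R) : x k @[k --> \oo] --> (0 : R) -> exists B, forall k, `|x k| <= B.
Proof.
move=> x0; have [B [_ hB]] := cvg_seq_bounded (cvgP _ x0).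
exists (B + 1) => k; apply: (hB (B + 1)); last by []; by rewrite ltrDl.
Qed.

Variables (Omega : set (R * R)) (zeta : R * R) (u : nat -> R * R -> R)
  (G : nat -> R * R -> R * R) (M : nat -> R).
Hypotheses (Oh : Omega `<=` disk 2^-1) (Oz : Omega zeta).
Hypothesis uG : forall k, H01_grad Omega (u k) (G k).
Hypothesis M0 : forall k, 0 <= M k.
Hypothesis GM : forall k, (\int[leb2 R]_z ((G k z).1 ^+ 2)%:E +
  \int[leb2 R]_z ((G k z).2 ^+ 2)%:E = (M k ^+ 2)%:E)%E.
Hypothesis GM1 : forall k, (\int[leb2 R]_z ((G k z).1 ^+ 2)%:E <= (M k ^+ 2)%:E)%E.
Hypothesis GM2 : forall k, (\int[leb2 R]_z ((G k z).2 ^+ 2)%:E <= (M k ^+ 2)%:E)%E.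
Hypothesis u_Dweak : D_weakly_cvg0 Omega u.

(** A single operator [gop 1 zeta] suffices: by the hypothesis, every bounded functional stays
    bounded on the translated sequence. This applies to each series of norming functionals, which is
    a bounded functional with constant [16 / 15]. *)
Lemma gradient_norm_bounded : exists B, forall k, M k <= B.
Proof.
pose ek k := cid (norming_functional Oh (Oh Oz) (uG k) (M0 k) (GM k) (GM1 k) (GM2 k)).
pose e k := projT1 (ek k).
have e_lin k (c : R) f g : H01 (disk 1) f -> H01 (disk 1) g ->
    e k (fun z => c * f z + g z) = c * e k f + e k g.
  by rewrite /e; case: (ek k) => /= x [h _ _ _]; exact: h.
have e_le k f F (N : R) : H01_grad (disk 1) f F -> 0 <= N ->
     (\int[leb2 R]_z ((F z).1 ^+ 2)%:E <= (N ^+ 2)%:E)%E ->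
     (\int[leb2 R]_z ((F z).2 ^+ 2)%:E <= (N ^+ 2)%:E)%E -> `|e k f| <= N.
  by rewrite /e; case: (ek k) => /= x [_ h _ _]; exact: h.
have e_u i k : `|e i (gop 1 zeta (u k))| <= M k.
  by rewrite /e; case: (ek i) => /= x [_ _ h _]; exact: (h _ _ _ (uG k) (M0 k) (GM1 k) (GM2 k)).
have e_norm k : M k <= 6 * `|e k (gop 1 zeta (u k))|.
  by rewrite /e; case: (ek k) => /= x [_ _ _ h].
apply: (gliding_hump (e := fun i k => e i (gop 1 zeta (u k)))) => // c s cE.
pose ell f := limn (series (fun i => c i * e (s i) f)).
have small f F (N : R) : H01_grad (disk 1) f F -> 0 <= N ->
     (\int[leb2 R]_z ((F z).1 ^+ 2)%:E <= (N ^+ 2)%:E)%E ->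
     (\int[leb2 R]_z ((F z).2 ^+ 2)%:E <= (N ^+ 2)%:E)%E ->
     forall i, `|c i * e (s i) f| <= N * 16^-1 ^+ i.
  move=> fF N0 a1 a2 i; rewrite normrM cE mulrC ler_wpM2r ?exprn_ge0 ?invr_ge0//.
  exact: (e_le _ _ _ _ fF N0 a1 a2).
have scvg f : H01 (disk 1) f -> cvgn (series (fun i => c i * e (s i) f)).
  move=> [F fF]; have [N N0 [_ _ _ a1 a2]] := H01_L2 (@subset_refl _ _) fF.
  by have [] := geometric_series_cvg (small _ _ _ fF N0 a1 a2).
have bell : bounded_functional (disk 1) ell.
  split.
    move=> a f g Hf Hg; rewrite /ell.
    have -> : series (fun i => c i * e (s i) (fun z => a * f z + g z)) =
        (fun n => a * series (fun i => c i * e (s i) f) n + series (fun i => c i * e (s i) g) n).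
      apply/funext; elim=> [|n IH]; first by rewrite /series/= !big_geq// mulr0 addr0.
      by rewrite !seriesSr IH e_lin//; ring.
    apply: cvg_lim => //; apply: cvgD; last exact: scvg.
    by apply: cvgMr; exact: scvg.
  exists (16 / 15) => f F fF.
  have [N N0 [_ EN _ a1 a2]] := H01_L2 (@subset_refl _ _) fF.
  have [_ tail] := geometric_series_cvg (small _ _ _ fF N0 a1 a2).
  have {tail} := tail 0%N.
  rewrite [X in _ - X](_ : _ = 0); last by rewrite /series/= big_geq.
  by rewrite subr0 expr0 mulr1 EN -EFinM lee_fin mulrC.
have gset (k : nat) : opset Omega (gop 1 zeta).
  by exists 1%N, zeta; split => //; exact: subset_closure.
exact: cvg0_bounded (@u_Dweak (fun=> gop 1 zeta) gset ell bell).
Qed.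

End boundedness.

(** * Uniformity over the operators *)

Section selection.
Variable R : realType.
Variables (Omega : set (R * R)) (u : nat -> R * R -> R).
Hypotheses (Onz : Omega !=set0) (u_Dweak : D_weakly_cvg0 Omega u).

(** The operators in the definition of D-weak convergence may vary freely with [k]. Taking a
    violating operator at every [k] that has one turns convergence along sequences into uniformity
    over the whole operator set. *)
Lemma D_weak_uniform ell (eps : R) : bounded_functional (disk 1) ell -> 0 < eps ->
  exists k0, forall k, (k0 <= k)%N -> forall g, opset Omega g -> `|ell (g (u k))| < eps.
Proof.
move=> bell eps0; have [z0 Oz0] := Onz.
have gz0 : opset Omega (gop 1 z0) by exists 1%N, z0; split => //; exact: subset_closure.
pose P k g := opset Omega g /\ eps <= `|ell (g (u k))|.
(* The operator [gop 1 z0] is a mere filler for the [k] without a violation. *)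
pose g k := if pselect (exists g, P k g) is left ex then projT1 (cid ex) else gop 1 z0.
have gO k : opset Omega (g k).
  by rewrite /g; case: pselect => // ex; case: (cid ex) => /= h [].
have /cvgrPdist_lt/(_ _ eps0) [k0 _ hk] := u_Dweak gO bell.
exists k0 => k k0k h hO; rewrite ltNge; apply/negP => hle.
have := hk k k0k; rewrite /= sub0r normrN; apply/negP; rewrite -leNgt.
rewrite /g; case: pselect => [ex|nex]; first by case: (cid ex) => /= h' [].
by exfalso; apply: nex; exists h.
Qed.

(** The constant 4 is that of the embedding of H_0^1 of the disk in L^1. *)
Lemma Rintegral_bounded_functional (S : set (mplane R)) : measurable S ->
  bounded_functional (disk 1) (fun f => Rintegral (leb2 R) S f).
Proof.
move=> mS.
have int f : H01 (disk 1) f -> (leb2 R).-integrable S (EFin \o f).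
  move=> [F fF]; have [N N0 [_ _ _ a1 a2]] := H01_L2 (@subset_refl _ _) fF.
  have [mf _ _ _ _] := fF.
  exact: (integrable_subset mf (H01_L1_fin (@subset_refl _ _) fF N0 a1 a2) mS).
split.
  move=> a f g Hf Hg; have i1 := int _ Hf; have i2 := int _ Hg.
  have i3 : (leb2 R).-integrable S (EFin \o (fun z => a * f z)).
    by have := integrableZl mS a i1; apply: eq_integrable.
  by rewrite (RintegralD mS i3 i2) (RintegralZl _ mS i1).
exists 4 => f F fF.
have [N N0 [_ EN _ a1 a2]] := H01_L2 (@subset_refl _ _) fF.
have [mf _ _ _ _] := fF.
rewrite EN -EFinM.
have i1 := int _ (ex_intro _ F fF).
rewrite EFin_normr_Rintegral//.
apply: le_trans (le_abse_integral _ mS _) _; first by case/integrableP: i1.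
apply: le_trans (H01_L1_le (@subset_refl _ _) fF N0 a1 a2).
apply: ge0_subset_integral => //.
exact: measurable_EFin_norm.
Qed.

End selection.

(** * Conclusion *)

Section single_function.
Variable R : realType.

Lemma half_pow_small (c e : R) : 0 <= c -> 0 < e ->
  exists N, forall n, (N <= n)%N -> c * 2^-1 ^+ n <= e.
Proof.
move=> c0 e0; exists (Num.truncn (c / e)).+1 => n Nn.
have h : c / e < 2 ^+ n.
  apply: lt_trans (truncnS_gt _) _; apply: (@le_lt_trans _ _ n%:R); first by rewrite ler_nat.
  by rewrite -natrX ltr_nat ltn_expl.
rewrite exprVn ler_pdivrMr ?exprn_gt0// mulrC -ler_pdivrMr//; exact: ltW.
Qed.

Lemma cvg0_ereal (a : nat -> \bar R) : (forall k, (0 <= a k)%E) ->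
  (forall e : R, 0 < e -> exists k0, forall k, (k0 <= k)%N -> (a k <= e%:E)%E) ->
  a k @[k --> \oo] --> 0%E.
Proof.
move=> a0 small; apply/fine_cvgP; split.
  have [k0 h] := small 1 ltr01; exists k0 => // k /h ak.
  by rewrite ge0_fin_numE//; apply: le_lt_trans ak _; rewrite ltry.
apply/cvgrPdist_le => e e0; have [k0 h] := small e e0; exists k0 => // k /h ak.
rewrite /= sub0r normrN ger0_norm ?fine_ge0// -lee_fin fineK// ge0_fin_numE//.
by apply: le_lt_trans ak _; rewrite ltry.
Qed.

Lemma expL2_norm_ge0 (Omega : set (R * R)) (u : R * R -> R) : (0 <= expL2_norm Omega u)%E.
Proof. by apply: le_ereal_inf_tmp => _ [s [s0 _] <-]; rewrite lee_fin ltW. Qed.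

Lemma expL2_norm_le (Omega : set (R * R)) (u : R * R -> R) (s : R) : 0 < s ->
  (\int[leb2 R]_(z in Omega) (expR ((u z / s) ^+ 2) - 1)%:E <= 1)%E ->
  (expL2_norm Omega u <= s%:E)%E.
Proof. by move=> s0 h; apply: ereal_inf_lbound; exists s. Qed.

(** For [lambda = s^-2] the integral is eventually below 1, which says that the Luxemburg norm is at
    most [s]. Finiteness for every [k], including the first ones, has to be supplied separately. *)
Lemma expL2_cvg0_of_integral (Omega : set (R * R)) (u : nat -> R * R -> R) :
  (forall k, exists s : R, 0 < s /\
     (\int[leb2 R]_(z in Omega) (expR ((u k z / s) ^+ 2) - 1)%:E <= 1)%E) ->
  (forall lambda : R, 0 < lambda ->
     (\int[leb2 R]_(z in Omega) (expR (lambda * u k z ^+ 2) - 1)%:E)%E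
       @[k --> \oo] --> 0%E) ->
  expL2_cvg0 Omega u.
Proof.
move=> fin cvg; split=> [k|].
  have [s [s0 h]] := fin k; apply: le_lt_trans (expL2_norm_le s0 h) _; exact: ltry.
apply: cvg0_ereal => [k|s s0]; first exact: expL2_norm_ge0.
have l0 : 0 < s ^- 2 by rewrite invr_gt0 exprn_gt0.
have := cvg _ l0; move=> /(_ [set x | (x < 1)%E]) [].
  by apply: open_nbhs_nbhs; split; [exact: open_ereal_lt_ereal|rewrite /= lte_fin].
move=> k0 _ h; exists k0 => k k0k; apply: expL2_norm_le => //; apply/ltW.
have E : (\int[leb2 R]_(z in Omega) (expR ((u k z / s) ^+ 2) - 1)%:E =
    \int[leb2 R]_(z in Omega) (expR (s ^- 2 * u k z ^+ 2) - 1)%:E)%E.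
  by apply: eq_integral => z _; rewrite expr_div_n mulrC.
by rewrite E; exact: h.
Qed.

Variables (Omega : set (R * R)) (u : R * R -> R) (G : R * R -> R * R) (M : R).
Hypotheses (Oh : Omega `<=` disk 2^-1) (mO : measurable (Omega : set (mplane R))).
Hypotheses (uG : H01_grad Omega u G) (M0 : 0 <= M).
Hypotheses (GM1 : (\int[leb2 R]_z ((G z).1 ^+ 2)%:E <= (M ^+ 2)%:E)%E)
           (GM2 : (\int[leb2 R]_z ((G z).2 ^+ 2)%:E <= (M ^+ 2)%:E)%E).

Lemma half_disk : Omega `<=` disk 1.
Proof. by move=> z /Oh; rewrite /disk/= => /lt_trans; apply; lra. Qed.

Let Od := half_disk.
Let mu : measurable_fun [set: mplane R] u. Proof. by case: uG. Qed.
Let mG1 : measurable_fun [set: mplane R] (fun z => (G z).1). Proof. by case: uG. Qed.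
Let mG2 : measurable_fun [set: mplane R] (fun z => (G z).2). Proof. by case: uG. Qed.
Let iu := H01_L1_fin Od uG M0 GM1 GM2.

(** The function [g] of the sections on averages, with [Gam = 2 * M]; the l^1 length of the gradient
    is what walking along the two axes produces. *)
Definition grad_l1 (z : R * R) : R := `|(G z).1| + `|(G z).2|.

Lemma grad_l1_ge0 z : 0 <= grad_l1 z.
Proof. by rewrite addr_ge0. Qed.

Lemma measurable_grad_l1 : measurable_fun [set: mplane R] grad_l1.
Proof. by apply: measurable_funD; exact: measurableT_comp. Qed.

Lemma grad_l1_L2 : (\int[leb2 R]_z (grad_l1 z ^+ 2)%:E <= ((2 * M) ^+ 2)%:E)%E.
Proof.
have mf b : measurable_fun [set: mplane R] (fun z => (2 * grad_component G b z ^+ 2)%:E).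
  apply/measurable_EFinP; apply: measurable_funM; first exact: measurable_cst.
  by apply: measurable_funX; case: b.
have f0 b (z : mplane R) : (0 <= (2 * grad_component G b z ^+ 2)%:E)%E by rewrite lee_fin mulr_ge0// sqr_ge0.
apply: (@le_trans _ _ (\int[leb2 R]_z ((2 * grad_component G false z ^+ 2)%R%:E + (2 * grad_component G true z ^+ 2)%R%:E))%E).
  apply: ge0_le_integral => //.
  - by move=> z _; rewrite lee_fin sqr_ge0.
  - by apply/measurable_EFinP; apply: measurable_funX; exact: measurable_grad_l1.
  - exact: (emeasurable_funD (mf false) (mf true)).
  - move=> z _; rewrite -EFinD lee_fin /grad_l1 /=.
    rewrite -[X in 2 * X + _]real_normK ?num_real// -[X in _ + 2 * X]real_normK ?num_real//.
    by have := sqr_ge0 (`|(G z).1| - `|(G z).2|); nra.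
rewrite (plane_integralD measurableT (mf false) (mf true) (f0 false) (f0 true)).
have e b : (\int[leb2 R]_z (2 * grad_component G b z ^+ 2)%R%:E <= (2 * M ^+ 2)%:E)%E.
  under eq_integral do rewrite EFinM.
  rewrite ge0_integralZl//; last 2 first.
  - by apply: measurable_sqr; case: (b).
  - by move=> z _; rewrite lee_fin sqr_ge0.
  by rewrite EFinM; apply: lee_wpmul2l => //; case: (b).
apply: le_trans (leeD (e false) (e true)) _.
by rewrite -EFinD lee_fin; lra.
Qed.

Let Gam0 : 0 <= 2 * M. Proof. by rewrite mulr_ge0. Qed.
Let poincare a b h (h0 : 0 <= h) := H01_L1_poincare Od uG a b h0.
Let translate_le w := H01_translate_le Od uG w M0 GM1 GM2.

Lemma H01_davg_sector_le (zeta : R * R) q l : (0 < q)%N -> (0 < l)%N ->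
  `|davg u zeta (q * l)| <= Num.sqrt (q * l)%:R *
     (32 * q%:R / 3 * `|sector_mean q (gop (q * l) zeta u)| + 4608 * (2 * M) / Num.sqrt q%:R).
Proof. exact: (davg_sector_le mu measurable_grad_l1 iu grad_l1_ge0 Gam0 grad_l1_L2 poincare). Qed.

Lemma H01_L1_le_davg (eta : R) n : 0 <= eta -> (forall z, Omega z -> `|davg u z n| <= eta) ->
  (\int[leb2 R]_(z in Omega) `|u z|%:E <= (dside R n * (2 * M) + 4 * eta)%:E)%E.
Proof.
move=> eta0; apply: (L1_le_davg mu iu Gam0 translate_le mO eta0).
by move=> z /Od; exact: disk_unit_square.
Qed.

Lemma H01_moser_le (lam s : R) (m q i0 : nat) :
  0 <= lam -> 4 * lam <= m%:R -> 0 < s -> (0 < q)%N -> (0 < i0)%N ->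
  (q <= (2 * m).+1 * i0 ^ 2)%N ->
  (forall z l, Omega z -> (0 < l)%N ->
     `|davg u z (q * l)| <= s / (2 * Num.sqrt (2 * (2 * m).+1%:R)) * Num.sqrt (q * l)%:R) ->
  (\int[leb2 R]_(z in Omega) (expR (lam * (u z / s) ^+ 2) - 1)%:E <=
   (lam * i0%:R * expR (lam * i0%:R ^+ 2))%:E * \int[leb2 R]_(z in Omega) `|(u z / s)%R|%:E +
   (8 * (2 * M) / s * 2^-1 ^+ i0)%:E)%E.
Proof. exact: (moser_le mu iu Gam0 translate_le mO). Qed.

(** The drift from scale 0 is at most [16 M sqrt l], and the mean over the square of area 4 at scale
    0 is at most [M]. *)
Lemma H01_davg_le z l : (0 < l)%N -> `|davg u z l| <= 17 * M * Num.sqrt l%:R.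
Proof.
move=> l0; have ch := davg_chain mu measurable_grad_l1 iu grad_l1_ge0 Gam0 grad_l1_L2 poincare z 0 l.
have s1 : 1 <= Num.sqrt (l%:R : R) by rewrite -[leLHS]sqrtr1 ler_sqrt ?ler0n// ler1n.
have d0 : `|davg u z 0| <= M.
  have := davg_dist_le mu iu 0 z 0; rewrite sub0r normrN -EFinM /dside expr0 mulr1 => h.
  have : ((`|davg u z 0| * 2 ^+ 2)%:E <= (4 * M)%:E)%E.
    apply: (le_trans h); apply: le_trans (H01_L1_le Od uG M0 GM1 GM2).
    under eq_integral do rewrite sub0r normrN.
    apply: ge0_subset_integral => //; first exact: measurable_dsquare.
    exact: measurable_EFin_norm.
  by rewrite lee_fin; lra.
rewrite add0n in ch; have -> : davg u z l = (davg u z l - davg u z 0) + davg u z 0 by rewrite subrK.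
apply: le_trans (ler_normD _ _) _; apply: le_trans (lerD ch d0) _.
have := ler_wpM2l M0 s1; lra.
Qed.

(** Means of a single function are only bounded by a multiple of [sqrt l], so the scale [s] is taken
    proportional to [M] in place of smallness. *)
Lemma H01_exp_integrable : exists s : R, 0 < s /\
  (\int[leb2 R]_(z in Omega) (expR ((u z / s) ^+ 2) - 1)%:E <= 1)%E.
Proof.
(* With [lam = 1] and [m = 4] the hypothesis on the means asks for [s >= 17 M * 2 * sqrt 18], and
   [sqrt 18 <= 5]. The summand 1 keeps [s] positive when [M = 0]. *)
pose s := 170 * M + 1; have s0 : 0 < s by rewrite /s ltr_wpDl// mulr_ge0.
exists s; split => //.
have sq : Num.sqrt (2 * (2 * 4).+1%:R) <= 5 :> R.
  rewrite -[leRHS]ger0_norm// -sqrtr_sqr ler_sqrt ?sqr_ge0//; lra.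
have sq0 : 0 < Num.sqrt (2 * (2 * 4).+1%:R) :> R by rewrite sqrtr_gt0 mulr_gt0.
have A z l : Omega z -> (0 < l)%N ->
    `|davg u z (1 * l)| <= s / (2 * Num.sqrt (2 * (2 * 4).+1%:R)) * Num.sqrt (1 * l)%:R.
  move=> _ l0; rewrite mul1n; apply: le_trans (H01_davg_le z l0) _.
  rewrite ler_wpM2r ?sqrtr_ge0// ler_pdivlMr ?mulr_gt0// /s.
  by have := ler_wpM2l M0 sq; lra.
have l1 : 0 <= 1 :> R by [].
have l4 : 4 * 1 <= 4%:R :> R by rewrite mulr1.
have := @H01_moser_le 1 s 4 1 1 l1 l4 s0 isT isT isT A.
under [X in (X <= _)%E -> _]eq_integral do rewrite mul1r.
move=> /le_trans; apply.
have us : (\int[leb2 R]_(z in Omega) `|(u z / s)%R|%:E <= (4 * M / s)%:E)%E.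
  apply: (@le_trans _ _ (\int[leb2 R]_(z in Omega) ((s^-1)%:E * `|u z|%:E))%E).
    rewrite le_eqVlt; apply/orP; left; apply/eqP; apply: eq_integral => z _.
    by rewrite normrM [X in (_ * X)%:E]gtr0_norm ?invr_gt0// mulrC EFinM.
  have mn : measurable_fun [set: mplane R] (fun z => `|u z|%:E).
    exact: measurable_EFin_norm.
  rewrite ge0_integralZl//; last 2 first.
  - exact: measurable_funTS.
  - by rewrite lee_fin invr_ge0 ltW.
  rewrite mulrC EFinM; apply: lee_wpmul2l; first by rewrite lee_fin invr_ge0 ltW.
  apply: le_trans (H01_L1_le Od uG M0 GM1 GM2).
  exact: ge0_subset_integral.
have e4 := expR1_le4 R; have e0 := expR_ge0 (1 : R).
apply: (@le_trans _ _ (4%:E * (4 * M / s)%:E + (8 * (2 * M) / s * 2^-1 ^+ 1)%:E)%E).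
  apply: leeD => //; rewrite !mul1r expr1n; apply: lee_pmul => //.
  by apply: integral_ge0 => z _; rewrite lee_fin.
rewrite -EFinM -EFinD lee_fin expr1.
have -> : 4 * (4 * M / s) + 8 * (2 * M) / s * 2^-1 = (24 * M) / s by field; rewrite gt_eqF.
by rewrite ler_pdivrMr// mul1r /s; have := M0; lra.
Qed.

End single_function.

(** * Sequences with bounded gradients *)

Section sequences.
Variable R : realType.
Variables (Omega : set (R * R)) (u : nat -> R * R -> R) (G : nat -> R * R -> R * R)
  (M : nat -> R) (B : R).
Hypotheses (Oh : Omega `<=` disk 2^-1) (mO : measurable (Omega : set (mplane R))).
Hypotheses (Onz : Omega !=set0) (u_Dweak : D_weakly_cvg0 Omega u).
Hypothesis uG : forall k, H01_grad Omega (u k) (G k).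
Hypotheses (M0 : forall k, 0 <= M k) (MB : forall k, M k <= B).
Hypothesis GM1 : forall k, (\int[leb2 R]_z ((G k z).1 ^+ 2)%:E <= (M k ^+ 2)%:E)%E.
Hypothesis GM2 : forall k, (\int[leb2 R]_z ((G k z).2 ^+ 2)%:E <= (M k ^+ 2)%:E)%E.

Let B0 : 0 <= B. Proof. exact: le_trans (M0 0) (MB 0). Qed.

(** First [q] is chosen from the gradient bound [B] so that the error term is at most [eps / 2].
    This fixes the sector, and only then is the functional tested, uniformly over all
    [gop (q * l) z]. *)
Lemma davg_uniform_small (eps : R) : 0 < eps -> exists q k0 : nat, (0 < q)%N /\
  forall k, (k0 <= k)%N -> forall z l, Omega z -> (0 < l)%N ->
    `|davg (u k) z (q * l)| <= eps * Num.sqrt (q * l)%:R.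
Proof.
move=> e0; pose c := 4608 * (2 * B) / (eps / 2).
have h4608 : 0 <= 4608 :> R by exact: ler0n.
have e20 : 0 < eps / 2 by rewrite divr_gt0.
have c0 : 0 <= c by apply: divr_ge0; [apply: mulr_ge0 => //; exact: mulr_ge0|exact: ltW].
pose q := (Num.truncn (c ^+ 2)).+1.
have cq : c <= Num.sqrt q%:R.
  by rewrite -[leLHS]ger0_norm// -sqrtr_sqr ler_sqrt ?ler0n// ltW// truncnS_gt.
have q0 : 0 < q%:R :> R by rewrite ltr0n.
have sq0 : 0 < Num.sqrt (q%:R : R) by rewrite sqrtr_gt0.
have mS := @measurable_sector_piece R q.
(* Multiplied by the factor [32 q / 3], this threshold is [eps / 2]. *)
have d0 : 0 < 3 * eps / (64 * q%:R) by rewrite divr_gt0 ?mulr_gt0.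
have [k0 hk] := D_weak_uniform Onz u_Dweak (Rintegral_bounded_functional mS) d0.
exists q, k0; split => // k k0k z l Oz l0.
apply: le_trans (H01_davg_sector_le Oh (uG k) (M0 k) (GM1 k) (GM2 k) z (ltn0Sn _) l0) _.
rewrite mulrC ler_wpM2r ?sqrtr_ge0//.
have gO : opset Omega (gop (q * l) z).
  by exists (q * l)%N, z; split => //; [rewrite muln_gt0|exact: subset_closure].
have h1 := ltW (hk k k0k _ gO); rewrite -/(sector_mean q _) in h1.
have h2 : 4608 * (2 * M k) / Num.sqrt q%:R <= eps / 2.
  rewrite ler_pdivrMr//; apply: (@le_trans _ _ (4608 * (2 * B))).
    by rewrite ler_wpM2l// ler_wpM2l.
  by rewrite [leRHS]mulrC -ler_pdivrMr.
have h3 : 32 * q%:R / 3 * `|sector_mean q (gop (q * l) z (u k))| <= eps / 2.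
  apply: le_trans (ler_wpM2l _ h1) _; first by rewrite divr_ge0 ?mulr_ge0// ltW.
  by rewrite le_eqVlt; apply/orP; left; apply/eqP; field; rewrite gt_eqF.
by have := lerD h3 h2; rewrite -splitr.
Qed.

(** The scale 0 is excluded because its square circumscribes the disk. *)
Lemma dsquare_disk n : (0 < n)%N -> dsquare (0 : R * R) n `<=` disk 1.
Proof.
move=> n0 z /dsquareE[]; rewrite !subr0 => z1 z2.
have e2 : (2^-1 : R) ^+ n <= 2^-1.
  by rewrite -[leRHS]expr1; apply: ler_wiXn2l; rewrite ?invr_ge0//; lra.
have s1 : z.1 ^+ 2 < 4^-1.
  by rewrite -real_normK ?num_real//; have := normr_ge0 z.1; move: (`|z.1|) z1 => x; nra.
have s2 : z.2 ^+ 2 < 4^-1.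
  by rewrite -real_normK ?num_real//; have := normr_ge0 z.2; move: (`|z.2|) z2 => x; nra.
rewrite /disk/= /euclid -(ltr_pXn2r (n := 2))// ?nnegrE// expr1n sqr_sqrtr ?addr_ge0 ?sqr_ge0//.
by lra.
Qed.

(** Within the disk the truncation in [gop] is invisible, so a mean centred at [z] is a fixed
    functional evaluated at an operator of order 1. *)
Lemma davg_gop1 (v : R * R -> R) z n : measurable_fun [set: mplane R] v -> (0 < n)%N ->
  davg v z n = Rintegral (leb2 R) (dsquare (0 : R * R) n) (gop 1 z v) / dside R n ^+ 2.
Proof.
move=> mv n0; rewrite /davg -/(Rintegral _ _ _); congr (_ / _).
rewrite Rintegral_mkcond [RHS]Rintegral_mkcond.
have mS := measurable_dsquare z n.
have mf : measurable_fun [set: mplane R] (v \_ (dsquare z n)).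
  by apply/(measurable_restrictT _ _).1 => //; exact: measurable_funTS.
rewrite -(Rintegral_translate z mf); apply: eq_Rintegral => p _; rewrite /patch.
have -> : (p + z \in dsquare z n) = (p \in dsquare (0 : R * R) n).
  by apply/idP/idP => /set_mem/dsquareE[h1 h2]; apply/mem_set/dsquareE;
    move: h1 h2; rewrite addpE/= ?addrK ?subr0 ?addr0//; rewrite addrK.
case: ifPn => // /set_mem pS; rewrite /gop /patch mem_set; last exact: (dsquare_disk n0).
rewrite powR1 mul1r (_ : cpow p 1 = p); last by case: (p) => x y; rewrite /cpow expr1.
by rewrite (addrC (z : R * R)).
Qed.

(** At one fine scale [n], fixed by [B] and [eta], the distance from [u k] to its means costs at
    most [4 B 2^-n <= eta / 2]; the means, uniformly at most [eta / 8] for large [k], cost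
    [4 * eta / 8]. *)
Lemma L1_small (eta : R) : 0 < eta -> exists k0, forall k, (k0 <= k)%N ->
  (\int[leb2 R]_(z in Omega) `|u k z|%:E <= eta%:E)%E.
Proof.
move=> e0; have B4 : 0 <= 4 * B by rewrite mulr_ge0.
have [N hN] := half_pow_small B4 (divr_gt0 e0 (ltr0n R 2)).
pose n := N.+1; have d0 := dside_gt0 R n.
have hn := hN n (leqnSn N).
have t0 : 0 < eta / 8 * dside R n ^+ 2 by rewrite mulr_gt0 ?exprn_gt0// divr_gt0.
have mS := measurable_dsquare (0 : R * R) n.
have [k0 hk] := D_weak_uniform Onz u_Dweak (Rintegral_bounded_functional mS) t0.
exists k0 => k k0k; have [mu _ _ _ _] := uG k.
have e8 : 0 <= eta / 8 by rewrite divr_ge0// ltW.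
have A z : Omega z -> `|davg (u k) z n| <= eta / 8.
  move=> Oz; have gO : opset Omega (gop 1 z) by exists 1%N, z; split => //; exact: subset_closure.
  rewrite (davg_gop1 z mu (ltn0Sn N)) normrM [X in _ * X]gtr0_norm ?invr_gt0 ?exprn_gt0//.
  by rewrite ler_pdivrMr ?exprn_gt0// ltW//; exact: hk.
apply: le_trans (H01_L1_le_davg Oh mO (uG k) (M0 k) (GM1 k) (GM2 k) e8 A) _.
rewrite lee_fin /dside.
have p0 : 0 <= (2^-1 : R) ^+ n by rewrite exprn_ge0.
have := ler_wpM2r p0 (MB k); have -> : 2 * 2^-1 ^+ n * (2 * M k) = 4 * (M k * 2^-1 ^+ n) by ring.
move: hn; rewrite -mulrA; lra.
Qed.

Lemma exp_integral_cvg0 (lam : R) : 0 < lam ->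
  (\int[leb2 R]_(z in Omega) (expR (lam * u k z ^+ 2) - 1)%:E)%E @[k --> \oo] --> 0%E.
Proof.
move=> l0; apply: cvg0_ereal => [k|e e0].
  apply: integral_ge0 => z _; rewrite lee_fin subr_ge0.
  by apply: le_trans (expR_ge1Dx _); rewrite lerDl mulr_ge0 ?sqr_ge0// ltW.
pose m := (Num.truncn (4 * lam)).+1.
have lm : 4 * lam <= m%:R by rewrite ltW// truncnS_gt.
(* The smallness that the level set estimate requires for [s = 1]. *)
pose eps : R := 1 / (2 * Num.sqrt (2 * (2 * m).+1%:R)).
have eps0 : 0 < eps by rewrite divr_gt0// mulr_gt0// sqrtr_gt0 mulr_gt0.
have [q [k1 [q0 hq]]] := davg_uniform_small eps0.
have B16 : 0 <= 16 * B by rewrite mulr_ge0.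
have [N hN] := half_pow_small B16 (divr_gt0 e0 (ltr0n R 2)).
(* [N] makes the geometric tail at most [e / 2] and [q] ensures [q <= K i0^2]. As [i0] does not
   depend on [k], the constant in front of the L^1 norm is fixed before that norm is made small. *)
pose i0 := (N + q)%N.
have i00 : (0 < i0)%N by rewrite addn_gt0 q0 orbT.
have qi : (q <= (2 * m).+1 * i0 ^ 2)%N.
  by apply: (@leq_trans i0); [exact: leq_addl|rewrite -mulnn mulnA leq_pmull// muln_gt0].
pose c := lam * i0%:R * expR (lam * i0%:R ^+ 2).
have c0 : 0 < c by rewrite !mulr_gt0 ?expR_gt0// ltr0n.
have [k2 hk2] := L1_small (divr_gt0 (divr_gt0 e0 (ltr0n R 2)) c0).
exists (maxn k1 k2) => k; rewrite geq_max => /andP[k1k k2k].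
have := H01_moser_le Oh mO (uG k) (M0 k) (GM1 k) (GM2 k) (ltW l0) lm ltr01 q0 i00 qi (hq k k1k).
have -> : (\int[leb2 R]_(z in Omega) (expR (lam * (u k z / 1) ^+ 2) - 1)%:E =
    \int[leb2 R]_(z in Omega) (expR (lam * u k z ^+ 2) - 1)%:E)%E.
  by apply: eq_integral => z _; rewrite divr1.
have -> : (\int[leb2 R]_(z in Omega) `|(u k z / 1)%R|%:E = \int[leb2 R]_(z in Omega) `|u k z|%:E)%E.
  by apply: eq_integral => z _; rewrite divr1.
move=> /le_trans; apply.
apply: (@le_trans _ _ (c%:E * (e / 2 / c)%:E + (e / 2)%:E)%E).
  apply: leeD.
    by apply: lee_wpmul2l; [rewrite lee_fin ltW|exact: hk2].
  rewrite lee_fin divr1; apply: le_trans (hN i0 (leq_addr _ _)).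
  by rewrite ler_wpM2r ?exprn_ge0//; have := MB k; lra.
by rewrite -EFinM -EFinD lee_fin mulrC divfK ?gt_eqF// -splitr.
Qed.

End sequences.

Unset Implicit Arguments.

Theorem theorem2p6 (R : realType) (Omega : set (R * R))
    (Omega_domain : domain Omega) (Omega_sub : Omega `<=` disk (2^-1))
    (u : nat -> R * R -> R) (u_H01 : forall k, H01 Omega (u k))
    (u_Dweak : D_weakly_cvg0 Omega u) :
  expL2_cvg0 Omega u /\
  (forall lambda : R, 0 < lambda ->
     (\int[leb2 R]_(z in Omega) (expR (lambda * u k z ^+ 2) - 1)%:E)%E
       @[k --> \oo] --> 0%E).
Proof.
have mO : measurable (Omega : set (mplane R)) by apply: open_measurable_plane; case: Omega_domain.
pose G k := projT1 (cid (u_H01 k)).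
have uG k : H01_grad Omega (u k) (G k) by rewrite /G; case: cid.
pose cM k := cid2 (H01_L2 (half_disk Omega_sub) (uG k)).
pose M k := s2val (cM k).
have M0 k : 0 <= M k by rewrite /M; case: (cM k).
have GM k : [/\ (\int[leb2 R]_z (u k z ^+ 2)%:E < +oo)%E,
      L2norm (fun z => euclid (G k z)) = (M k)%:E,
      (\int[leb2 R]_z ((G k z).1 ^+ 2)%:E + \int[leb2 R]_z ((G k z).2 ^+ 2)%:E = (M k ^+ 2)%:E)%E,
      (\int[leb2 R]_z ((G k z).1 ^+ 2)%:E <= (M k ^+ 2)%:E)%E &
      (\int[leb2 R]_z ((G k z).2 ^+ 2)%:E <= (M k ^+ 2)%:E)%E].
  by rewrite /M; case: (cM k).
have GMs k := let: And5 _ _ x _ _ := GM k in x.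
have GM1 k := let: And5 _ _ _ x _ := GM k in x.
have GM2 k := let: And5 _ _ _ _ x := GM k in x.
have cvg : forall lambda : R, 0 < lambda ->
    (\int[leb2 R]_(z in Omega) (expR (lambda * u k z ^+ 2) - 1)%:E)%E @[k --> \oo] --> 0%E.
  (* The definition of a domain admits the empty set, which contains no centre [zeta]. *)
  move=> lambda l0; have [->|/set0P [zeta Oz]] := eqVneq Omega set0.
    by under eq_fun do rewrite integral_set0; exact: cvg_cst.
  have [B MB] := gradient_norm_bounded Omega_sub Oz uG M0 GMs GM1 GM2 u_Dweak.
  have Onz : Omega !=set0 by exists zeta.
  exact: (exp_integral_cvg0 Omega_sub mO Onz u_Dweak uG M0 MB GM1 GM2 l0).
split => //; apply: expL2_cvg0_of_integral => // k.
exact: (H01_exp_integrable Omega_sub mO (uG k) (M0 k) (GM1 k) (GM2 k)).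
Qed.
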